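(* Let $V$ be a set of $n$ vertices, and let $\sigma=e_1,\ldots,e_m$ be a sequence of distinct directed edges on $V$ with weights in $[1,W]$, arriving online one at a time. Before any edge arrives, the algorithm receives a prediction $\hat\sigma$ which is a permutation of $\sigma$. For an edge $e$ let $\mathrm{index}(e)$ and $\widehat{\mathrm{index}}(e)$ be its positions in $\sigma$ and $\hat\sigma$, and let $\eta=\max_e|\mathrm{index}(e)-\widehat{\mathrm{index}}(e)|$. At any time $t$ (after $t$ insertions) the algorithm may be queried with a pair $(i,j)$ of vertices and must return a value between $d^t(i,j)$ and $(1+\epsilon)d^t(i,j)$, where $d^t(i,j)$ is the shortest-path distance from $i$ to $j$ in the graph on $V$ with edges $e_1,\ldots,e_t$. Then there is a learned online all-pairs shortest-path algorithm with $\tilde O(nm\log W/\epsilon)$ preprocessing time, $O(\log n)$ worst-case update time per edge insertion, and $O(\eta^2\log\log_{1+\epsilon}(nW))$ worst-case query time.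
   Context: $\epsilon>0$ is an approximation parameter with $\epsilon=O(1)$. The $\tilde O$ notation suppresses logarithmic factors. Path lengths are sums of edge weights. *)

(* Defs.v *)
From Stdlib Require Import Reals List Permutation Arith Lia.
From Coquelicot Require Import Rbar Lub.
Import ListNotations.
Open Scope R_scope.

(* The vertex set of size n is {0, ..., n-1}. *)
Record edge : Type := Edge { tail : nat; head : nat; weight : R }.

Definition ends (e : edge) : nat * nat := (tail e, head e).

(* Distinctness is that of the ordered pairs of end points: there are no
   parallel edges, even with different weights. *)
Definition edge_sequence (n : nat) (W : R) (s : list edge) : Prop :=
  NoDup (map ends s) /\
  forall e, In e s ->
    (tail e < n)%nat /\ (head e < n)%nat /\ 1 <= weight e <= W.

Inductive path (G : list edge) : nat -> nat -> R -> Prop :=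
| path_nil i : path G i i 0
| path_cons e j l :
    In e G -> path G (head e) j l -> path G (tail e) j (weight e + l).

(* Infimum of the path lengths, hence [p_infty] if j is not reachable. *)
Definition dist (G : list edge) (i j : nat) : Rbar := Glb_Rbar (path G i j).

Definition same_ends (e f : edge) : bool :=
  Nat.eqb (tail e) (tail f) && Nat.eqb (head e) (head f).

Fixpoint index (e : edge) (s : list edge) : nat :=
  match s with
  | [] => 0
  | f :: s' => if same_ends e f then 0 else S (index e s')
  end.

Definition nat_dist (a b : nat) : nat := ((a - b) + (b - a))%nat.

Definition prediction_error (s sh : list edge) : nat :=
  list_max (map (fun e => nat_dist (index e s) (index e sh)) s).

(* A word RAM with exact real cells.
   Programs are finite pieces of syntax. Integer cells hold w-bit words and
    are the only ones usable as addresses; real cells support exact field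
    operations and comparisons, but no rounding to integers. Every node of an
    expression and every command that is executed costs one unit. *)

Record state : Type := State {
  ivar : nat -> nat;
  rvar : nat -> R;
  imem : nat -> nat;
  rmem : nat -> R }.

Inductive iexp : Type :=
| IConst (z : nat)
| IVar (x : nat)
| ILoad (a : iexp)
| IAdd (a b : iexp)
| ISub (a b : iexp)
| IMul (a b : iexp)
| IDiv (a b : iexp).

Inductive rexp : Type :=
| RVar (x : nat)
| RLoad (a : iexp)
| ROfInt (a : iexp)
| RAdd (a b : rexp)
| RSub (a b : rexp)
| RMul (a b : rexp)
| RDiv (a b : rexp).

Inductive bexp : Type :=
| BILe (a b : iexp)
| BIEq (a b : iexp)
| BRLe (a b : rexp)
| BNot (a : bexp)
| BAnd (a b : bexp).

Inductive com : Type :=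
| Skip
| ISet (x : nat) (a : iexp)
| RSet (x : nat) (a : rexp)
| IStore (p : iexp) (a : iexp)
| RStore (p : iexp) (a : rexp)
| Seq (c d : com)
| If (b : bexp) (c d : com)
| While (b : bexp) (c : com).

(* Constants, sums and products are reduced modulo 2^w; subtraction is
   truncated at 0. *)
Fixpoint ieval (w : nat) (s : state) (e : iexp) : nat :=
  match e with
  | IConst z => (z mod 2 ^ w)%nat
  | IVar x => ivar s x
  | ILoad a => imem s (ieval w s a)
  | IAdd a b => ((ieval w s a + ieval w s b) mod 2 ^ w)%nat
  | ISub a b => (ieval w s a - ieval w s b)%nat
  | IMul a b => ((ieval w s a * ieval w s b) mod 2 ^ w)%nat
  | IDiv a b => (ieval w s a / ieval w s b)%nat
  end.

Fixpoint reval (w : nat) (s : state) (e : rexp) : R :=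
  match e with
  | RVar x => rvar s x
  | RLoad a => rmem s (ieval w s a)
  | ROfInt a => INR (ieval w s a)
  | RAdd a b => reval w s a + reval w s b
  | RSub a b => reval w s a - reval w s b
  | RMul a b => reval w s a * reval w s b
  | RDiv a b => reval w s a / reval w s b
  end.

Fixpoint beval (w : nat) (s : state) (e : bexp) : bool :=
  match e with
  | BILe a b => Nat.leb (ieval w s a) (ieval w s b)
  | BIEq a b => Nat.eqb (ieval w s a) (ieval w s b)
  | BRLe a b => if Rle_dec (reval w s a) (reval w s b) then true else false
  | BNot a => negb (beval w s a)
  | BAnd a b => beval w s a && beval w s b
  end.

Fixpoint icost (e : iexp) : nat :=
  match e with
  | IConst _ | IVar _ => 1
  | ILoad a => S (icost a)
  | IAdd a b | ISub a b | IMul a b | IDiv a b => S (icost a + icost b)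
  end.

Fixpoint rcost (e : rexp) : nat :=
  match e with
  | RVar _ => 1
  | RLoad a | ROfInt a => S (icost a)
  | RAdd a b | RSub a b | RMul a b | RDiv a b => S (rcost a + rcost b)
  end.

Fixpoint bcost (e : bexp) : nat :=
  match e with
  | BILe a b | BIEq a b => S (icost a + icost b)
  | BRLe a b => S (rcost a + rcost b)
  | BNot a => S (bcost a)
  | BAnd a b => S (bcost a + bcost b)
  end.

Definition upd {A : Type} (f : nat -> A) (x : nat) (v : A) : nat -> A :=
  fun y => if Nat.eqb y x then v else f y.

Definition set_ivar s x v := State (upd (ivar s) x v) (rvar s) (imem s) (rmem s).
Definition set_rvar s x v := State (ivar s) (upd (rvar s) x v) (imem s) (rmem s).
Definition set_imem s p v := State (ivar s) (rvar s) (upd (imem s) p v) (rmem s).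
Definition set_rmem s p v := State (ivar s) (rvar s) (imem s) (upd (rmem s) p v).

(* [exec w c s k s']: with w-bit words, c started in s halts in s' at cost k. *)
Inductive exec (w : nat) : com -> state -> nat -> state -> Prop :=
| exec_skip s : exec w Skip s 1 s
| exec_iset s x a :
    exec w (ISet x a) s (S (icost a)) (set_ivar s x (ieval w s a))
| exec_rset s x a :
    exec w (RSet x a) s (S (rcost a)) (set_rvar s x (reval w s a))
| exec_istore s p a :
    exec w (IStore p a) s (S (icost p + icost a))
      (set_imem s (ieval w s p) (ieval w s a))
| exec_rstore s p a :
    exec w (RStore p a) s (S (icost p + rcost a))
      (set_rmem s (ieval w s p) (reval w s a))
| exec_seq c d s k s' l s'' :
    exec w c s k s' -> exec w d s' l s'' -> exec w (Seq c d) s (S (k + l)) s''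
| exec_if b c d s k s' :
    exec w (if beval w s b then c else d) s k s' ->
    exec w (If b c d) s (S (bcost b + k)) s'
| exec_while_end b c s :
    beval w s b = false -> exec w (While b c) s (S (bcost b)) s
| exec_while_step b c s k s' l s'' :
    beval w s b = true -> exec w c s k s' -> exec w (While b c) s' l s'' ->
    exec w (While b c) s (S (bcost b + k + l)) s''.

Lemma exec_det w c s k s' l s'' :
  exec w c s k s' -> exec w c s l s'' -> k = l /\ s' = s''.
Proof.
intros H; revert l s''.
induction H; intros l0 s0 E0; inversion E0; subst; auto; try congruence;
  repeat match goal with
  | IH : (forall l s, exec w ?c ?a l s -> _), E : exec w ?c ?a _ _ |- _ =>
      destruct (IH _ _ E); subst; clear E
  end; auto.
Qed.

Definition runs_within (w : nat) (c : com) (s : state) (T : R)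
    (Q : state -> Prop) : Prop :=
  exists k s', exec w c s k s' /\ INR k <= T /\ Q s'.

(* What the preprocessing starts from: n, m, eps, W in variables, the predicted
   edges in memory (end points of the k-th one at addresses 2k and 2k+1, its
   weight at address k), and 0 in every other cell. *)
Definition input (n : nat) (W eps : R) (sh : list edge) : state :=
  State
    (fun x => match x with 0 => n | 1 => length sh | _ => 0 end)%nat
    (fun x => match x with 0%nat => eps | 1%nat => W | _ => 0 end)
    (fun a => nth a (flat_map (fun e => [tail e; head e]) sh) 0%nat)
    (fun a => nth a (map weight sh) 0).

Inductive event : Type :=
| Insert (e : edge)
| Query (i j : nat).

Definition insertions (evs : list event) : list edge :=
  flat_map (fun ev => match ev with Insert e => [e] | Query _ _ => [] end) evs.

Definition pass_edge (s : state) (e : edge) : state :=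
  set_rvar (set_ivar (set_ivar s 2 (tail e)) 3 (head e)) 2 (weight e).

Definition pass_query (s : state) (i j : nat) : state :=
  set_ivar (set_ivar s 2 i) 3 j.

(* Variable 4 tells whether the answer is finite. *)
Definition answer (s : state) : Rbar :=
  if Nat.eqb (ivar s 4) 0 then p_infty else Finite (rvar s 3).

(* From state s, in which the edges of G have been inserted, the events are
   processed in order: insertions take time at most Tupd, queries take time at
   most Tqry and are answered within a factor 1 + eps. Updates and queries run
   on the state left by the preceding event. *)
Fixpoint serves (w : nat) (update query : com) (Tupd Tqry eps : R)
    (G : list edge) (evs : list event) (s : state) : Prop :=
  match evs with
  | [] => True
  | Insert e :: evs' =>
      runs_within w update (pass_edge s e) Tupd (fun s' =>
        serves w update query Tupd Tqry eps (G ++ [e]) evs' s')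
  | Query i j :: evs' =>
      runs_within w query (pass_query s i j) Tqry (fun s' =>
        Rbar_le (dist G i j) (answer s') /\
        Rbar_le (answer s') (Rbar_mult (Finite (1 + eps)) (dist G i j)) /\
        serves w update query Tupd Tqry eps G evs' s')
  end.

(* Asymptotic bounds are meant for parameters on which their factors do not
    degenerate; elsewhere (an empty sequence, one vertex, W = 1, a perfect
    prediction) each degenerate factor is read as 1. *)

Definition ge1 (x : R) : R := Rmax 1 x.

Definition log_base (b x : R) : R := ln x / ln b.

Definition preprocessing_size (n m : nat) (W eps : R) : R :=
  ge1 (INR n) * ge1 (INR m) * ge1 (ln W) / eps.

(* f times a power of log f, as meant by soft O. *)
Definition soft (k : nat) (f : R) : R := f * ge1 (ln f) ^ k.

Definition update_size (n : nat) : R := ge1 (ln (INR n)).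

Definition query_size (n eta : nat) (W eps : R) : R :=
  ge1 (INR eta) ^ 2 * ge1 (ln (log_base (1 + eps) (INR n * W))).

(* Words have a logarithmic number of bits: enough, up to the constant factor c,
   to address n, m and the log_{1+eps}(nW) distance scales. *)
Definition word_size_ok (c n m : nat) (W eps : R) (w : nat) : Prop :=
  (INR n + INR m + log_base (1 + eps) (INR n * W) + 2) ^ c <= 2 ^ w.

(* Main.v *)
From Pilot Require Import Defs.
From Stdlib Require Import Reals List Permutation.
From Stdlib Require Import Arith Lia Lra Classical FunctionalExtensionality.
From Coquelicot Require Import Rbar Lub Rcomplements.
Import ListNotations.
(* [List] shadows the projections [tail] and [head]. *)
Import Pilot.Defs.
Open Scope R_scope.
Open Scope nat_scope.

(** The predicted sequence is preprocessed offline: for every source, every vertex and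
    every number p, an estimate of the distance after the first p predicted edges, within
    a factor 1 + eps, can be looked up by a binary search.

    Estimates are rounded to the scales 0, 1, q, q^2, ... with q = 1 + O(eps / log m).
    For one source, the times at which they change are found by bisecting the time axis.
    At the midpoint of an interval only the vertices whose estimates differ at its two ends
    have to be recomputed, by a run of Dijkstra's algorithm on them which takes the (constant)
    estimates of the other vertices as boundary values. Each level of the bisection loses
    one factor q, and since the estimates of a vertex decrease along the time axis, on each
    level it is recomputed at most once per scale; hence the total cost is that of
    O(log m) times the number of scales passes over the edges.

    Online, a prefix of p predicted edges is known to have been inserted, and advancing p
    by at most one per update keeps it at most eta behind the true time. The inserted edges
    outside of this prefix lie in a window of length 2 eta of the predicted order. A query
    runs the quadratic version of Dijkstra's algorithm on these edges, using the table for
    the distances between their end points inside the prefix. *)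

(** * A cost logic for the word RAM *)

(** Errors do not accumulate along paths. Upper estimates are witnessed by paths, and lower bounds
    have the form estimate <= c * length with a single factor c for all vertices, which survives
    both the addition of an edge and the concatenation of pieces. Hence the runs of Dijkstra's
    algorithm lose nothing, only the rounding at a midpoint multiplies c by q, and a query loses
    nothing beyond the factor of the table. With K levels it remains to arrange q^K <= 1 + eps,
    which explains q = 1 + eps / (c0 (K + 1)) with c0 depending on [eps_max] only. A vertex with
    equal scales at both ends of an interval is settled at the midpoint: its upper bound comes from
    the earlier end, its lower bound from the later one. The table stores the time at which each
    scale is reached, so that a lookup searches among the scales; their number is polynomial in
    log_{1+eps} (nW) because m <= n * n. The prefix cannot lag by more than eta: the edge that
    blocks it has not arrived, so its true position is not before the current time, and its
    predicted position is at most eta smaller. *)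

(* Array j of a program occupies the cells 32 (m + i) + j, all beyond the input. *)
Definition Ad (j : nat) (a : iexp) : iexp :=
  IAdd (IMul (IAdd (IVar 1) a) (IConst 32)) (IConst j).
Definition Ld (j : nat) (a : iexp) : iexp := ILoad (Ad j a).
Definition RLd (j : nat) (a : iexp) : rexp := RLoad (Ad j a).
Definition St (j : nat) (a e : iexp) : com := IStore (Ad j a) e.
Definition RSt (j : nat) (a : iexp) (e : rexp) : com := RStore (Ad j a) e.

Definition inb (x : nat) (l : list nat) : bool := existsb (Nat.eqb x) l.

(** The arrays that a store to address [p] can reach: the one named in the text if [p] has the shape
    produced by [Ad], and conservatively all 32 otherwise. *)
Definition arr_of (p : iexp) : list nat :=
  match p with
  | IAdd (IMul _ (IConst z)) (IConst j) => if andb (Nat.eqb z 32) (Nat.ltb j 32) then [j] else seq 0 32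
  | _ => seq 0 32
  end.

Fixpoint modi (c : com) : list nat :=
  match c with
  | ISet x _ => [x]
  | Seq c d | If _ c d => modi c ++ modi d
  | While _ c => modi c
  | _ => []
  end.
Fixpoint modr (c : com) : list nat :=
  match c with
  | RSet x _ => [x]
  | Seq c d | If _ c d => modr c ++ modr d
  | While _ c => modr c
  | _ => []
  end.
Fixpoint modia (c : com) : list nat :=
  match c with
  | IStore p _ => arr_of p
  | Seq c d | If _ c d => modia c ++ modia d
  | While _ c => modia c
  | _ => []
  end.
Fixpoint modra (c : com) : list nat :=
  match c with
  | RStore p _ => arr_of p
  | Seq c d | If _ c d => modra c ++ modra d
  | While _ c => modra c
  | _ => []
  end.

Lemma inb_app x l l' : inb x (l ++ l') = orb (inb x l) (inb x l').
Proof. apply existsb_app. Qed.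

(* An alias of [upd] for arrays, which reduction leaves alone. *)
Definition aset {A : Type} (f : nat -> A) (i : nat) (v : A) : nat -> A := upd f i v.

Lemma aset_eq {A} (f : nat -> A) i v : aset f i v i = v.
Proof. unfold aset, upd. now rewrite Nat.eqb_refl. Qed.

Lemma aset_neq {A} (f : nat -> A) i v x : x <> i -> aset f i v x = f x.
Proof. intros H. unfold aset, upd. now apply Nat.eqb_neq in H; rewrite H. Qed.

Section Logic.
Variables (w m : nat).

Definition ia (s : state) (j : nat) : nat -> nat := fun i => imem s (32 * (m + i) + j).
Definition ra (s : state) (j : nat) : nat -> R := fun i => rmem s (32 * (m + i) + j).

Definition set_ia (s : state) (j i v : nat) : state := set_imem s (32 * (m + i) + j) v.
Definition set_ra (s : state) (j i : nat) (v : R) : state := set_rmem s (32 * (m + i) + j) v.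

(* What [c] leaves unchanged can be read off its text: array j is the only one with
   addresses congruent to j modulo 32, even if an address computation overflows. *)
Record frame (c : com) (s s' : state) : Prop := Frame {
  fr_i : forall x, inb x (modi c) = false -> ivar s' x = ivar s x;
  fr_r : forall x, inb x (modr c) = false -> rvar s' x = rvar s x;
  fr_ia : forall j, Nat.ltb j 32 = true -> inb j (modia c) = false -> ia s' j = ia s j;
  fr_ra : forall j, Nat.ltb j 32 = true -> inb j (modra c) = false -> ra s' j = ra s j }.

Lemma frame_refl c s : frame c s s.
Proof. now constructor. Qed.

Lemma frame_trans c s s' s'' : frame c s s' -> frame c s' s'' -> frame c s s''.
Proof.
intros [A B C D] [A' B' C' D']; constructor; intros.
- now rewrite A', A. - now rewrite B', B. - now rewrite C', C. - now rewrite D', D.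
Qed.

Lemma frame_sub c d s s' :
  (forall x, inb x (modi c) = true -> inb x (modi d) = true) ->
  (forall x, inb x (modr c) = true -> inb x (modr d) = true) ->
  (forall x, inb x (modia c) = true -> inb x (modia d) = true) ->
  (forall x, inb x (modra c) = true -> inb x (modra d) = true) ->
  frame c s s' -> frame d s s'.
Proof.
intros h1 h2 h3 h4 [A B C D]; constructor; intros.
- apply A. specialize (h1 x). destruct (inb x (modi c)); auto. now rewrite h1 in H.
- apply B. specialize (h2 x). destruct (inb x (modr c)); auto. now rewrite h2 in H.
- apply C; auto. specialize (h3 j). destruct (inb j (modia c)); auto. now rewrite h3 in H0.
- apply D; auto. specialize (h4 j). destruct (inb j (modra c)); auto. now rewrite h4 in H0.
Qed.

Lemma pow_32 : 6 <= w -> exists q, 2 ^ w = 32 * q /\ 2 <= q.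
Proof. intros w6.
exists (2 ^ (w - 5)). split.
- change 32 with (2 ^ 5). rewrite <- Nat.pow_add_r. f_equal. lia.
- change 2 with (2 ^ 1) at 1. apply Nat.pow_le_mono_r; lia.
Qed.

Lemma mod_mod_32 a q : (a mod (32 * q)) mod 32 = a mod 32.
Proof.
rewrite (Nat.div_mod_eq a (32 * q)) at 2.
replace (32 * q * (a / (32 * q)) + a mod (32 * q))
  with (a mod (32 * q) + q * (a / (32 * q)) * 32) by lia.
now rewrite Nat.Div0.mod_add.
Qed.

(** As 32 divides 2^w, reduction modulo 2^w preserves residues modulo 32, so an address of the shape
    [Ad j] stays congruent to [j] even after an overflow. The bound on [w] keeps the constants 32
    and [j] themselves unreduced. *)
Lemma arr_of_miss s p j i : 6 <= w ->
  j < 32 -> inb j (arr_of p) = false -> ieval w s p <> 32 * (m + i) + j.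
Proof. intros w6.
intros Hj H.
assert (Hall : inb j (seq 0 32) = true).
{ apply existsb_exists. exists j. split; [apply in_seq; lia | apply Nat.eqb_refl]. }
destruct p; cbn [arr_of] in H; try congruence.
destruct p1; try congruence.
destruct p1_2; try congruence.
destruct p2; try congruence.
destruct (Nat.eqb_spec z 32); cbn [andb] in H; try congruence. subst z.
destruct (Nat.ltb_spec z0 32); try congruence.
cbn [ieval]. destruct (pow_32 w6) as [q [E Hq]]. rewrite E.
rewrite (Nat.mod_small 32), (Nat.mod_small z0) by lia.
unfold inb in H. cbn [existsb] in H. rewrite Bool.orb_false_r in H.
apply Nat.eqb_neq in H.
intros Hx. apply (f_equal (fun t => t mod 32)) in Hx.
rewrite mod_mod_32, Nat.Div0.add_mod, mod_mod_32, Nat.Div0.mod_mul in Hx.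
rewrite Nat.add_0_l, Nat.Div0.mod_mod in Hx.
replace (32 * (m + i) + j) with (j + (m + i) * 32) in Hx by lia.
rewrite Nat.Div0.mod_add, !Nat.mod_small in Hx by lia. congruence.
Qed.

Lemma exec_frame c s k s' : 6 <= w -> exec w c s k s' -> frame c s s'.
Proof.
intros w6. induction 1; try (now constructor).
- constructor; auto. intros y Hy. cbn in *. unfold upd.
  rewrite Bool.orb_false_r in Hy. now rewrite Hy.
- constructor; auto. intros y Hy. cbn in *. unfold upd.
  rewrite Bool.orb_false_r in Hy. now rewrite Hy.
- constructor; auto. intros j Hj Hy. apply functional_extensionality; intros i.
  unfold ia. cbn [set_imem imem modia] in *. unfold upd.
  destruct (Nat.eqb_spec (32 * (m + i) + j) (ieval w s p)) as [E|]; auto.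
  symmetry in E. apply (arr_of_miss _ _ _ _ w6) in E; try easy. now apply Nat.ltb_lt.
- constructor; auto. intros j Hj Hy. apply functional_extensionality; intros i.
  unfold ra. cbn [set_rmem rmem modra] in *. unfold upd.
  destruct (Nat.eqb_spec (32 * (m + i) + j) (ieval w s p)) as [E|]; auto.
  symmetry in E. apply (arr_of_miss _ _ _ _ w6) in E; try easy. now apply Nat.ltb_lt.
- apply frame_trans with s'; [eapply frame_sub, IHexec1 | eapply frame_sub, IHexec2];
    intros x Hx; cbn [modi modr modia modra]; rewrite inb_app, Hx; auto using Bool.orb_true_r.
- eapply frame_sub, IHexec;
    intros x Hx; cbn [modi modr modia modra]; rewrite inb_app; destruct (beval w s b); rewrite Hx;
    auto using Bool.orb_true_r.
- apply frame_trans with s'; [eapply frame_sub, IHexec1 | exact IHexec2]; auto.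
Qed.

(* [k0] is the cost already spent, [k'] an upper bound of the cost spent after [c]. *)
Definition wp (c : com) (s : state) (k0 : nat) (Q : state -> nat -> Prop) : Prop :=
  exists k s' k', exec w c s k s' /\ k0 + k <= k' /\ Q s' k'.

Definition tri (c : com) (s : state) (T : nat) (P : state -> Prop) : Prop :=
  wp c s 0 (fun s' k' => k' <= T /\ P s').

Lemma wp_seq c d s k0 Q :
  wp c s (S k0) (fun s' k' => wp d s' k' Q) -> wp (Seq c d) s k0 Q.
Proof.
intros (k & s' & k' & E & L & (k2 & s2 & k2' & E2 & L2 & H)).
exists (S (k + k2)), s2, k2'. repeat split; auto.
- econstructor; eauto. - lia.
Qed.

Lemma wp_skip s k0 Q : Q s (S k0) -> wp Skip s k0 Q.
Proof. intros H. exists 1, s, (S k0). split; [constructor | split; [lia | easy]]. Qed.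

Lemma wp_iset x a s k0 Q v c :
  S (icost a) = c -> ieval w s a = v -> Q (set_ivar s x v) (k0 + c) ->
  wp (ISet x a) s k0 Q.
Proof. intros <- <- H. do 3 eexists. split; [constructor|]. split; [|exact H]. lia. Qed.

Lemma wp_rset x a s k0 Q v c :
  S (rcost a) = c -> reval w s a = v -> Q (set_rvar s x v) (k0 + c) ->
  wp (RSet x a) s k0 Q.
Proof. intros <- <- H. do 3 eexists. split; [constructor|]. split; [|exact H]. lia. Qed.

Lemma wp_st j p e s k0 Q i v c :
  S (icost (Ad j p) + icost e) = c ->
  ieval w s (Ad j p) = 32 * (m + i) + j -> ieval w s e = v ->
  Q (set_ia s j i v) (k0 + c) -> wp (St j p e) s k0 Q.
Proof.
intros <- E1 <- H. do 3 eexists. split; [apply exec_istore|]. split.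
2:{ rewrite E1. exact H. } lia.
Qed.

Lemma wp_rst j p e s k0 Q i v c :
  S (icost (Ad j p) + rcost e) = c ->
  ieval w s (Ad j p) = 32 * (m + i) + j -> reval w s e = v ->
  Q (set_ra s j i v) (k0 + c) -> wp (RSt j p e) s k0 Q.
Proof.
intros <- E1 <- H. do 3 eexists. split; [apply exec_rstore|]. split.
2:{ rewrite E1. exact H. } lia.
Qed.

Definition bev (s : state) (b : bexp) (P : Prop) : Prop := beval w s b = true <-> P.

Lemma wp_if b c d s k0 Q P kb :
  S (bcost b) = kb -> bev s b P ->
  (P -> wp c s (k0 + kb) Q) -> (~ P -> wp d s (k0 + kb) Q) -> wp (If b c d) s k0 Q.
Proof.
intros <- HB H1 H2.
assert (H : wp (if beval w s b then c else d) s (k0 + S (bcost b)) Q).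
{ unfold bev in HB. destruct (beval w s b); [apply H1, HB | apply H2]; auto.
  intros H. apply HB in H. discriminate. }
destruct H as (k & s' & k' & E & L & H).
exists (S (bcost b + k)), s', k'. split; [now apply exec_if | split; [lia | easy]].
Qed.

(** Composition with a verified command: its whole budget [T] is charged, and everything that its
    text cannot modify is recovered from the frame. *)
Lemma wp_call c s k0 Q T P : 6 <= w ->
  tri c s T P -> (forall s', frame c s s' -> P s' -> Q s' (k0 + T)) -> wp c s k0 Q.
Proof. intros w6.
intros (k & s' & k' & E & L & L' & H) HQ.
exists k, s', (k0 + T). split; [easy | split; [lia|]].
apply HQ; auto. eapply (exec_frame _ _ _ _ w6); eauto.
Qed.

Lemma tri_weaken c s T T' P P' : 6 <= w ->
  tri c s T P -> T <= T' -> (forall s', frame c s s' -> P s' -> P' s') -> tri c s T' P'.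
Proof. intros w6. intros H L HP. eapply (wp_call _ _ _ _ _ _ w6); [exact H|]. intros s' F Hs. cbn. auto. Qed.

(* The first argument of the invariant bounds the cost still to come, so it is
   also the termination measure. *)
Lemma tri_while b c s0 T0 (P : state -> Prop) (I : nat -> state -> Prop) : 6 <= w ->
  I T0 s0 ->
  (forall T s, frame c s0 s -> I T s ->
     exists B, bev s b B /\
       (B -> wp c s (S (bcost b)) (fun s' k' => exists T', k' + T' <= T /\ I T' s')) /\
       (~ B -> S (bcost b) <= T /\ P s)) ->
  tri (While b c) s0 T0 P.
Proof. intros w6.
intros H0 H.
(* Induction on a bound of the remaining budget, which strictly decreases since evaluating the guard
   costs at least one unit. *)
assert (HH : forall N T s, T <= N -> frame c s0 s -> I T s ->
  exists k s', exec w (While b c) s k s' /\ k <= T /\ P s').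
{ induction N as [|N IH]; intros T s HN F HI; destruct (H T s F HI) as (B & HB & H1 & H2);
    unfold bev in HB; destruct (beval w s b) eqn:E.
  - destruct H1 as (k & s' & k' & Ex & L & T' & L' & _); [now apply HB | lia].
  - destruct H2; [|lia]. intros HB'. apply HB in HB'. discriminate.
  - destruct H1 as (k & s' & k' & Ex & L & T' & L' & HI'); [now apply HB|].
    destruct (IH T' s') as (k2 & s2 & E2 & L2 & HP); auto; [lia| |].
    { eapply frame_trans; eauto; eapply exec_frame; eauto. }
    exists (S (bcost b + k + k2)), s2. repeat split; auto; [|lia].
    eapply exec_while_step; eauto.
  - destruct H2; [intros HB'; apply HB in HB'; discriminate|].
    exists (S (bcost b)), s. repeat split; auto. now constructor. }
destruct (HH T0 T0 s0) as (k & s' & E & L & HP); auto using frame_refl.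
exists k, s', k. auto.
Qed.

Lemma ev_const s z : z < 2 ^ w -> ieval w s (IConst z) = z.
Proof. apply Nat.mod_small. Qed.
Lemma ev_var s x v : ivar s x = v -> ieval w s (IVar x) = v.
Proof. easy. Qed.
Lemma ev_add s a b x y :
  ieval w s a = x -> ieval w s b = y -> x + y < 2 ^ w -> ieval w s (IAdd a b) = x + y.
Proof. intros <- <-. apply Nat.mod_small. Qed.
Lemma ev_sub s a b x y :
  ieval w s a = x -> ieval w s b = y -> ieval w s (ISub a b) = x - y.
Proof. now intros <- <-. Qed.
Lemma ev_mul s a b x y :
  ieval w s a = x -> ieval w s b = y -> x * y < 2 ^ w -> ieval w s (IMul a b) = x * y.
Proof. intros <- <-. apply Nat.mod_small. Qed.
Lemma ev_div s a b x y :
  ieval w s a = x -> ieval w s b = y -> ieval w s (IDiv a b) = x / y.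
Proof. now intros <- <-. Qed.
Lemma ev_load s a x v : ieval w s a = x -> imem s x = v -> ieval w s (ILoad a) = v.
Proof. now intros <-. Qed.
Lemma ev_ad s j a i :
  ivar s 1 = m -> ieval w s a = i -> j < 32 -> 32 * (m + i + 1) < 2 ^ w ->
  ieval w s (Ad j a) = 32 * (m + i) + j.
Proof.
intros E1 E2 Hj Hw. unfold Ad. cbn [ieval]. rewrite E1, E2.
rewrite (Nat.mod_small 32), (Nat.mod_small j), (Nat.mod_small (m + i)) by lia.
rewrite (Nat.mod_small ((m + i) * 32)) by lia. rewrite Nat.mod_small by lia. lia.
Qed.
Lemma ev_ld s j a i v :
  ieval w s (Ad j a) = 32 * (m + i) + j -> ia s j i = v -> ieval w s (Ld j a) = v.
Proof. unfold Ld, ia. cbn [ieval]. now intros -> <-. Qed.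

Lemma re_var s x v : rvar s x = v -> reval w s (RVar x) = v.
Proof. easy. Qed.
Lemma re_ofint s a x : ieval w s a = x -> reval w s (ROfInt a) = INR x.
Proof. now intros <-. Qed.
Lemma re_ld s j a i v :
  ieval w s (Ad j a) = 32 * (m + i) + j -> ra s j i = v -> reval w s (RLd j a) = v.
Proof. unfold RLd, ra. cbn [reval]. now intros -> <-. Qed.
Lemma re_load s a x v : ieval w s a = x -> rmem s x = v -> reval w s (RLoad a) = v.
Proof. now intros <-. Qed.
Lemma re_add s a b x y :
  reval w s a = x -> reval w s b = y -> reval w s (RAdd a b) = (x + y)%R.
Proof. now intros <- <-. Qed.
Lemma re_mul s a b x y :
  reval w s a = x -> reval w s b = y -> reval w s (RMul a b) = (x * y)%R.
Proof. now intros <- <-. Qed.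
Lemma re_div s a b x y :
  reval w s a = x -> reval w s b = y -> reval w s (RDiv a b) = (x / y)%R.
Proof. now intros <- <-. Qed.

Lemma bev_ile s a b x y :
  ieval w s a = x -> ieval w s b = y -> bev s (BILe a b) (x <= y).
Proof. intros <- <-. apply Nat.leb_le. Qed.
Lemma bev_ieq s a b x y :
  ieval w s a = x -> ieval w s b = y -> bev s (BIEq a b) (x = y).
Proof. intros <- <-. apply Nat.eqb_eq. Qed.
Lemma bev_rle s a b x y :
  reval w s a = x -> reval w s b = y -> bev s (BRLe a b) (x <= y)%R.
Proof.
intros <- <-. unfold bev. cbn [beval].
destruct (Rle_dec (reval w s a) (reval w s b)); easy.
Qed.
Lemma bev_not s a P : bev s a P -> bev s (BNot a) (~ P).
Proof.
unfold bev. cbn [beval]. destruct (beval w s a); cbn; intuition congruence.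
Qed.
Lemma bev_and s a b P Q : bev s a P -> bev s b Q -> bev s (BAnd a b) (P /\ Q).
Proof.
unfold bev. cbn [beval]. destruct (beval w s a), (beval w s b); cbn; intuition congruence.
Qed.

Lemma ia_set_ia s j i v : ia (set_ia s j i v) j = aset (ia s j) i v.
Proof.
apply functional_extensionality. intros x. unfold ia, aset, set_ia, set_imem, upd. cbn [imem].
destruct (Nat.eqb_spec x i); destruct (Nat.eqb_spec (32 * (m + x) + j) (32 * (m + i) + j));
  auto; lia.
Qed.
Lemma ra_set_ra s j i v : ra (set_ra s j i v) j = aset (ra s j) i v.
Proof.
apply functional_extensionality. intros x. unfold ra, aset, set_ra, set_rmem, upd. cbn [rmem].
destruct (Nat.eqb_spec x i); destruct (Nat.eqb_spec (32 * (m + x) + j) (32 * (m + i) + j));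
  auto; lia.
Qed.
Lemma ia_set_ia_other s j i v j' :
  andb (andb (Nat.ltb j 32) (Nat.ltb j' 32)) (negb (Nat.eqb j j')) = true ->
  ia (set_ia s j i v) j' = ia s j'.
Proof.
intros H. apply Bool.andb_true_iff in H. destruct H as [H H3].
apply Bool.andb_true_iff in H. destruct H as [H1 H2].
apply Nat.ltb_lt in H1, H2. apply Bool.negb_true_iff, Nat.eqb_neq in H3.
apply functional_extensionality. intros x. unfold ia, set_ia, set_imem, upd. cbn [imem].
destruct (Nat.eqb_spec (32 * (m + x) + j') (32 * (m + i) + j)); auto; lia.
Qed.
Lemma ra_set_ra_other s j i v j' :
  andb (andb (Nat.ltb j 32) (Nat.ltb j' 32)) (negb (Nat.eqb j j')) = true ->
  ra (set_ra s j i v) j' = ra s j'.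
Proof.
intros H. apply Bool.andb_true_iff in H. destruct H as [H H3].
apply Bool.andb_true_iff in H. destruct H as [H1 H2].
apply Nat.ltb_lt in H1, H2. apply Bool.negb_true_iff, Nat.eqb_neq in H3.
apply functional_extensionality. intros x. unfold ra, set_ra, set_rmem, upd. cbn [rmem].
destruct (Nat.eqb_spec (32 * (m + x) + j') (32 * (m + i) + j)); auto; lia.
Qed.
End Logic.

(** * Tactics for symbolic execution *)

Ltac look1 :=
  match goal with
  | H : ivar ?s ?x = _ |- context [ivar ?s ?x] => rewrite H
  | H : rvar ?s ?x = _ |- context [rvar ?s ?x] => rewrite H
  | H : ia ?m ?s ?j = _ |- context [ia ?m ?s ?j] => rewrite H
  | H : ra ?m ?s ?j = _ |- context [ra ?m ?s ?j] => rewrite H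
  | |- context [ivar (set_ivar ?s ?x ?v) ?y] =>
      first [ change (ivar (set_ivar s x v) y) with v
            | change (ivar (set_ivar s x v) y) with (ivar s y) ]
  | |- context [ivar (set_rvar ?s ?x ?v)] => change (ivar (set_rvar s x v)) with (ivar s)
  | |- context [ivar (set_ia ?m ?s ?j ?i ?v)] => change (ivar (set_ia m s j i v)) with (ivar s)
  | |- context [ivar (set_ra ?m ?s ?j ?i ?v)] => change (ivar (set_ra m s j i v)) with (ivar s)
  | |- context [rvar (set_rvar ?s ?x ?v) ?y] =>
      first [ change (rvar (set_rvar s x v) y) with v
            | change (rvar (set_rvar s x v) y) with (rvar s y) ]
  | |- context [rvar (set_ivar ?s ?x ?v)] => change (rvar (set_ivar s x v)) with (rvar s)
  | |- context [rvar (set_ia ?m ?s ?j ?i ?v)] => change (rvar (set_ia m s j i v)) with (rvar s)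
  | |- context [rvar (set_ra ?m ?s ?j ?i ?v)] => change (rvar (set_ra m s j i v)) with (rvar s)
  | |- context [ia ?m (set_ivar ?s ?x ?v)] => change (ia m (set_ivar s x v)) with (ia m s)
  | |- context [ia ?m (set_rvar ?s ?x ?v)] => change (ia m (set_rvar s x v)) with (ia m s)
  | |- context [ia ?m (set_ra ?m ?s ?j ?i ?v)] => change (ia m (set_ra m s j i v)) with (ia m s)
  | |- context [ia ?m (set_ia ?m ?s ?j ?i ?v) ?j] => rewrite (ia_set_ia m s j i v)
  | |- context [ia ?m (set_ia ?m ?s ?j ?i ?v) ?j'] =>
      rewrite (ia_set_ia_other m s j i v j' eq_refl)
  | |- context [ra ?m (set_ivar ?s ?x ?v)] => change (ra m (set_ivar s x v)) with (ra m s)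
  | |- context [ra ?m (set_rvar ?s ?x ?v)] => change (ra m (set_rvar s x v)) with (ra m s)
  | |- context [ra ?m (set_ia ?m ?s ?j ?i ?v)] => change (ra m (set_ia m s j i v)) with (ra m s)
  | |- context [ra ?m (set_ra ?m ?s ?j ?i ?v) ?j] => rewrite (ra_set_ra m s j i v)
  | |- context [ra ?m (set_ra ?m ?s ?j ?i ?v) ?j'] =>
      rewrite (ra_set_ra_other m s j i v j' eq_refl)
  | F : frame _ _ _ ?s |- context [ivar ?s ?x] => rewrite (fr_i _ _ _ _ F x eq_refl)
  | F : frame _ _ _ ?s |- context [rvar ?s ?x] => rewrite (fr_r _ _ _ _ F x eq_refl)
  | F : frame ?m _ _ ?s |- context [ia ?m ?s ?j] => rewrite (fr_ia _ _ _ _ F j eq_refl eq_refl)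
  | F : frame ?m _ _ ?s |- context [ra ?m ?s ?j] => rewrite (fr_ra _ _ _ _ F j eq_refl eq_refl)
  end.
Ltac look := repeat look1.

Ltac bnd := lia.

(** Evaluates an expression bottom-up; every operation that is reduced modulo 2^w leaves a range
    condition for [bnd]. *)
Ltac ev :=
  lazymatch goal with
  | |- ieval _ _ (Ad _ _) = _ =>
      eapply ev_ad; [look; reflexivity | ev | apply Nat.ltb_lt; reflexivity | bnd]
  | |- ieval _ _ (Ld _ _) = _ => eapply ev_ld; [ev | look; reflexivity]
  | |- ieval _ _ (IConst _) = _ => eapply ev_const; bnd
  | |- ieval _ _ (IVar _) = _ => eapply ev_var; look; reflexivity
  | |- ieval _ _ (ILoad _) = _ => eapply ev_load; [ev | look; reflexivity]
  | |- ieval _ _ (IAdd _ _) = _ => eapply ev_add; [ev | ev | bnd]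
  | |- ieval _ _ (ISub _ _) = _ => eapply ev_sub; [ev | ev]
  | |- ieval _ _ (IMul _ _) = _ => eapply ev_mul; [ev | ev | bnd]
  | |- ieval _ _ (IDiv _ _) = _ => eapply ev_div; [ev | ev]
  | |- reval _ _ (RVar _) = _ => eapply re_var; look; reflexivity
  | |- reval _ _ (RLd _ _) = _ => eapply re_ld; [ev | look; reflexivity]
  | |- reval _ _ (RLoad _) = _ => eapply re_load; [ev | look; reflexivity]
  | |- reval _ _ (ROfInt _) = _ => eapply re_ofint; ev
  | |- reval _ _ (RAdd _ _) = _ => eapply re_add; [ev | ev]
  | |- reval _ _ (RMul _ _) = _ => eapply re_mul; [ev | ev]
  | |- reval _ _ (RDiv _ _) = _ => eapply re_div; [ev | ev]
  | |- bev _ _ (BILe _ _) _ => eapply bev_ile; [ev | ev]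
  | |- bev _ _ (BIEq _ _) _ => eapply bev_ieq; [ev | ev]
  | |- bev _ _ (BRLe _ _) _ => eapply bev_rle; [ev | ev]
  | |- bev _ _ (BNot _) _ => eapply bev_not; ev
  | |- bev _ _ (BAnd _ _) _ => eapply bev_and; [ev | ev]
  end.

Fixpoint seqs (cs : list com) : com :=
  match cs with [] => Skip | [c] => c | c :: cs' => Seq c (seqs cs') end.

Ltac step :=
  lazymatch goal with
  | |- wp _ (seqs _) _ _ _ => cbn [seqs]; step
  | |- wp _ (Seq _ _) _ _ _ => apply wp_seq; cbv beta
  | |- wp _ Skip _ _ _ => apply wp_skip; cbv beta
  | |- wp _ (ISet _ _) _ _ _ => eapply wp_iset; [vm_compute; reflexivity | ev | cbv beta ]
  | |- wp _ (RSet _ _) _ _ _ => eapply wp_rset; [vm_compute; reflexivity | ev | cbv beta ]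
  | |- wp _ (St _ _ _) _ _ _ => eapply wp_st; [vm_compute; reflexivity | ev | ev | cbv beta ]
  | |- wp _ (RSt _ _ _) _ _ _ => eapply wp_rst; [vm_compute; reflexivity | ev | ev | cbv beta ]
  | |- wp _ (If _ _ _) _ _ _ => eapply wp_if; [vm_compute; reflexivity | ev | intros ? | intros ?]
  end.

Ltac splits := repeat match goal with |- _ /\ _ => split end.

Ltac cost :=
  repeat match goal with |- context [bcost ?b] =>
    let c := eval vm_compute in (bcost b) in change (bcost b) with c end; lia.

(** Gives a branching command one common postcondition and cost, so that the code behind it is
    executed symbolically only once. *)
Ltac join m T P :=
  lazymatch goal with |- wp ?w ?c ?s ?k ?Q =>
    apply (wp_call w m c s k Q T P); [assumption | unfold tri | ] end.

(** * Binary search and the tournament tree *)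

(** The arguments are doubled so that the bound also drops in the last halving, from length 1 to
    length 0, where [Nat.log2 0 = 0]. *)
Lemma log2_half d d' : 1 <= d -> d' <= d / 2 -> S (Nat.log2 (2 * d')) <= Nat.log2 (2 * d).
Proof.
intros H1 H2. rewrite (Nat.log2_double d) by lia. apply le_n_S.
apply Nat.log2_le_mono. pose proof (Nat.div_mod_eq d 2). lia.
Qed.

Lemma frame_while m b c s s' : frame m c s s' -> frame m (While b c) s s'.
Proof. intros [A B C D]; now constructor. Qed.

Lemma frame_set_ivar m c s s' x v :
  frame m c s s' -> inb x (modi c) = true -> frame m c s (set_ivar s' x v).
Proof.
intros [A B C D] H; constructor; auto. intros y Hy. cbn. unfold upd.
destruct (Nat.eqb_spec y x); [congruence | auto].
Qed.

Definition bsearch (b : bexp) : com :=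
  While (BNot (BILe (IVar 26) (IVar 25)))
    (Seq (ISet 27 (IDiv (IAdd (IVar 25) (IVar 26)) (IConst 2)))
         (If b (ISet 26 (IVar 27)) (ISet 25 (IAdd (IVar 27) (IConst 1))))).

(** The conclusion is local: the predicate, read as false below [lo] and as true at [hi], switches
    to true at [r]. For a monotone predicate this pins down the threshold. *)
Lemma bsearch_ok w m b s lo hi (P : nat -> Prop) :
  6 <= w -> ivar s 25 = lo -> ivar s 26 = hi -> lo <= hi -> 2 * hi + 2 < 2 ^ w ->
  (forall s' x, frame m (bsearch b) s s' -> ivar s' 27 = x -> lo <= x < hi ->
     bev w s' b (P x)) ->
  tri w (bsearch b) s ((bcost b + 20) * Nat.log2 (2 * (hi - lo)) + 5)
    (fun s' => exists r, ivar s' 25 = r /\ lo <= r <= hi /\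
       (r = hi \/ P r) /\ (r = lo \/ ~ P (r - 1))).
Proof.
intros w6 E1 E2 Hle Hw HP.
eapply (tri_while w m) with (I := fun T s => exists l h, ivar s 25 = l /\ ivar s 26 = h /\
  lo <= l /\ l <= h /\ h <= hi /\ (h = hi \/ P h) /\ (l = lo \/ ~ P (l - 1)) /\
  (bcost b + 20) * Nat.log2 (2 * (h - l)) + 5 <= T).
{ exact w6. }
{ exists lo, hi. repeat split; auto. }
intros T s1 F (l & h & El & Eh & L1 & L2 & L3 & Hh & Hl & HT).
eexists. split; [ev|]. split.
- intros Hlt.
  assert (D : 2 * ((l + h) / 2) <= l + h < 2 * ((l + h) / 2) + 2).
  { pose proof (Nat.div_mod_eq (l + h) 2). pose proof (Nat.mod_upper_bound (l + h) 2). lia. }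
  set (d := (l + h) / 2) in *.
  step. step. fold d.
  eapply wp_if; [reflexivity| | |].
  + apply (HP _ d); [|reflexivity | lia].
    apply frame_set_ivar; [now apply frame_while | reflexivity].
  + intros HPd. step. exists (T - (bcost b + 20)).
    assert (S (Nat.log2 (2 * (d - l))) <= Nat.log2 (2 * (h - l))).
    { apply log2_half; [lia|]. pose proof (Nat.div_mod_eq (h - l) 2).
      pose proof (Nat.mod_upper_bound (h - l) 2). lia. }
    split; [cbn [bcost icost]; nia|].
    exists l, d. repeat split; look; auto; try lia. nia.
  + intros HPd. step. exists (T - (bcost b + 20)).
    assert (S (Nat.log2 (2 * (h - (d + 1)))) <= Nat.log2 (2 * (h - l))).
    { apply log2_half; [lia|]. pose proof (Nat.div_mod_eq (h - l) 2).
      pose proof (Nat.mod_upper_bound (h - l) 2). lia. }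
    split; [cbn [bcost icost]; nia|].
    exists (d + 1), h. repeat split; look; auto; try lia.
    * right. replace (d + 1 - 1) with d by lia. auto.
    * nia.
- intros Hn. split; [cbn; lia|]. exists l. replace h with l in * by lia.
  repeat split; auto.
Qed.

Section Tournament.

(* The tournament on N vertices: node y has the children 2y and 2y + 1, the leaf N + v holds
   v + 1 if v takes part and 0 otherwise, and an inner node holds the child of smaller key.
   N need not be a power of two. *)
Inductive anc (x : nat) : nat -> Prop :=
| anc_refl : anc x x
| anc_up y : anc x y -> anc x (y / 2).

Definition node_ok (key : nat -> R) (tr : nat -> nat) (y : nat) : Prop :=
  (tr y = 0 -> tr (2 * y) = 0 /\ tr (2 * y + 1) = 0) /\
  (tr y <> 0 -> (tr y = tr (2 * y) \/ tr y = tr (2 * y + 1)) /\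
     forall z, z = 2 * y \/ z = 2 * y + 1 -> tr z <> 0 ->
       (key (tr y - 1)%nat <= key (tr z - 1)%nat)%R).

Definition leaves_ok (N : nat) (tr : nat -> nat) : Prop :=
  forall v, v < N -> tr (N + v) = 0 \/ tr (N + v) = v + 1.

Definition heap_ok (N : nat) (key : nat -> R) (tr : nat -> nat) : Prop :=
  (forall y, 1 <= y < N -> node_ok key tr y) /\ leaves_ok N tr.

Lemma anc_le x y : anc x y -> y <= x.
Proof.
induction 1; auto. pose proof (Nat.div_mod_eq y 2). lia.
Qed.

Lemma anc_trans x y z : anc x y -> anc y z -> anc x z.
Proof. intros H; induction 1; auto. now constructor. Qed.

Lemma anc_half y z : z = 2 * y \/ z = 2 * y + 1 -> z / 2 = y.
Proof.
intros H. pose proof (Nat.div_mod_eq z 2). pose proof (Nat.mod_upper_bound z 2). lia.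
Qed.

Lemma anc_inv x y : anc x y -> y = x \/ anc (x / 2) y.
Proof.
induction 1 as [|y H [IH|IH]]; auto.
- subst. right. constructor.
- right. now constructor.
Qed.

Lemma anc_root x : 1 <= x -> anc x 1.
Proof.
induction x as [x IH] using lt_wf_ind. intros H.
destruct (Nat.eq_dec x 1) as [->|]; [constructor|].
pose proof (Nat.div_mod_eq x 2). pose proof (Nat.mod_upper_bound x 2).
apply anc_trans with (x / 2); [constructor; constructor | apply IH; lia].
Qed.

(** Descending from [y] to the child that holds the same value ends in the leaf of that vertex. So a
    vertex can occur only on the path above its own leaf, which is why a change of its key concerns
    this path alone. *)
Lemma tree_value_anc N key tr (ok : nat -> Prop) :
  leaves_ok N tr -> (forall y, 1 <= y < N -> ok y -> node_ok key tr y) ->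
  (forall y z, z = 2 * y \/ z = 2 * y + 1 -> ok y -> ok z) ->
  forall y, 1 <= y < 2 * N -> ok y -> tr y <> 0 ->
  tr y <= N /\ anc (N + (tr y - 1)) y.
Proof.
intros HL HN Hd.
enough (G : forall d y, 2 * N - y <= d -> 1 <= y < 2 * N -> ok y -> tr y <> 0 ->
  tr y <= N /\ anc (N + (tr y - 1)) y) by (intros; eapply G; eauto).
induction d as [|d IH]; intros y Hdy Hy Ho Hz; [lia|].
destruct (le_lt_dec N y) as [Hge|Hlt].
- destruct (HL (y - N)) as [E|E]; [lia| |]; replace (N + (y - N)) with y in E by lia.
  + congruence.
  + rewrite E. split; [lia|]. replace (N + (y - N + 1 - 1)) with y by lia. constructor.
- destruct (HN y) as [_ H]; auto; [lia|]. destruct (H Hz) as [[E|E] _].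
  + destruct (IH (2 * y)) as [A B]; try lia; [eapply Hd; eauto|].
    rewrite E. split; auto. rewrite <- (anc_half y (2 * y)) at 2 by auto. now constructor.
  + destruct (IH (2 * y + 1)) as [A B]; try lia; [eapply Hd; eauto|].
    rewrite E. split; auto. rewrite <- (anc_half y (2 * y + 1)) at 2 by auto. now constructor.
Qed.

(** On the way up from a nonempty node, nodes stay nonempty and keys can only decrease; applied to
    the root this gives the minimum. *)
Lemma heap_anc_le N key tr x y :
  heap_ok N key tr -> 1 <= y -> x < 2 * N -> anc x y -> tr x <> 0 ->
  tr y <> 0 /\ (key (tr y - 1)%nat <= key (tr x - 1)%nat)%R.
Proof.
intros [HN HL] Hy Hx HA Hz. revert Hy.
induction HA as [|y HA IH]; intros Hy; [split; auto; apply Rle_refl|].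
pose proof (Nat.div_mod_eq y 2) as D. pose proof (Nat.mod_upper_bound y 2) as U.
pose proof (anc_le _ _ HA).
destruct IH as [IH1 IH2]; [lia|].
set (z := y / 2) in *.
assert (Ez : y = 2 * z \/ y = 2 * z + 1) by lia.
destruct (HN z) as [A B]; [lia|].
destruct (Nat.eq_dec (tr z) 0) as [E|E].
- destruct (A E) as [A1 A2]. destruct Ez as [Ez|Ez]; rewrite <- Ez in *; congruence.
- split; auto. destruct (B E) as [_ C]. eapply Rle_trans; [|exact IH2]. now apply C.
Qed.

Lemma heap_root_none N key tr :
  heap_ok N key tr -> 1 <= N -> tr 1 = 0 -> forall v, v < N -> tr (N + v) = 0.
Proof.
intros H HN E v Hv. destruct (Nat.eq_dec (tr (N + v)) 0) as [|Hz]; auto.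
destruct (heap_anc_le N key tr (N + v) 1) as [A _]; auto; try lia. apply anc_root. lia.
Qed.

Lemma heap_leaf N key tr y :
  heap_ok N key tr -> 1 <= y < 2 * N -> tr y <> 0 -> tr y <= N /\ tr (N + (tr y - 1)) = tr y.
Proof.
intros [HH HL] Hy Hty. split.
{ apply (tree_value_anc N key tr (fun _ => True) HL); auto. }
assert (G : forall d y, 2 * N - y <= d -> 1 <= y < 2 * N -> tr y <> 0 ->
  tr (N + (tr y - 1)) = tr y); [|apply (G (2 * N)); auto; lia].
clear y Hy Hty. induction d as [|d IH]; intros y Hd Hy Hty; [lia|].
destruct (le_lt_dec N y) as [Hge|Hlt].
- destruct (HL (y - N)) as [E'|E']; [lia| |]; replace (N + (y - N)) with y in E' by lia.
  + congruence. + rewrite E'. replace (N + (y - N + 1 - 1)) with y by lia. lia.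
- destruct (HH y) as [_ C]; [lia|]. destruct (C Hty) as [[E'|E'] _]; rewrite E';
    apply IH; try lia.
Qed.

Lemma heap_root_min N key tr :
  heap_ok N key tr -> 1 <= N -> tr 1 <> 0 ->
  tr 1 <= N /\ tr (N + (tr 1 - 1)) = tr 1 /\
  forall v, v < N -> tr (N + v) <> 0 -> (key (tr 1 - 1)%nat <= key v)%R.
Proof.
intros H HN Hz.
destruct (heap_leaf N key tr 1 H) as [A B]; auto; [lia|]. splits; auto.
intros v Hv Hm. destruct (heap_anc_le N key tr (N + v) 1) as [_ C]; auto; try lia.
{ apply anc_root. lia. }
destruct H as [_ HL]. destruct (HL v Hv) as [E|E]; [congruence|]. rewrite E in C.
now replace (v + 1 - 1) with v in C by lia.
Qed.

(** Nodes that are not above the leaf of [v] neither hold [v] nor have a child that does, so they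
    see neither the new key nor the new leaf. *)
Lemma node_ok_off_path N key tr v r t :
  heap_ok N key tr -> v < N ->
  forall y, 1 <= y < N -> ~ anc (N + v) y -> node_ok (aset key v r) (aset tr (N + v) t) y.
Proof.
intros [HN HL] Hv y Hy Hna.
assert (Hch : forall z, z = 2 * y \/ z = 2 * y + 1 -> ~ anc (N + v) z).
{ intros z Hz C. apply Hna. rewrite <- (anc_half y z Hz). now constructor. }
assert (HT : forall z, z = y \/ z = 2 * y \/ z = 2 * y + 1 ->
  aset tr (N + v) t z = tr z /\ (tr z <> 0 -> aset key v r (tr z - 1) = key (tr z - 1)%nat)).
{ intros z Hz.
  assert (Hza : ~ anc (N + v) z) by (destruct Hz as [->|]; auto).
  split.
  - apply aset_neq. intros ->. apply Hza. constructor.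
  - intros Hz0. apply aset_neq. intros E. apply Hza. rewrite <- E.
    apply (tree_value_anc N key tr (fun _ => True) HL); auto. lia. }
destruct (HT y) as [Ey Ky]; auto.
destruct (HT (2 * y)) as [E1 K1]; auto.
destruct (HT (2 * y + 1)) as [E2 K2]; auto.
destruct (HN y Hy) as [A B]. unfold node_ok. rewrite Ey, E1, E2. split; auto.
intros Hz. destruct (B Hz) as [C D]. split; auto.
intros z [->| ->] Hz'; [rewrite E1, Ky, K1 | rewrite E2, Ky, K2]; auto;
  try (now rewrite <- E1); try (now rewrite <- E2).
- apply D; auto. now rewrite <- E1.
- apply D; auto. now rewrite <- E2.
Qed.

(** Recomputing node [z] repairs it and can disturb only its parent; thus the set of possibly wrong
    nodes shrinks from the ancestors of [z] to those of [z / 2]. *)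
Lemma node_ok_update N key tr z b :
  1 <= z -> (forall y, 1 <= y < N -> y <> z -> ~ anc (z / 2) y -> node_ok key tr y) ->
  (b = 0 -> tr (2 * z) = 0 /\ tr (2 * z + 1) = 0) ->
  (b <> 0 -> (b = tr (2 * z) \/ b = tr (2 * z + 1)) /\
     forall c, c = 2 * z \/ c = 2 * z + 1 -> tr c <> 0 -> (key (b - 1)%nat <= key (tr c - 1)%nat)%R) ->
  forall y, 1 <= y < N -> ~ anc (z / 2) y -> node_ok key (aset tr z b) y.
Proof.
intros Hz Hok H0 H1 y Hy Hna. unfold node_ok.
destruct (Nat.eq_dec y z) as [->|Hyz].
- rewrite aset_eq, !(aset_neq tr z b) by lia. split; auto. intros Hb.
  destruct (H1 Hb) as [A B]. split; auto. intros c Hc. rewrite aset_neq by lia. auto.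
- assert (Hc : forall c, c = 2 * y \/ c = 2 * y + 1 -> c <> z).
  { intros c Hc ->. apply Hna. rewrite (anc_half y z Hc). constructor. }
  rewrite !(aset_neq tr z b) by auto. destruct (Hok y) as [A B]; auto.
  split; auto. intros Hz'. destruct (B Hz') as [C D]. split; auto.
  intros c Hcc. rewrite aset_neq by auto. auto.
Qed.
End Tournament.

(** * Repairing the tournament on the way to the root *)

Definition fixpath : com :=
  While (BNot (BILe (IVar 22) (IConst 1)))
    (Seq (ISet 22 (IDiv (IVar 22) (IConst 2)))
    (Seq (ISet 23 (Ld 7 (IMul (IConst 2) (IVar 22))))
    (Seq (ISet 24 (Ld 7 (IAdd (IMul (IConst 2) (IVar 22)) (IConst 1))))
    (If (BIEq (IVar 23) (IConst 0)) (St 7 (IVar 22) (IVar 24))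
    (If (BIEq (IVar 24) (IConst 0)) (St 7 (IVar 22) (IVar 23))
    (If (BRLe (RLd 1 (ISub (IVar 23) (IConst 1))) (RLd 1 (ISub (IVar 24) (IConst 1))))
       (St 7 (IVar 22) (IVar 23))
       (St 7 (IVar 22) (IVar 24)))))))).

(** Invariant of the loop: only proper ancestors of the current node may violate [node_ok]. The
    bound on all tree entries keeps the addresses computed from them in range. *)
Lemma fixpath_ok w m s N key tr tr1 x0 :
  6 <= w -> 32 * (m + 2 * N + 2) < 2 ^ w -> ivar s 1 = m ->
  ivar s 22 = x0 -> ra m s 1 = key -> ia m s 7 = tr ->
  N <= x0 < 2 * N -> leaves_ok N tr ->
  (forall x, N <= x -> tr1 x = tr x) ->
  (forall y, tr y <= N) ->
  (forall y, 1 <= y < N -> ~ anc (x0 / 2) y -> node_ok key tr y) ->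
  tri w fixpath s (150 * Nat.log2 (2 * N) + 5)
    (fun s' => heap_ok N key (ia m s' 7) /\ (forall x, N <= x -> ia m s' 7 x = tr1 x) /\
       forall y, ia m s' 7 y <= N).
Proof.
intros w6 Hw Em Ex Ek Et Hx HL Ht1 Hle Hok.
eapply (tri_while w m) with (I := fun T s => exists x tr, ivar s 22 = x /\ ia m s 7 = tr /\
  1 <= x < 2 * N /\ leaves_ok N tr /\ (forall x, N <= x -> tr x = tr1 x) /\
  (forall y, tr y <= N) /\
  (forall y, 1 <= y < N -> ~ anc (x / 2) y -> node_ok key tr y) /\
  150 * Nat.log2 x + 5 <= T).
{ exact w6. }
{ exists x0, tr. splits; auto; try lia. intros; symmetry; auto.
  enough (Nat.log2 x0 <= Nat.log2 (2 * N)) by lia. apply Nat.log2_le_mono. lia. }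
clear dependent tr. clear x0 Ex Hx.
intros T s1 F (x & tr & Ex & Et & Hx & HL & Ht1 & Hle & Hok & HT).
assert (Ek1 : ra m s1 1 = key) by (look; auto).
assert (Em1 : ivar s1 1 = m) by (look; auto).
eexists. split; [ev|]. split.
- intros Hlt.
  assert (Hlog : S (Nat.log2 (x / 2)) <= Nat.log2 x).
  { pose proof (Nat.div_mod_eq x 2). pose proof (Nat.mod_upper_bound x 2).
    rewrite <- (Nat.log2_double (x / 2)) by lia. apply Nat.log2_le_mono. lia. }
  assert (Hh : 1 <= x / 2 < N /\ x / 2 < x).
  { pose proof (Nat.div_mod_eq x 2). pose proof (Nat.mod_upper_bound x 2). lia. }
  set (z := x / 2) in *.
  assert (G : forall b s' k', k' <= 120 ->
     ivar s' 22 = z -> ia m s' 7 = aset tr z b -> b <= N ->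
     ((b = 0 -> tr (2 * z) = 0 /\ tr (2 * z + 1) = 0) /\
      (b <> 0 -> (b = tr (2 * z) \/ b = tr (2 * z + 1)) /\
       forall c, c = 2 * z \/ c = 2 * z + 1 -> tr c <> 0 -> (key (b - 1)%nat <= key (tr c - 1)%nat)%R)) ->
     exists T', k' + T' <= T /\ exists x tr, ivar s' 22 = x /\ ia m s' 7 = tr /\
       1 <= x < 2 * N /\ leaves_ok N tr /\ (forall x, N <= x -> tr x = tr1 x) /\
       (forall y, tr y <= N) /\
       (forall y, 1 <= y < N -> ~ anc (x / 2) y -> node_ok key tr y) /\
       150 * Nat.log2 x + 5 <= T').
  { intros b s' k' Hk' E22 E7 HbN Hb. exists (150 * Nat.log2 z + 5). split; [lia|].
    exists z, (aset tr z b). split; [auto|]. split; [auto|]. split; [lia|].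
    split; [|split; [|split; [|split; [|lia]]]].
    - intros v Hv. rewrite aset_neq by lia. auto.
    - intros y Hy. rewrite aset_neq by lia. auto.
    - intros y. destruct (Nat.eq_dec y z) as [->|];
        [now rewrite aset_eq | rewrite aset_neq by auto; auto].
    - apply node_ok_update; auto; [lia | | apply Hb | apply Hb].
      intros y Hy Hyz Hna. apply Hok; auto. intros C. apply anc_inv in C. tauto. }
  pose proof (Hle (2 * z)) as HL2. pose proof (Hle (2 * z + 1)) as HL3.
  step. step. step. step. step. step. fold z.
  step; [|step; [|step]].
  + step. eapply G with (b := tr (2 * z + 1)); look; auto; [cbn; lia|].
    split; [auto|]. intros Hb. split; auto.
    intros c [->| ->] Hc; [congruence | apply Rle_refl].
  + step. eapply G with (b := tr (2 * z)); look; auto; [cbn; lia|].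
    split; [auto|]. intros Hb. split; auto.
    intros c [->| ->] Hc; [apply Rle_refl | congruence].
  + step. eapply G with (b := tr (2 * z)); look; auto; [cbn; lia|].
    split; [tauto|]. intros Hb. split; auto.
    intros c [->| ->] Hc; [apply Rle_refl | easy].
  + step. eapply G with (b := tr (2 * z + 1)); look; auto; [cbn; lia|].
    split; [tauto|]. intros Hb. split; auto.
    intros c [->| ->] Hc; [|apply Rle_refl]. left. now apply Rnot_le_lt.
- intros Hn. split; [cbn; lia|]. split; [split; [|auto]|]; rewrite ?Et; auto.
  (* At the root the parent is 0, above which there is no inner node, so no exception is left. *)
  intros y Hy. apply Hok; auto. replace (x / 2) with 0.
  + intros C. apply anc_le in C. lia.
  + destruct x as [|[|x]]; auto; lia.
Qed.

Definition tree_empty (N : nat) (tr : nat -> nat) : Prop :=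
  forall y, 1 <= y < 2 * N -> tr y = 0.

Lemma heap_empty_root N key tr :
  heap_ok N key tr -> 1 <= N -> tr 1 = 0 -> tree_empty N tr.
Proof.
intros H HN E y Hy. destruct (Nat.eq_dec (tr y) 0) as [|Hz]; auto.
destruct (heap_leaf N key tr y H Hy Hz) as [A B].
rewrite (heap_root_none N key tr H HN E) in B by lia. congruence.
Qed.

Lemma tree_empty_heap N key tr : tree_empty N tr -> heap_ok N key tr.
Proof.
intros H. split.
- intros y Hy. split.
  + intros _. rewrite !H by lia. auto.
  + intros C. rewrite H in C by lia. congruence.
- intros v Hv. left. apply H. lia.
Qed.

Lemma aset_id {A} (f : nat -> A) i : aset f i (f i) = f.
Proof.
apply functional_extensionality. intros x. destruct (Nat.eq_dec x i) as [->|].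
- apply aset_eq. - now apply aset_neq.
Qed.

Lemma fixpath_leaf_ok w m s N key tr v r t :
  6 <= w -> 32 * (m + 2 * N + 2) < 2 ^ w -> ivar s 1 = m ->
  ivar s 22 = N + v -> ra m s 1 = aset key v r -> ia m s 7 = aset tr (N + v) t ->
  v < N -> heap_ok N key tr -> t = 0 \/ t = v + 1 -> (forall y, tr y <= N) ->
  tri w fixpath s (150 * Nat.log2 (2 * N) + 5)
    (fun s' => heap_ok N (aset key v r) (ia m s' 7) /\
       (forall x, N <= x -> ia m s' 7 x = aset tr (N + v) t x) /\
       forall y, ia m s' 7 y <= N).
Proof.
intros w6 Hw Em Ex Ek Et Hv HH Ht Hle.
eapply fixpath_ok; eauto; try lia.
- intros u Hu. destruct (Nat.eq_dec u v) as [->|].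
  + rewrite aset_eq. auto.
  + rewrite aset_neq by lia. apply HH. auto.
- intros y. destruct (Nat.eq_dec y (N + v)) as [->|].
  + rewrite aset_eq. lia. + rewrite aset_neq by lia. auto.
- intros y Hy Hna. apply node_ok_off_path; auto.
  intros C. apply anc_inv in C. destruct C; [lia | auto].
Qed.

(** * Divide and conquer on time *)

(* On an interval starting at time [rl], the scale of vertex [rv] drops from [rhi] to [rlo]. *)
Record rcd : Type := Rcd { rl : nat; rv : nat; rhi : nat; rlo : nat }.

(** With [X] the scales at the midpoint, a record splits into a left and a right part; a part on
    which the scale does not drop is omitted, which keeps dead vertices out of the recursion. *)
Definition lefts (X : nat -> nat) (rs : list rcd) : list rcd :=
  flat_map (fun r => if X (rv r) <? rhi r
                     then [Rcd (rl r) (rv r) (rhi r) (X (rv r))] else []) rs.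

Definition rights (X : nat -> nat) (mid : nat) (rs : list rcd) : list rcd :=
  flat_map (fun r => if rlo r <? X (rv r)
                     then [Rcd mid (rv r) (X (rv r)) (rlo r)] else []) rs.

(** * Validity of scales at a midpoint, and the sweep over the intervals of one level *)

Section Sweep.
Variables (F sc m src : nat) (q : R) (pw : nat -> R) (HS : nat -> Prop).
Variables (et eh : nat -> nat) (ew : nat -> R) (reach : nat -> nat -> R -> Prop).
Hypothesis q1 : (1 <= q)%R.
Hypothesis sc2 : 2 <= sc.
Hypothesis pw0 : pw 0 = 0%R.
Hypothesis pw1 : pw 1 = 1%R.
Hypothesis pwS : forall i, 1 <= i < sc -> pw (S i) = (q * pw i)%R.
Hypothesis pw_mono : forall i j, i <= j <= sc -> (pw i <= pw j)%R.
Hypothesis pw_top : forall i, i < sc -> (pw i < pw sc)%R.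
Hypothesis HSdec : forall v, HS v \/ ~ HS v.
Hypothesis HSsrc : ~ HS src.
Hypothesis HShead : forall e, e < m -> eh e <> src -> HS (eh e).
Hypothesis Hew : forall e, e < m -> (1 <= ew e)%R.
Hypothesis reach_mono : forall t t' v x, t <= t' -> reach t v x -> reach t' v x.
Hypothesis reach_src : forall t, reach t src 0%R.
Hypothesis reach_step : forall t e x,
  e < m -> e < t -> reach t (et e) x -> reach t (eh e) (x + ew e)%R.
Hypothesis reach_ind : forall t (P : nat -> R -> Prop), P src 0%R ->
  (forall e x, e < m -> e < t -> reach t (et e) x -> P (et e) x -> P (eh e) (x + ew e)%R) ->
  forall v x, reach t v x -> P v x.

(** Scales are indices into [pw]. The scale [sc] stands for infinity and promises no path; any
    smaller one is certified by a path in the graph at time [t]. *)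
Definition upper (t v d : nat) : Prop := d < sc -> exists x, reach t v x /\ (x <= pw d)%R.
Definition lower (c : R) (t v d : nat) : Prop := forall x, reach t v x -> (pw d <= c * x)%R.

Lemma reach_pos t v x : reach t v x -> (0 <= x)%R.
Proof.
revert v x. apply reach_ind; [lra|]. intros e x He _ _ Hx. specialize (Hew e He). lra.
Qed.

(** Going back in time only removes paths, so a lower bound for a later graph holds for an earlier
    one. Lengths are nonnegative, which allows the factor to grow. *)
Lemma lower_weaken c c' t t' v d :
  (c <= c')%R -> t' <= t -> lower c t v d -> lower c' t' v d.
Proof.
intros Hc Ht H x Hx. pose proof (reach_pos _ _ _ Hx).
apply Rle_trans with (c * x)%R; [apply H; eauto|]. nra.
Qed.

Lemma upper_mono t t' v d : t <= t' -> upper t v d -> upper t' v d.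
Proof. intros Ht H Hd. destruct (H Hd) as (x & Hx & L). eauto. Qed.

(* [Uat mid v x]: the value x is a legitimate upper estimate; [pw sc] plays the
   role of infinity. *)
Definition Uat (t v : nat) (x : R) : Prop :=
  (1 <= x)%R /\ ((x < pw sc)%R -> exists y, reach t v y /\ (y <= x)%R).

Lemma Uat_step t e x : e < m -> e < t -> Uat t (et e) x -> Uat t (eh e) (x + ew e)%R.
Proof.
intros He Ht [H1 H2]. pose proof (Hew e He). split; [lra|]. intros H3.
destruct H2 as (y & Hy & L); [lra|]. exists (y + ew e)%R. split; [auto|lra].
Qed.

Lemma Uat_scale t t' v d : t <= t' -> 1 <= d -> d <= sc -> upper t v d -> Uat t' v (pw d).
Proof.
intros Ht Hd Hs H. split.
- rewrite <- pw1. apply pw_mono. lia.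
- intros Hlt. destruct (Nat.eq_dec d sc) as [->|]; [lra|].
  destruct H as (x & Hx & L); [lia|]. eauto.
Qed.

Lemma Uat_edge t t' e d :
  e < m -> e < t' -> t <= t' -> d <= sc -> (et e = src \/ upper t (et e) d) ->
  Uat t' (eh e) (pw d + ew e)%R.
Proof.
intros He Ht Htt Hd H. pose proof (Hew e He).
assert (0 <= pw d)%R by (rewrite <- pw0; apply pw_mono; lia).
split; [lra|]. intros Hlt.
destruct H as [Hs|H].
- exists (0 + ew e)%R. split; [|lra]. apply reach_step; auto. rewrite Hs. auto.
- destruct (Nat.eq_dec d sc) as [->|]; [lra|]. destruct H as (x & Hx & L); [lia|].
  exists (x + ew e)%R. split; [|lra]. eauto.
Qed.

(** Induction along a path, appending edges. At a recomputed vertex ([al]) the relaxed inequality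
    through the last edge gives c x + w <= c (x + w), so the factor [c] is not increased. At any
    other vertex the scale [cur] already has the lower bound at the midpoint by hypothesis. The
    minimality of the keys enters only through these inequalities. *)
Lemma midpoint_lower c mid (al : nat -> Prop) (kf : nat -> R) (cur : nat -> nat) :
  (1 <= c)%R -> (forall v, al v \/ ~ al v) -> ~ al src -> cur src = 0 ->
  (forall v, HS v -> ~ al v -> lower c mid v (cur v)) ->
  (forall e, e < m -> e < mid -> al (eh e) ->
     (kf (eh e) <= pw (cur (et e)) + ew e)%R /\
     (al (et e) -> kf (eh e) <= kf (et e) + ew e)%R) ->
  forall v x, al v -> reach mid v x -> (kf v <= c * x)%R.
Proof.
intros Hc Hdec Hsrc Hcs Hdead Hrel.
assert (G : forall v x, reach mid v x ->
  (al v -> (kf v <= c * x)%R) /\ (~ al v -> (pw (cur v) <= c * x)%R)).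
{ intros v x Hr. pattern v, x. revert v x Hr. apply reach_ind.
  - split; [tauto|]. rewrite Hcs, pw0. lra.
  - intros e x He Ht Hr [IH1 IH2]. pose proof (Hew e He). pose proof (reach_pos _ _ _ Hr).
    split.
    + intros Hal. destruct (Hrel e He Ht Hal) as [A B].
      destruct (Hdec (et e)) as [Ha|Ha].
      * specialize (B Ha). specialize (IH1 Ha). nra.
      * specialize (IH2 Ha). nra.
    + intros Hal. destruct (Nat.eq_dec (eh e) src) as [E|E].
      * rewrite E, Hcs, pw0. nra.
      * apply Hdead; auto. }
intros v x Hv Hx. now apply G.
Qed.

(** The scale below [x] is less than the key, and one step of the scales multiplies by [q]; this is
    the loss of one level. The step from scale 0 to scale 1 has no such ratio and is covered by 1 <=
    k. If [x] was raised to [lo], the bound is that of [lo] itself. *)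
Lemma round_lower c t v x k lo :
  (1 <= c)%R -> (1 <= k)%R -> (forall y, reach t v y -> (k <= c * y)%R) ->
  lower c t v lo -> x <= sc -> (x = lo \/ x = 0 \/ (pw (x - 1)%nat < k)%R) ->
  lower (c * q) t v x.
Proof.
intros Hc Hk Hkx Hlo Hx H y Hy. pose proof (reach_pos _ _ _ Hy). specialize (Hkx y Hy).
assert (Hcq : (c * y <= c * q * y)%R) by nra.
destruct H as [->|[->|H]].
- specialize (Hlo y Hy). lra.
- rewrite pw0. nra.
- destruct x as [|[|x]]; [rewrite pw0; nra | rewrite pw1; lra|].
  replace (S (S x) - 1) with (S x) in H by lia. rewrite pwS by lia. nra.
Qed.

(** The order of the queue: by starting time, and without repeated vertices for one starting time.
    The records of one interval are therefore contiguous and form the group treated by one run of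
    Dijkstra's algorithm. *)
Definition ord (r r' : rcd) : Prop := rl r < rl r' \/ (rl r = rl r' /\ rv r <> rv r').

Fixpoint ordered (rs : list rcd) : Prop :=
  match rs with [] => True | r :: rs' => (forall r', In r' rs' -> ord r r') /\ ordered rs' end.

Lemma ordered_app rs rs' :
  ordered (rs ++ rs') <->
  ordered rs /\ ordered rs' /\ forall r r', In r rs -> In r' rs' -> ord r r'.
Proof.
induction rs as [|r rs IH]; cbn.
- intuition.
- rewrite IH. split.
  + intros (H & A & B & C). splits; auto.
    * intros r' Hr'. apply H, in_app_iff. auto.
    * intros r1 r2 [<-|H1] H2; auto. apply H, in_app_iff. auto.
  + intros ((H & A) & B & C). splits; auto.
    intros r' Hr'. apply in_app_iff in Hr'. destruct Hr'; auto.
Qed.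

Lemma ordered_nodup rs l :
  ordered rs -> (forall r, In r rs -> rl r = l) -> NoDup (map rv rs).
Proof.
induction rs as [|r rs IH]; cbn; intros H Hl; constructor.
- intros C. apply in_map_iff in C. destruct C as (r' & E & Hr').
  destruct H as [H _]. destruct (H r' Hr') as [H'|[_ H']]; [|congruence].
  rewrite (Hl r), (Hl r') in H' by auto. lia.
- apply IH; [apply H | auto].
Qed.

Lemma span_level l rs : exists g rest, rs = g ++ rest /\ (forall r, In r g -> rl r = l) /\
  match rest with [] => True | r :: _ => rl r <> l end.
Proof.
induction rs as [|r rs IH]; [|destruct IH as (g & rest & -> & A & B)].
- exists [], []. cbn. tauto.
- destruct (Nat.eq_dec (rl r) l).
  + exists (r :: g), rest. splits; auto. intros r' [<-|]; auto.
  + exists [], (r :: g ++ rest). cbn. splits; auto. tauto.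
Qed.

(* Splitting a record at an intermediate scale does not change this sum, which therefore
   bounds the work on every level. *)
Definition wsum (g : nat -> nat) (rs : list rcd) : nat :=
  list_sum (map (fun r => g (rv r) * (rhi r - rlo r)) rs).

Lemma wsum_app g rs rs' : wsum g (rs ++ rs') = wsum g rs + wsum g rs'.
Proof. unfold wsum. now rewrite map_app, list_sum_app. Qed.

Lemma wsum_split g X mid rs :
  (forall r, In r rs -> rlo r <= X (rv r) <= rhi r) ->
  wsum g (lefts X rs ++ rights X mid rs) = wsum g rs.
Proof.
intros H. rewrite wsum_app. unfold wsum, lefts, rights.
induction rs as [|r rs IH]; cbn [flat_map map list_sum fold_right]; auto.
rewrite !map_app, !list_sum_app.
specialize (IH (fun r' Hr' => H r' (or_intror Hr'))).
pose proof (H r (or_introl eq_refl)) as Hr.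
unfold list_sum in *. rewrite <- IH.
destruct (Nat.ltb_spec (X (rv r)) (rhi r)), (Nat.ltb_spec (rlo r) (X (rv r)));
  cbn [map fold_right rv rhi rlo]; nia.
Qed.

(* The scales at the multiples of [len]. The value 0 at the last time F is not an estimate but
   a trivial lower bound, which saves computing the final distances first. *)
Record level_fun (len : nat) (c : R) (D : nat -> nat -> nat) : Prop := LevelFun {
  lf_0 : forall v, HS v -> D 0 v = sc;
  lf_F : forall v, HS v -> D F v = 0;
  lf_mono : forall t v, HS v -> Nat.divide len t -> t + len <= F -> D (t + len) v <= D t v;
  lf_le : forall t v, HS v -> Nat.divide len t -> t <= F -> D t v <= sc;
  lf_up : forall t v, HS v -> Nat.divide len t -> t < F -> upper t v (D t v);
  lf_low : forall t v, HS v -> Nat.divide len t -> t <= F -> lower c t v (D t v) }.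

(** The records are exactly the pairs of an interval and a vertex at which [D] changes. The time [b]
    up to which the list is complete makes the notion apply to a level still under construction. *)
Record level_recs (len b : nat) (D : nat -> nat -> nat) (rs : list rcd) : Prop := LevelRecs {
  lr_rec : forall r, In r rs -> Nat.divide len (rl r) /\ rl r + len <= b /\ HS (rv r) /\
    rhi r = D (rl r) (rv r) /\ rlo r = D (rl r + len) (rv r) /\ rlo r < rhi r;
  lr_all : forall t v, Nat.divide len t -> t + len <= b -> HS v -> D t v <> D (t + len) v ->
    exists r, In r rs /\ rl r = t /\ rv r = v;
  lr_ord : ordered rs }.

Section Level.
Variables (half : nat) (c : R) (D : nat -> nat -> nat) (Rs : list rcd).
Let len := 2 * half.
Hypothesis half1 : 1 <= half.
Hypothesis c1 : (1 <= c)%R.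
Hypothesis HF : Nat.divide len F.
Hypothesis HD : level_fun len c D.
Hypothesis HR : level_recs len F D Rs.

(** The invariant while a level is refined: the records [P] before time [t0] are done, [R] remain,
    and [Out] is the part of the new level produced so far. From [t0] on, the refined function [D']
    still repeats the value of [D] at the preceding multiple of [len], which is the right default
    for midpoints at which nothing changes. *)
Record sweep (t0 : nat) (P R : list rcd) (D' : nat -> nat -> nat) (Out : list rcd) : Prop :=
 Sweep {
  sw_div : Nat.divide len t0;
  sw_le : t0 <= F;
  sw_split : Rs = P ++ R;
  sw_P : forall r, In r P -> rl r < t0;
  sw_R : forall r, In r R -> t0 <= rl r;
  sw_agree : forall t v, Nat.divide len t -> D' t v = D t v;
  sw_later : forall t v, t0 <= t -> D' t v = D (t / len * len) v;
  sw_mid : forall t v, Nat.divide len t -> t < t0 -> HS v ->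
    D (t + len) v <= D' (t + half) v <= D t v /\ upper (t + half) v (D' (t + half) v) /\
    lower (c * q) (t + half) v (D' (t + half) v);
  sw_out : level_recs half t0 D' Out;
  sw_sum : forall g, wsum g Out = wsum g P }.

Lemma half_multiple t :
  Nat.divide half t -> Nat.divide len t \/ exists t1, Nat.divide len t1 /\ t = t1 + half.
Proof.
intros [k ->]. destruct (Nat.Even_or_Odd k) as [[j ->]|[j ->]].
- left. exists j. unfold len. lia.
- right. exists (j * len). split; [exists j; lia | unfold len; lia].
Qed.

Lemma divide_lt_step t t0 : Nat.divide len t -> Nat.divide len t0 -> t < t0 -> t + len <= t0.
Proof.
intros [a ->] [b ->] H. destruct (le_lt_dec b a) as [L|L].
- pose proof (Nat.mul_le_mono_r _ _ len L). lia.
- pose proof (Nat.mul_le_mono_r _ _ len L). lia.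
Qed.

Lemma mid_not_multiple t0 t : Nat.divide len t0 -> Nat.divide len t -> t <> t0 + half.
Proof.
intros [a ->] [b ->] H. destruct (le_lt_dec b a) as [L|L];
  pose proof (Nat.mul_le_mono_r _ _ len L); unfold len in *; lia.
Qed.

Lemma drop_record P grp R' t0 v :
  Rs = P ++ grp ++ R' -> (forall r, In r P -> rl r < t0) ->
  (forall r, In r grp -> rl r = t0) -> (forall r, In r R' -> rl r <> t0) ->
  Nat.divide len t0 -> t0 < F -> HS v ->
  (In v (map rv grp) <-> D t0 v <> D (t0 + len) v).
Proof.
intros ERs HP Hg HR' Hd HtF Hv.
assert (t0 + len <= F) by (now apply divide_lt_step). split.
- intros Hi. apply in_map_iff in Hi. destruct Hi as (r & <- & Hr).
  destruct (lr_rec _ _ _ _ HR r) as (_ & _ & _ & A & B & C).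
  { rewrite ERs, !in_app_iff. auto. }
  rewrite (Hg r Hr) in *. lia.
- intros Hne. destruct (lr_all _ _ _ _ HR t0 v) as (r & Hr & E1 & E2); auto.
  rewrite ERs, !in_app_iff in Hr. destruct Hr as [Hr|[Hr|Hr]].
  + apply HP in Hr. lia.
  + rewrite <- E2. now apply in_map.
  + now apply HR' in Hr.
Qed.

Lemma ordered_lefts X t0 grp :
  (forall r, In r grp -> rl r = t0) -> ordered grp -> ordered (lefts X grp).
Proof.
unfold lefts. induction grp as [|r grp IH]; cbn [flat_map]; [easy|]. intros Hg Ho.
apply ordered_app. destruct Ho as [Ho1 Ho2]. splits.
- destruct (X (rv r) <? rhi r); cbn; auto. split; auto. tauto.
- apply IH; auto. intros; apply Hg; cbn; auto.
- intros r1 r2 H1 H2. apply in_flat_map in H2. destruct H2 as (r3 & Hr3 & H2).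
  destruct (X (rv r) <? rhi r); [destruct H1 as [<-|[]]|destruct H1].
  destruct (X (rv r3) <? rhi r3); [destruct H2 as [<-|[]]|destruct H2].
  exact (Ho1 r3 Hr3).
Qed.

Lemma ordered_rights X mid t0 grp :
  (forall r, In r grp -> rl r = t0) -> ordered grp -> ordered (rights X mid grp).
Proof.
unfold rights. induction grp as [|r grp IH]; cbn [flat_map]; [easy|]. intros Hg Ho.
apply ordered_app. destruct Ho as [Ho1 Ho2]. splits.
- destruct (rlo r <? X (rv r)); cbn; auto. split; auto. tauto.
- apply IH; auto. intros; apply Hg; cbn; auto.
- intros r1 r2 H1 H2. apply in_flat_map in H2. destruct H2 as (r3 & Hr3 & H2).
  destruct (rlo r <? X (rv r)); [destruct H1 as [<-|[]]|destruct H1].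
  destruct (rlo r3 <? X (rv r3)); [destruct H2 as [<-|[]]|destruct H2].
  right. cbn. split; auto. destruct (Ho1 r3 Hr3) as [C|[_ C]]; auto.
  rewrite (Hg r), (Hg r3) in C by (cbn; auto). lia.
Qed.

Lemma in_lefts X grp r' : In r' (lefts X grp) <->
  exists r, In r grp /\ X (rv r) < rhi r /\ r' = Rcd (rl r) (rv r) (rhi r) (X (rv r)).
Proof.
unfold lefts. rewrite in_flat_map. split.
- intros (r & Hr & H). exists r. destruct (Nat.ltb_spec (X (rv r)) (rhi r)); [destruct H as [<-|[]]|destruct H]; auto.
- intros (r & Hr & H & ->). exists r. split; auto. apply Nat.ltb_lt in H. rewrite H. cbn; auto.
Qed.

Lemma in_rights X mid grp r' : In r' (rights X mid grp) <->
  exists r, In r grp /\ rlo r < X (rv r) /\ r' = Rcd mid (rv r) (X (rv r)) (rlo r).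
Proof.
unfold rights. rewrite in_flat_map. split.
- intros (r & Hr & H). exists r. destruct (Nat.ltb_spec (rlo r) (X (rv r))); [destruct H as [<-|[]]|destruct H]; auto.
- intros (r & Hr & H & ->). exists r. split; auto. apply Nat.ltb_lt in H. rewrite H. cbn; auto.
Qed.

(** Only the vertices of the group get new midpoint values; all others inherit the value of the left
    end. The new records are the left parts, starting at [t0], followed by the right parts, starting
    at the midpoint, so the order of the queue persists. *)
Lemma sweep_step t0 P grp R' D' Out X :
  sweep t0 P (grp ++ R') D' Out -> t0 < F ->
  (forall r, In r grp -> rl r = t0) -> (forall r, In r R' -> rl r <> t0) ->
  (forall r, In r grp -> rlo r <= X (rv r) <= rhi r /\
     upper (t0 + half) (rv r) (X (rv r)) /\ lower (c * q) (t0 + half) (rv r) (X (rv r))) ->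
  exists D'', sweep (t0 + len) (P ++ grp) R' D''
    (Out ++ lefts X grp ++ rights X (t0 + half) grp).
Proof.
intros [S1 S2 S3 S4 S5 S6 S7 S8 S9 S10] HtF Hg HR' HX.
exists (fun t v => if andb (t =? t0 + half) (inb v (map rv grp)) then X v else D' t v).
set (D'' := fun t v => _).
assert (Hst : t0 + len <= F) by (now apply divide_lt_step).
assert (Hdh : forall t, Nat.divide len t -> Nat.divide half t).
{ intros t [k ->]. exists (2 * k). unfold len. lia. }
assert (Hin : forall v, inb v (map rv grp) = true <-> In v (map rv grp)).
{ intros v. unfold inb. rewrite existsb_exists. split.
  - intros (x & Hx & E). apply Nat.eqb_eq in E. congruence.
  - intros H. exists v. rewrite Nat.eqb_refl. auto. }
assert (Dne : forall t v, t <> t0 + half -> D'' t v = D' t v).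
{ intros t v Ht. unfold D''. apply Nat.eqb_neq in Ht. now rewrite Ht. }
assert (Dal : forall v, In v (map rv grp) -> D'' (t0 + half) v = X v).
{ intros v Hv. unfold D''. apply Hin in Hv. rewrite Hv, Nat.eqb_refl. easy. }
assert (Ddead : forall v, ~ In v (map rv grp) -> D'' (t0 + half) v = D t0 v).
{ intros v Hv. unfold D''. rewrite Nat.eqb_refl. cbn [andb].
  destruct (inb v (map rv grp)) eqn:E; [apply Hin in E; tauto|].
  rewrite S7 by lia. f_equal. destruct S1 as [k ->].
  rewrite Nat.add_comm, Nat.div_add by (unfold len; lia).
  rewrite Nat.div_small by (unfold len; lia). lia. }
assert (Dmul : forall t v, Nat.divide len t -> D'' t v = D t v).
{ intros t v Ht. rewrite Dne; auto. now apply mid_not_multiple. }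
assert (Hrec : forall r, In r grp -> HS (rv r) /\ rhi r = D t0 (rv r) /\
  rlo r = D (t0 + len) (rv r) /\ rlo r < rhi r).
{ intros r Hr. destruct (lr_rec _ _ _ _ HR r) as (_ & _ & A & B & C & E).
  { rewrite S3, !in_app_iff. auto. } rewrite (Hg r Hr) in *. auto. }
assert (Hal : forall v, HS v -> In v (map rv grp) <-> D t0 v <> D (t0 + len) v).
{ intros v Hv. eapply drop_record; eauto. }
assert (Hdl : Nat.divide len (t0 + len)).
{ apply Nat.divide_add_r; auto. apply Nat.divide_refl. }
constructor; auto.
- rewrite S3, app_assoc. auto.
- intros r Hr. apply in_app_iff in Hr. destruct Hr as [Hr|Hr].
  + apply S4 in Hr. lia. + apply Hg in Hr. unfold len. lia.
- intros r Hr. assert (t0 <= rl r) by (apply S5, in_app_iff; auto).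
  apply divide_lt_step; auto.
  + apply (lr_rec _ _ _ _ HR). rewrite S3, !in_app_iff. auto.
  + specialize (HR' r Hr). lia.
- intros t v Ht. rewrite Dne by (unfold len in *; lia). apply S7. lia.
- intros t v Hd Ht Hv. destruct (Nat.eq_dec t t0) as [->|Hne].
  + destruct (in_dec Nat.eq_dec v (map rv grp)) as [Hi|Hi].
    * rewrite Dal by auto. apply in_map_iff in Hi. destruct Hi as (r & <- & Hr).
      destruct (Hrec r Hr) as (_ & <- & <- & _). apply HX; auto.
    * rewrite Ddead by auto.
      assert (E : D t0 v = D (t0 + len) v).
      { destruct (Nat.eq_dec (D t0 v) (D (t0 + len) v)); auto. exfalso. apply Hi, Hal; auto. }
      (* Here the scales at the two ends agree: the left end provides the upper bound and the right
         end the lower one. *)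
      split; [lia|]. split.
      -- apply upper_mono with t0; [lia|]. apply (lf_up _ _ _ HD); auto.
      -- rewrite E. apply lower_weaken with c (t0 + len); [nra | unfold len; lia|].
         apply (lf_low _ _ _ HD); auto.
  + assert (t < t0).
    { destruct (Nat.lt_ge_cases t t0); auto. exfalso.
      assert (t0 + len <= t) by (apply divide_lt_step; auto; lia). lia. }
    rewrite Dne by lia. auto.
- destruct S9 as [O1 O2 O3].
  constructor.
  + intros r Hr. apply in_app_iff in Hr. destruct Hr as [Hr|Hr].
    * destruct (O1 r Hr) as (A1 & A2 & A3 & A4 & A5 & A6). rewrite !Dne by lia.
      splits; auto. lia.
    * apply in_app_iff in Hr. destruct Hr as [Hr|Hr].
      -- apply in_lefts in Hr. destruct Hr as (r0 & Hr0 & HXr & ->).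
         destruct (Hrec r0 Hr0) as (B1 & B2 & B3 & B4). cbn [rl rv rhi rlo].
         rewrite (Hg r0 Hr0). rewrite Dal by (now apply in_map). rewrite Dmul by auto.
         splits; auto. unfold len. lia.
      -- apply in_rights in Hr. destruct Hr as (r0 & Hr0 & HXr & ->).
         destruct (Hrec r0 Hr0) as (B1 & B2 & B3 & B4). cbn [rl rv rhi rlo].
         rewrite Dal by (now apply in_map).
         replace (t0 + half + half) with (t0 + len) by (unfold len; lia).
         rewrite Dmul by auto. splits; auto.
         apply Nat.divide_add_r; auto. apply Nat.divide_refl.
  + intros t v Ht Hb Hv Hne.
    destruct (le_lt_dec (t + half) t0) as [Hle|Hgt].
    * rewrite !Dne in Hne by lia. destruct (O2 t v) as (r & Hr & E); auto.
      exists r. rewrite in_app_iff. auto.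
    * assert (Ht' : t = t0 \/ t = t0 + half).
      { apply half_multiple in Ht. destruct Ht as [Ht|(t1 & Ht1 & ->)].
        - left. destruct (Nat.lt_trichotomy t t0) as [C|[C|C]]; auto; exfalso.
          + apply divide_lt_step in C; auto. unfold len in *; lia.
          + apply divide_lt_step in C; auto. unfold len in *; lia.
        - right. f_equal. destruct (Nat.lt_trichotomy t1 t0) as [C|[C|C]]; auto; exfalso.
          + apply divide_lt_step in C; auto. unfold len in *; lia.
          + apply divide_lt_step in C; auto. unfold len in *; lia. }
      destruct (in_dec Nat.eq_dec v (map rv grp)) as [Hi|Hi].
      -- pose proof Hi as Hi'. apply in_map_iff in Hi'. destruct Hi' as (r & <- & Hr).
         destruct (Hrec r Hr) as (B1 & B2 & B3 & B4). destruct (HX r Hr) as (C1 & _ & _).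
         destruct Ht' as [->| ->].
         ++ rewrite Dmul, Dal in Hne by auto.
            exists (Rcd (rl r) (rv r) (rhi r) (X (rv r))). cbn. rewrite (Hg r Hr). splits; auto.
            rewrite !in_app_iff. right. left. apply in_lefts. exists r. rewrite (Hg r Hr).
            splits; auto. lia.
         ++ replace (t0 + half + half) with (t0 + len) in Hne by (unfold len; lia).
            rewrite Dal, Dmul in Hne by auto.
            exists (Rcd (t0 + half) (rv r) (X (rv r)) (rlo r)). cbn. splits; auto.
            rewrite !in_app_iff. right. right. apply in_rights. exists r. splits; auto. lia.
      -- exfalso. apply Hne.
         assert (E : D t0 v = D (t0 + len) v).
         { destruct (Nat.eq_dec (D t0 v) (D (t0 + len) v)); auto. exfalso. apply Hi, Hal; auto. }
         destruct Ht' as [->| ->].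
         ++ rewrite Ddead, Dmul; auto.
         ++ replace (t0 + half + half) with (t0 + len) by (unfold len; lia).
            rewrite Ddead, Dmul; auto.
  + assert (Hog : ordered grp).
    { pose proof (lr_ord _ _ _ _ HR) as Ho. rewrite S3 in Ho.
      apply ordered_app in Ho. destruct Ho as (_ & Ho & _). apply ordered_app in Ho. apply Ho. }
    apply ordered_app. splits; auto.
    * apply ordered_app. splits.
      -- eapply ordered_lefts; eauto.
      -- eapply ordered_rights; eauto.
      -- intros r1 r2 H1 H2. apply in_lefts in H1. destruct H1 as (r3 & A1 & A2 & ->).
         apply in_rights in H2. destruct H2 as (r4 & B1 & B2 & ->).
         left. cbn. rewrite (Hg r3); auto. lia.
    * intros r1 r2 H1 H2. left. destruct (O1 r1 H1) as (_ & A & _).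
      apply in_app_iff in H2. destruct H2 as [H2|H2].
      -- apply in_lefts in H2. destruct H2 as (r4 & B1 & B2 & ->). cbn. rewrite (Hg r4); auto. lia.
      -- apply in_rights in H2. destruct H2 as (r4 & B1 & B2 & ->). cbn. lia.
- intros g. rewrite !wsum_app, S10. f_equal. rewrite <- wsum_app. apply wsum_split.
  intros r Hr. apply HX. auto.
Qed.

(** Intervals without records are steps with an empty group; the program jumps over them, and the
    current scales remain correct because nothing changes there. *)
Lemma sweep_advance k t0 P R D' Out :
  sweep t0 P R D' Out -> t0 + k * len <= F ->
  (forall r, In r R -> t0 + k * len <= rl r) ->
  exists D'', sweep (t0 + k * len) P R D'' Out /\
    forall v, HS v -> D (t0 + k * len) v = D t0 v.
Proof.
revert t0 D'. induction k as [|k IH]; intros t0 D' Hs HF' HRl.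
- rewrite Nat.add_0_r. exists D'. auto.
- assert (HtF : t0 < F) by (unfold len in *; nia).
  destruct (sweep_step t0 P [] R D' Out (fun _ => 0)) as [D'' Hs'']; auto; try easy.
  { intros r Hr. apply HRl in Hr. unfold len in *. nia. }
  cbn in Hs''. rewrite !app_nil_r in Hs''.
  destruct (IH (t0 + len) D'' Hs'') as (D3 & Hs3 & E); [lia| |].
  { intros r Hr. apply HRl in Hr. lia. }
  replace (t0 + S k * len) with (t0 + len + k * len) by lia.
  exists D3. split; auto. intros v Hv. rewrite E by auto.
  destruct (Nat.eq_dec (D t0 v) (D (t0 + len) v)) as [|Hne]; auto. exfalso.
  apply (drop_record P [] R t0 v) in Hne; auto; try easy.
  + apply (sw_split _ _ _ _ _ Hs). + apply (sw_P _ _ _ _ _ Hs).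
  + intros r Hr. apply HRl in Hr. unfold len in *. nia.
  + apply (sw_div _ _ _ _ _ Hs).
Qed.

Lemma sweep_init : sweep 0 [] Rs (fun t v => D (t / len * len) v) [].
Proof.
constructor; auto; try easy; try lia.
- apply Nat.divide_0_r.
- intros t v [k ->]. now rewrite Nat.div_mul by (unfold len; lia).
- constructor; try easy. intros. lia.
Qed.

Lemma sweep_end P D' Out :
  sweep F P [] D' Out ->
  level_fun half (c * q) D' /\ level_recs half F D' Out /\ forall g, wsum g Out = wsum g Rs.
Proof.
intros [S1 S2 S3 S4 S5 S6 S7 S8 S9 S10]. rewrite app_nil_r in S3. subst P.
assert (Hcq : (c <= c * q)%R) by nra.
splits; auto. constructor.
- intros v Hv. rewrite S6 by apply Nat.divide_0_r. now apply (lf_0 _ _ _ HD).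
- intros v Hv. rewrite S6 by auto. now apply (lf_F _ _ _ HD).
- intros t v Hv Ht Hb. apply half_multiple in Ht. destruct Ht as [Ht|(t1 & Ht1 & ->)].
  + rewrite (S6 t) by auto. apply S8; auto. lia.
  + replace (t1 + half + half) with (t1 + len) by (unfold len; lia).
    rewrite (S6 (t1 + len)); [apply S8; auto; lia|].
    apply Nat.divide_add_r; auto. apply Nat.divide_refl.
- intros t v Hv Ht Hb. apply half_multiple in Ht. destruct Ht as [Ht|(t1 & Ht1 & ->)].
  + rewrite S6 by auto. now apply (lf_le _ _ _ HD).
  + eapply Nat.le_trans; [apply S8; auto; lia|]. apply (lf_le _ _ _ HD); auto. lia.
- intros t v Hv Ht Hb. apply half_multiple in Ht. destruct Ht as [Ht|(t1 & Ht1 & ->)].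
  + rewrite S6 by auto. now apply (lf_up _ _ _ HD).
  + apply S8; auto. lia.
- intros t v Hv Ht Hb. apply half_multiple in Ht. destruct Ht as [Ht|(t1 & Ht1 & ->)].
  + rewrite S6 by auto. apply lower_weaken with c t; auto. now apply (lf_low _ _ _ HD).
  + apply S8; auto. lia.
Qed.

(** The scales of all possible tails of edges: a vertex other than the source that is not a head has
    the infinite scale throughout. *)
Definition cur_at (t : nat) (cur : nat -> nat) : Prop :=
  cur src = 0 /\ (forall v, HS v -> cur v = D t v) /\
  (forall e, e < m -> ~ HS (et e) -> et e <> src -> cur (et e) = sc).

Lemma group_estimates l cur grp :
  Nat.divide len l -> l < F -> cur_at l cur -> (forall r, In r grp -> In r Rs /\ rl r = l) ->
  (forall r, In r grp -> Uat (l + half) (rv r) (pw (rhi r))) /\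
  (forall e, e < m -> e < l + half -> Uat (l + half) (eh e) (pw (cur (et e)) + ew e)%R).
Proof.
intros Hl HlF (C1 & C2 & C3) Hg. split.
- intros r Hr. destruct (Hg r Hr) as [Hr' E].
  destruct (lr_rec _ _ _ _ HR r Hr') as (_ & A & B & C & _ & G).
  rewrite E in *. apply Uat_scale with l; try lia.
  + rewrite C. apply (lf_le _ _ _ HD); auto. lia.
  + rewrite C. apply (lf_up _ _ _ HD); auto.
- intros e He Ht. destruct (HSdec (et e)) as [Hh|Hh].
  + rewrite C2 by auto. apply Uat_edge with l; auto; [lia| |].
    * apply (lf_le _ _ _ HD); auto. lia.
    * right. apply (lf_up _ _ _ HD); auto.
  + destruct (Nat.eq_dec (et e) src) as [E|E].
    * rewrite E, C1. apply Uat_edge with l; auto; lia.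
    * rewrite C3 by auto. apply Uat_edge with l; auto; [lia|]. right. intros C. lia.
Qed.

(** Combines [midpoint_lower], whose boundary condition holds because the vertices outside of the
    group have no record, with [round_lower]. The upper bound holds because rounding only increases
    a key that is witnessed by a path. *)
Lemma group_valid P grp R' l cur X (kf : nat -> R) :
  Rs = P ++ grp ++ R' -> (forall r, In r P -> rl r < l) ->
  (forall r, In r grp -> rl r = l) -> (forall r, In r R' -> rl r <> l) ->
  Nat.divide len l -> l < F -> cur_at l cur ->
  (forall r, In r grp -> rlo r <= X (rv r) <= rhi r /\ (kf (rv r) <= pw (X (rv r)))%R /\
    (X (rv r) = rlo r \/ X (rv r) = 0 \/ (pw (X (rv r) - 1)%nat < kf (rv r))%R) /\
    Uat (l + half) (rv r) (kf (rv r)) /\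
    forall e, e < m -> e < l + half -> eh e = rv r ->
      (kf (rv r) <= pw (cur (et e)) + ew e)%R /\
      forall r', In r' grp -> et e = rv r' -> (kf (rv r) <= kf (rv r') + ew e)%R) ->
  forall r, In r grp -> rlo r <= X (rv r) <= rhi r /\
     upper (l + half) (rv r) (X (rv r)) /\ lower (c * q) (l + half) (rv r) (X (rv r)).
Proof.
intros ERs HP Hg HR' Hl HlF (C1 & C2 & C3) H r Hr.
assert (Hst : l + len <= F) by (now apply divide_lt_step).
assert (Hdl : Nat.divide len (l + len)).
{ apply Nat.divide_add_r; auto. apply Nat.divide_refl. }
assert (Hrs : forall r, In r grp -> In r Rs) by (intros; rewrite ERs, !in_app_iff; auto).
assert (Hlow : forall v, HS v -> lower c (l + half) v (D (l + len) v)).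
{ intros v Hv. apply lower_weaken with c (l + len); [lra | unfold len; lia|].
  apply (lf_low _ _ _ HD); auto. }
destruct (H r Hr) as (A1 & A2 & A3 & A4 & A5).
destruct (lr_rec _ _ _ _ HR r (Hrs r Hr)) as (_ & _ & B1 & B2 & B3 & B4).
rewrite (Hg r Hr) in *.
assert (Hhi : rhi r <= sc) by (rewrite B2; apply (lf_le _ _ _ HD); auto; lia).
split; [auto|]. split.
- intros Hx. pose proof (pw_top _ Hx). destruct A4 as [_ A4].
  destruct A4 as (y & Hy & L); [lra|]. exists y. split; auto. lra.
- apply round_lower with (k := kf (rv r)) (lo := rlo r); auto; [apply A4 | | |lia].
  + intros y Hy. revert Hy.
    apply midpoint_lower with (al := fun v => In v (map rv grp)) (cur := cur); auto.
    * intros v. destruct (in_dec Nat.eq_dec v (map rv grp)); auto.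
    * intros C. apply in_map_iff in C. destruct C as (r' & E & Hr').
      apply HSsrc. rewrite <- E. apply (lr_rec _ _ _ _ HR); auto.
    * intros v Hv Hn. rewrite C2 by auto.
      replace (D l v) with (D (l + len) v); auto.
      destruct (Nat.eq_dec (D (l + len) v) (D l v)); auto. exfalso. apply Hn.
      eapply drop_record; eauto.
    * intros e He Ht Ha. apply in_map_iff in Ha. destruct Ha as (r' & E & Hr').
      destruct (H r' Hr') as (_ & _ & _ & _ & A5').
      destruct (A5' e He Ht) as [G1 G2]; auto. rewrite E in *. split; auto.
      intros Ha'. apply in_map_iff in Ha'. destruct Ha' as (r2 & E2 & Hr2).
      rewrite <- E2. auto.
    * now apply in_map.
  + rewrite B3. auto.
Qed.
End Level.
End Sweep.

(** * The preprocessing for one source *)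

Inductive chain (nx : nat -> nat) : nat -> list nat -> Prop :=
| chain_nil : chain nx 0 []
| chain_cons e l : chain nx (nx e) l -> chain nx (S e) (e :: l).

Fixpoint qseg (ql qv qa qb : nat -> nat) (i : nat) (rs : list rcd) : Prop :=
  match rs with
  | [] => True
  | r :: rs' => (ql i = rl r /\ qv i = rv r /\ qa i = rhi r /\ qb i = rlo r) /\
                qseg ql qv qa qb (S i) rs'
  end.

Lemma qseg_app ql qv qa qb rs rs' i :
  qseg ql qv qa qb i (rs ++ rs') <->
  qseg ql qv qa qb i rs /\ qseg ql qv qa qb (i + length rs) rs'.
Proof.
revert i. induction rs as [|r rs IH]; intros i; cbn.
- rewrite Nat.add_0_r. tauto.
- rewrite IH. replace (S i + length rs) with (i + S (length rs)) by lia. tauto.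
Qed.

Lemma qseg_aset ql qv qa qb rs i j a b c d :
  i + length rs <= j -> qseg ql qv qa qb i rs ->
  qseg (aset ql j a) (aset qv j b) (aset qa j c) (aset qb j d) i rs.
Proof.
revert i. induction rs as [|r rs IH]; intros i Hj; cbn in *; auto.
intros [(A & B & C & D) H]. rewrite !aset_neq by lia. splits; auto. apply IH; auto. lia.
Qed.

Lemma qseg_ext ql qv qa qb ql' qv' qa' qb' rs i :
  (forall j, i <= j < i + length rs ->
     ql' j = ql j /\ qv' j = qv j /\ qa' j = qa j /\ qb' j = qb j) ->
  qseg ql qv qa qb i rs -> qseg ql' qv' qa' qb' i rs.
Proof.
revert i. induction rs as [|r rs IH]; intros i Hj; cbn in *; auto.
intros [(A & B & C & D) H].
destruct (Hj i) as (-> & -> & -> & ->); [lia|]. splits; auto.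
apply IH; auto. intros j Hj'. apply Hj. lia.
Qed.

Lemma qseg_snoc ql qv qa qb rs i r j :
  j = i + length rs -> qseg ql qv qa qb i rs ->
  qseg (aset ql j (rl r)) (aset qv j (rv r)) (aset qa j (rhi r)) (aset qb j (rlo r)) i
    (rs ++ [r]).
Proof.
intros -> H. apply qseg_app. split; [apply qseg_aset; auto|].
cbn. rewrite !aset_eq. auto.
Qed.

Fixpoint qxseg (qx X : nat -> nat) (i : nat) (rs : list rcd) : Prop :=
  match rs with [] => True | r :: rs' => qx i = X (rv r) /\ qxseg qx X (S i) rs' end.

Lemma qxseg_app qx X rs rs' i :
  qxseg qx X i (rs ++ rs') <-> qxseg qx X i rs /\ qxseg qx X (i + length rs) rs'.
Proof.
revert i. induction rs as [|r rs IH]; intros i; cbn.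
- rewrite Nat.add_0_r. tauto.
- rewrite IH. replace (S i + length rs) with (i + S (length rs)) by lia. tauto.
Qed.

Lemma qxseg_aset qx X rs i j a v x :
  i + length rs <= j -> ~ In v (map rv rs) -> qxseg qx X i rs ->
  qxseg (aset qx j a) (aset X v x) i rs.
Proof.
revert i. induction rs as [|r rs IH]; intros i Hj Hv; cbn in *; auto.
intros [A H]. rewrite aset_neq by lia. rewrite aset_neq by (intros C; apply Hv; auto).
split; auto. apply IH; auto. lia.
Qed.

Lemma lefts_aset X v x rs : ~ In v (map rv rs) -> lefts (aset X v x) rs = lefts X rs.
Proof.
unfold lefts. induction rs as [|r rs IH]; cbn [flat_map]; auto. intros H. cbn in H.
rewrite aset_neq by (intros C; apply H; auto). rewrite IH; auto.
Qed.

Lemma lefts_length X rs : length (lefts X rs) <= length rs.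
Proof.
unfold lefts. induction rs as [|r rs IH]; cbn [flat_map length]; auto. rewrite length_app.
destruct (X (rv r) <? rhi r); cbn [length]; lia.
Qed.

Lemma lefts_snoc X rs r :
  lefts X (rs ++ [r]) = lefts X rs ++
    (if X (rv r) <? rhi r then [Rcd (rl r) (rv r) (rhi r) (X (rv r))] else []).
Proof. unfold lefts. rewrite flat_map_app. cbn. now rewrite app_nil_r. Qed.

Lemma rights_snoc X mid rs r :
  rights X mid (rs ++ [r]) = rights X mid rs ++
    (if rlo r <? X (rv r) then [Rcd mid (rv r) (X (rv r)) (rlo r)] else []).
Proof. unfold rights. rewrite flat_map_app. cbn. now rewrite app_nil_r. Qed.

(* Integer variables: 0 n, 1 m, 5 index of the infinite scale, 6 number of heads of edges,
   7 K, 8 2^K, 9 length of the known prefix, 10 end of the window of marked edges, 11 source,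
   12 and 13 ends of the queue, 14 length of the intervals, 15 end of the level, 16 and 17
   start and midpoint of the group.
   Integer arrays: 0 position of an edge, by its ends; 1, 2 and 3, 4 lists of in- and
   out-edges; 5 heads; 6 scales at the start of the interval; 7 tournament; 8 to 11 queue of
   records; 12 scales at the midpoint; 13 table of times; 14 marks of inserted edges; 15, 16
   ends of the edges; 17, 18, 19 ends and status of the nodes of a query.
   Real arrays: 0 scales, 1 keys, 2 weights, 3 and 4 weights and values of the nodes of a query.
   Positions and list links are shifted by 1, so that 0 means none. *)
Definition inloop : com :=
  While (BILe (IConst 1) (IVar 21)) (seqs [
    ISet 28 (ISub (IVar 21) (IConst 1));
    If (BILe (IVar 17) (IVar 28)) Skip (seqs [
      RSet 6 (RAdd (RLd 0 (Ld 6 (Ld 15 (IVar 28)))) (RLd 2 (IVar 28)));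
      If (BRLe (RVar 5) (RVar 6)) Skip (RSet 5 (RVar 6))]);
    ISet 21 (Ld 2 (IVar 28))]).

(** The group is the maximal run of records that start together. A key starts from the old scale and
    from the in-edges, evaluated with the scales at the start of the interval: these are the
    boundary values for tails outside of the group, and still legitimate upper estimates for tails
    inside. *)
Definition passA : com :=
  While (BAnd (BNot (BILe (IVar 15) (IVar 18))) (BIEq (Ld 8 (IVar 18)) (IVar 16))) (seqs [
    ISet 20 (Ld 9 (IVar 18));
    RSet 5 (RLd 0 (Ld 10 (IVar 18)));
    ISet 21 (Ld 1 (IVar 20));
    inloop;
    RSt 1 (IVar 20) (RVar 5);
    ISet 22 (IAdd (IVar 0) (IVar 20));
    St 7 (IVar 22) (IAdd (IVar 20) (IConst 1));
    fixpath;
    ISet 18 (IAdd (IVar 18) (IConst 1))]).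

(** There is no membership test: a vertex outside of the group has key 0, and a settled one has a
    key at most the current one, so the comparison of keys rejects both. *)
Definition outloop : com :=
  While (BILe (IConst 1) (IVar 21)) (seqs [
    ISet 28 (ISub (IVar 21) (IConst 1));
    If (BILe (IVar 17) (IVar 28)) Skip (seqs [
      ISet 20 (Ld 16 (IVar 28));
      RSet 6 (RAdd (RVar 5) (RLd 2 (IVar 28)));
      If (BRLe (RLd 1 (IVar 20)) (RVar 6)) Skip (seqs [
        RSt 1 (IVar 20) (RVar 6);
        ISet 22 (IAdd (IVar 0) (IVar 20));
        fixpath])]);
    ISet 21 (Ld 4 (IVar 28))]).

Definition dijkstra : com :=
  While (BILe (IConst 1) (Ld 7 (IConst 1))) (seqs [
    ISet 29 (ISub (Ld 7 (IConst 1)) (IConst 1));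
    ISet 22 (IAdd (IVar 0) (IVar 29));
    St 7 (IVar 22) (IConst 0);
    fixpath;
    RSet 5 (RLd 1 (IVar 29));
    ISet 21 (Ld 3 (IVar 29));
    outloop]).

Definition append (l v a b : iexp) : com := seqs [
  St 8 (IVar 13) l; St 9 (IVar 13) v; St 10 (IVar 13) a; St 11 (IVar 13) b;
  ISet 13 (IAdd (IVar 13) (IConst 1))].

(** Rounding and emission of the left parts. The right parts need a separate pass, since in the
    sorted queue all left parts of a group precede all its right parts; array 12 carries the scales
    over. *)
Definition passC : com :=
  While (BNot (BILe (IVar 19) (IVar 18))) (seqs [
    ISet 20 (Ld 9 (IVar 18));
    RSet 5 (RLd 1 (IVar 20));
    ISet 25 (IConst 0);
    ISet 26 (Ld 10 (IVar 18));
    bsearch (BRLe (RVar 5) (RLd 0 (IVar 27)));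
    If (BILe (Ld 11 (IVar 18)) (IVar 25)) Skip (ISet 25 (Ld 11 (IVar 18)));
    St 12 (IVar 18) (IVar 25);
    RSt 1 (IVar 20) (ROfInt (IConst 0));
    If (BILe (Ld 10 (IVar 18)) (IVar 25)) Skip
      (append (IVar 16) (IVar 20) (Ld 10 (IVar 18)) (IVar 25));
    ISet 18 (IAdd (IVar 18) (IConst 1))]).

(** Besides emitting the right parts, this pass moves the current scales to the end of the interval,
    which is the start of the next one. *)
Definition passD : com :=
  While (BNot (BILe (IVar 19) (IVar 18))) (seqs [
    ISet 20 (Ld 9 (IVar 18));
    ISet 25 (Ld 12 (IVar 18));
    ISet 26 (Ld 11 (IVar 18));
    If (BILe (IVar 25) (IVar 26)) Skip
      (append (IVar 17) (IVar 20) (IVar 25) (IVar 26));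
    St 6 (IVar 20) (IVar 26);
    ISet 18 (IAdd (IVar 18) (IConst 1))]).

Definition group : com := seqs [
  ISet 16 (Ld 8 (IVar 12)); ISet 17 (IAdd (IVar 16) (IVar 14)); ISet 18 (IVar 12);
  passA; ISet 19 (IVar 18); dijkstra; ISet 18 (IVar 12); passC; ISet 18 (IVar 12); passD;
  ISet 12 (IVar 19)].

Definition reset : com := seqs [
  ISet 18 (IConst 0);
  While (BNot (BILe (IVar 6) (IVar 18))) (seqs [
    St 6 (Ld 5 (IVar 18)) (IVar 5);
    ISet 18 (IAdd (IVar 18) (IConst 1))]);
  St 6 (IVar 11) (IConst 0)].

(** Variable 15 separates the records of the old level from those of the new one, which are appended
    behind them in the same queue. *)
Definition level : com := seqs [
  reset;
  ISet 14 (IDiv (IVar 14) (IConst 2));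
  ISet 15 (IVar 13);
  While (BNot (BILe (IVar 15) (IVar 12))) group].

Definition ix (n sc s v x : nat) : nat := (s * n + v) * sc + x.

Lemma ix_inj n sc s v x s' v' x' :
  v < n -> v' < n -> x < sc -> x' < sc -> ix n sc s v x = ix n sc s' v' x' -> s = s' /\ v = v' /\ x = x'.
Proof.
unfold ix. intros Hv Hv' Hx Hx' E.
assert (A : s * n + v = s' * n + v').
{ apply (f_equal (fun t => t / sc)) in E. rewrite !Nat.div_add_l in E by lia.
  rewrite !Nat.div_small in E by lia. lia. }
assert (B : s = s').
{ apply (f_equal (fun t => t / n)) in A. rewrite !Nat.div_add_l in A by lia.
  rewrite !Nat.div_small in A by lia. lia. }
subst. lia.
Qed.

Definition initq : com := seqs [
  ISet 12 (IConst 0); ISet 13 (IConst 0); ISet 18 (IConst 0);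
  While (BNot (BILe (IVar 6) (IVar 18))) (seqs [
    ISet 20 (Ld 5 (IVar 18));
    If (BIEq (IVar 20) (IVar 11)) Skip (append (IConst 0) (IVar 20) (IVar 5) (IConst 0));
    ISet 18 (IAdd (IVar 18) (IConst 1))])].

(** When intervals have length 1, the cells from [rlo] to below [rhi] belong to the scales passed
    between the times [rl] and [rl + 1]. The entry is the later time, which is positive and leaves 0
    free. *)
Definition fillrec : com :=
  While (BNot (BILe (IVar 26) (IVar 25))) (seqs [
    St 13 (IAdd (IMul (IAdd (IMul (IVar 11) (IVar 0)) (IVar 20)) (IVar 5)) (IVar 25))
       (IAdd (IVar 16) (IConst 1));
    ISet 25 (IAdd (IVar 25) (IConst 1))]).

Definition fill : com :=
  While (BNot (BILe (IVar 13) (IVar 12))) (seqs [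
    ISet 16 (Ld 8 (IVar 12)); ISet 20 (Ld 9 (IVar 12));
    ISet 26 (Ld 10 (IVar 12)); ISet 25 (Ld 11 (IVar 12));
    fillrec;
    ISet 12 (IAdd (IVar 12) (IConst 1))]).

Definition source : com := seqs [
  initq; ISet 14 (IVar 8); While (BILe (IConst 2) (IVar 14)) level; fill;
  St 6 (IVar 11) (IVar 5)].

(** * Correctness and cost of the treatment of one group *)

Section Group.
Variables (w m n sc LG Lim : nat).
Variables (et eh : nat -> nat) (ew pw : nat -> R).
Variables (hin nin hout nout : nat -> nat) (inl outl : nat -> list nat).
Hypothesis w6 : 6 <= w.
Hypothesis Hw : 32 * (m + Lim + 2) < 2 ^ w.
Hypothesis Ln : 2 * n <= Lim.
Hypothesis Lm : 2 * m <= Lim.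
Hypothesis Lsc : 2 * sc <= Lim.
Hypothesis LG1 : 1 <= LG.
Hypothesis LGn : Nat.log2 (2 * n) <= LG.
Hypothesis LGs : Nat.log2 (2 * sc) <= LG.
Hypothesis n1 : 1 <= n.
Hypothesis Hpw0 : pw 0 = 0%R.
Hypothesis Hpw : forall i j, i <= j <= sc -> (pw i <= pw j)%R.
Hypothesis Hinl : forall v, v < n -> chain nin (hin v) (inl v).
Hypothesis Houtl : forall v, v < n -> chain nout (hout v) (outl v).
Hypothesis Inl : forall v e, v < n -> In e (inl v) <-> e < m /\ eh e = v.
Hypothesis Outl : forall v e, v < n -> In e (outl v) <-> e < m /\ et e = v.
Hypothesis Het : forall e, e < m -> et e < n.
Hypothesis Heh : forall e, e < m -> eh e < n.
Hypothesis Hew : forall e, e < m -> (1 <= ew e)%R.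

Record static (s : state) : Prop := Static {
  st_n : ivar s 0 = n; st_m : ivar s 1 = m; st_sc : ivar s 5 = sc;
  st_et : ia m s 15 = et; st_eh : ia m s 16 = eh; st_ew : ra m s 2 = ew;
  st_pw : ra m s 0 = pw; st_hin : ia m s 1 = hin; st_nin : ia m s 2 = nin;
  st_hout : ia m s 3 = hout; st_nout : ia m s 4 = nout }.

Definition is_min (P : nat -> Prop) (f : nat -> R) (r0 r : R) : Prop :=
  (r <= r0)%R /\ (forall e, P e -> (r <= f e)%R) /\ (r = r0 \/ exists e, P e /\ r = f e).

Lemma inloop_ok s l p r0 mid cur :
  static s -> ivar s 17 = mid -> ivar s 21 = p -> rvar s 5 = r0 -> ia m s 6 = cur ->
  chain nin p l -> (forall e, In e l -> e < m) -> (forall v, cur v <= sc) ->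
  tri w inloop s (70 * length l + 5) (fun s' => exists r, rvar s' 5 = r /\
    is_min (fun e => In e l /\ e < mid) (fun e => (pw (cur (et e)) + ew e)%R) r0 r).
Proof.
intros [] E17 E21 E5 E6 Hc Hl Hcur.
eapply (tri_while w m) with (I := fun T s => exists l1 l2 r, l = l1 ++ l2 /\
  rvar s 5 = r /\ chain nin (ivar s 21) l2 /\
  is_min (fun e => In e l1 /\ e < mid) (fun e => (pw (cur (et e)) + ew e)%R) r0 r /\
  70 * length l2 + 5 <= T).
{ exact w6. }
{ exists [], l, r0. splits; look; auto. split; [apply Rle_refl|]. cbn. split; [tauto | auto]. }
intros T s1 F (l1 & l2 & r & -> & Er & Hc2 & (M1 & M2 & M3) & HT).
remember (ivar s1 21) as p1 eqn:Ep. symmetry in Ep.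
inversion Hc2 as [Ep1 El|e l2' Hc3 Ep1 El]; subst l2.
- eexists. split; [ev|]. split; [lia|]. intros _. split; [cbn; lia|].
  exists r. rewrite app_nil_r. split; [auto|]. split; auto.
- assert (He : e < m) by (apply Hl, in_app_iff; cbn; auto).
  pose proof (Het e He). pose proof (Hcur (et e)).
  rewrite <- Ep1 in Ep.
  eexists. split; [ev|]. split; [|lia]. intros _.
  step. step. replace (S e - 1) with e by lia. cbn [length] in HT.
  step. step.
  + step. step. exists (70 * length l2' + 5). split; [cbn; lia|].
    exists (l1 ++ [e]), l2', r. rewrite <- app_assoc. splits; look; auto.
    split; [auto|]. split.
    * intros e' [He' Hm]. apply in_app_iff in He'. destruct He' as [|[->|[]]]; auto. lia.
    * destruct M3 as [|(e' & [A B] & C)]; auto. right. exists e'. rewrite in_app_iff. auto.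
  + step. step. step.
    * step. step. exists (70 * length l2' + 5). split; [cbn; lia|].
      exists (l1 ++ [e]), l2', r. rewrite <- app_assoc. splits; look; auto.
      split; [auto|]. split.
      -- intros e' [He' Hm]. apply in_app_iff in He'. destruct He' as [|[->|[]]]; auto.
      -- destruct M3 as [|(e' & [A B] & C)]; auto. right. exists e'. rewrite in_app_iff. auto.
    * step. step. exists (70 * length l2' + 5). split; [cbn; lia|].
      exists (l1 ++ [e]), l2', (pw (cur (et e)) + ew e)%R. rewrite <- app_assoc.
      splits; look; auto. assert ((pw (cur (et e)) + ew e <= r)%R) by lra.
      split; [lra|]. split.
      -- intros e' [He' Hm]. apply in_app_iff in He'. destruct He' as [|[->|[]]]; [|lra].
         eapply Rle_trans; eauto.
      -- right. exists e. rewrite in_app_iff. cbn. split; auto. split; auto. lia.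
Qed.
Definition kinit (mid : nat) (cur : nat -> nat) (r : rcd) (x : R) : Prop :=
  is_min (fun e => In e (inl (rv r)) /\ e < mid)
    (fun e => (pw (cur (et e)) + ew e)%R) (pw (rhi r)) x.

Lemma passA_ok s grp rest l mid qs en cur tr :
  static s -> ivar s 15 = en -> ivar s 16 = l -> ivar s 17 = mid -> ivar s 18 = qs ->
  ia m s 6 = cur -> ia m s 7 = tr ->
  qseg (ia m s 8) (ia m s 9) (ia m s 10) (ia m s 11) qs (grp ++ rest) ->
  en = qs + length (grp ++ rest) -> en <= Lim ->
  (forall r, In r grp -> rl r = l /\ rv r < n /\ rhi r <= sc) ->
  NoDup (map rv grp) -> match rest with [] => True | r :: _ => rl r <> l end ->
  (forall v, cur v <= sc) -> (forall v, ra m s 1 v = 0%R) ->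
  tree_empty n tr -> (forall y, tr y <= n) ->
  tri w passA s (list_sum (map (fun r => 400 * LG + 70 * length (inl (rv r))) grp) + 30)
    (fun s' => ivar s' 18 = qs + length grp /\
       heap_ok n (ra m s' 1) (ia m s' 7) /\ (forall y, ia m s' 7 y <= n) /\
       (forall v, v < n -> ia m s' 7 (n + v) <> 0 <-> In v (map rv grp)) /\
       (forall v, ~ In v (map rv grp) -> ra m s' 1 v = 0%R) /\
       (forall r, In r grp -> kinit mid cur r (ra m s' 1 (rv r)))).
Proof.
intros st E15 E16 E17 E18 E6 E7 Hq Een Hen Hgrp Hnd Hrest Hcur Hkey Htr Htrn.
destruct st.
eapply (tri_while w m) with (I := fun T s => exists g1 g2, grp = g1 ++ g2 /\
  ivar s 18 = qs + length g1 /\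
  heap_ok n (ra m s 1) (ia m s 7) /\ (forall y, ia m s 7 y <= n) /\
  (forall v, v < n -> ia m s 7 (n + v) <> 0 <-> In v (map rv g1)) /\
  (forall v, ~ In v (map rv g1) -> ra m s 1 v = 0%R) /\
  (forall r, In r g1 -> kinit mid cur r (ra m s 1 (rv r))) /\
  list_sum (map (fun r => 400 * LG + 70 * length (inl (rv r))) g2) + 30 <= T).
{ exact w6. }
{ exists [], grp. splits; look; auto.
  - cbn. lia.
  - now apply tree_empty_heap.
  - intros v Hv. rewrite Htr by lia. cbn. lia.
  - easy. }
intros T s1 F (g1 & g2 & -> & Ei & Hh & Htn & Hmem & Hk0 & Hki & HT).
remember (ia m s1 7) as tr1 eqn:Et1. symmetry in Et1.
remember (ra m s1 1) as key1 eqn:Ek1. symmetry in Ek1.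
rewrite <- app_assoc in Hq, Een. apply qseg_app in Hq. destruct Hq as [Hq1 Hq].
rewrite !length_app in Een.
destruct g2 as [|r g2].
- eexists. split; [ev|]. cbn [length] in *. split.
  + intros [A B]. exfalso. destruct rest as [|r rest]; [cbn in *; lia|].
    cbn in Hq. destruct Hq as [[Hq _] _]. congruence.
  + intros _. split; [cbn; lia|]. rewrite app_nil_r in *. splits; auto.
- cbn [qseg app] in Hq. destruct Hq as [(Q1 & Q2 & Q3 & Q4) Hq].
  destruct (Hgrp r) as (R1 & R2 & R3); [apply in_app_iff; cbn; auto|].
  cbn [length] in Een.
  eexists. split; [ev|]. split; [|intros C; exfalso; apply C; split; [lia | congruence]].
  intros _.
  assert (Hnr : ~ In (rv r) (map rv g1)).
  { rewrite map_app in Hnd. cbn in Hnd. apply NoDup_remove_2 in Hnd.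
    intros C. apply Hnd, in_app_iff. auto. }
  step. step. rewrite Q2. step. step. rewrite Q3. step. step. step.
  eapply (wp_call w m); [exact w6 | eapply inloop_ok with (l := inl (rv r)); look; auto | ].
  { constructor; look; auto. }
  { intros e He. now apply Inl in He. }
  intros s2 F2 (x & Ex & Hx).
  step. step. step. step. step. step. step.
  eapply (wp_call w m); [exact w6 | eapply fixpath_leaf_ok with (m := m) (N := n) (v := rv r) (key := key1)
     (tr := tr1) (r := x) (t := rv r + 1); look; auto; lia | ].
  intros s3 F3 (Hh3 & Hx3 & Hn3).
  remember (ia m s3 7) as tr3 eqn:Et3. symmetry in Et3.
  assert (Ek3 : ra m s3 1 = aset key1 (rv r) x) by (look; auto).
  step. cbn [map list_sum fold_right] in HT.
  exists (list_sum (map (fun r => 400 * LG + 70 * length (inl (rv r))) g2) + 30).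
  split; [unfold list_sum in *; cost|].
  exists (g1 ++ [r]), g2. rewrite <- app_assoc. splits; look; auto.
  + rewrite length_app. cbn. lia.
  + intros v Hv. rewrite Hx3 by lia. rewrite map_app, in_app_iff. cbn.
    destruct (Nat.eq_dec v (rv r)) as [->|Hne].
    * rewrite aset_eq. split; auto. lia.
    * rewrite aset_neq by lia. rewrite Hmem by auto. intuition congruence.
  + intros v Hv. rewrite map_app, in_app_iff in Hv. cbn in Hv.
    rewrite aset_neq by (intros ->; tauto). auto.
  + intros r' Hr'. apply in_app_iff in Hr'. destruct Hr' as [Hr'|[<-|[]]].
    * rewrite aset_neq; auto. intros C. apply Hnr. rewrite <- C. now apply in_map.
    * rewrite aset_eq. exact Hx.
Qed.
(* Vertices outside of the group have key 0, so that no relaxation changes them. *)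
Record dinv (U : nat -> R -> Prop) (key0 : nat -> R) (mid : nat) (A M : list nat)
    (Pd : nat -> nat -> Prop) (key : nat -> R) (tr : nat -> nat) : Prop := Dinv {
  di_heap : heap_ok n key tr;
  di_tr : forall y, tr y <= n;
  di_mem : forall v, v < n -> tr (n + v) <> 0 <-> In v M;
  di_incl : incl M A;
  di_nd : NoDup M;
  di_out : forall v, ~ In v A -> key v = 0%R;
  di_pos : forall v, In v A -> (0 <= key v)%R;
  di_done : forall d v, In d A -> ~ In d M -> In v M -> (key d <= key v)%R;
  di_rel : forall d e, In d A -> ~ In d M -> In e (outl d) -> e < mid -> In (eh e) A ->
    Pd d e -> (key (eh e) <= key d + ew e)%R;
  di_le : forall v, In v A -> (key v <= key0 v)%R;
  di_up : forall v, In v A -> U v (key v) }.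

Definition closed_up (U : nat -> R -> Prop) (mid : nat) : Prop :=
  forall e x, e < m -> e < mid -> U (et e) x -> U (eh e) (x + ew e)%R.

Lemma outloop_ok s U key0 mid A M u :
  static s -> ivar s 17 = mid -> ivar s 21 = hout u -> rvar s 5 = ra m s 1 u ->
  closed_up U mid -> (forall v, In v A -> v < n) ->
  In u A -> ~ In u M -> (forall d, In d A -> ~ In d M -> (ra m s 1 d <= ra m s 1 u)%R) ->
  dinv U key0 mid A M (fun d _ => d <> u) (ra m s 1) (ia m s 7) ->
  tri w outloop s (300 * LG * length (outl u) + 5) (fun s' =>
    dinv U key0 mid A M (fun _ _ => True) (ra m s' 1) (ia m s' 7)).
Proof.
intros [] E17 E21 E5 HU HA HuA HuM Hdu Hinv.
assert (Hu : u < n) by auto.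
eapply (tri_while w m) with (I := fun T s' => exists l1 l2, outl u = l1 ++ l2 /\
  chain nout (ivar s' 21) l2 /\ ra m s' 1 u = ra m s 1 u /\
  (forall d, In d A -> ~ In d M -> (ra m s' 1 d <= ra m s' 1 u)%R) /\
  dinv U key0 mid A M (fun d e => d <> u \/ In e l1) (ra m s' 1) (ia m s' 7) /\
  300 * LG * length l2 + 5 <= T).
{ exact w6. }
{ exists [], (outl u). splits; auto. { rewrite E21. auto. }
  destruct Hinv as [I1 I2 I3 I4 I5 I6 I7 I8 I9 I10 I11].
  constructor; auto. intros d e H1 H2 H3 H4 H5 [H6|[]]. auto. }
intros T s1 F (l1 & l2 & El & Hc2 & Hku & Hdu1 & Hinv1 & HT).
remember (ivar s1 21) as p1 eqn:Ep. symmetry in Ep.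
assert (E5' : rvar s1 5 = ra m s1 1 u) by (rewrite Hku; look; auto). clear E5. rename E5' into E5.
remember (ia m s1 7) as tr1 eqn:Et1. symmetry in Et1.
remember (ra m s1 1) as key1 eqn:Ek1. symmetry in Ek1.
inversion Hc2 as [Ep1 El2|e l2' Hc3 Ep1 El2]; subst l2.
- eexists. split; [ev|]. split; [lia|]. intros _. split; [cost|].
  rewrite app_nil_r in El. rewrite <- El in Hinv1.
  destruct Hinv1 as [I1 I2 I3 I4 I5 I6 I7 I8 I9 I10 I11]. constructor; auto.
  intros d e H1 H2 H3 H4 H5 _. apply I9; auto.
  destruct (Nat.eq_dec d u) as [->|]; auto.
- assert (Heo : In e (outl u)) by (rewrite El; apply in_app_iff; cbn; auto).
  destruct (proj1 (Outl u e Hu) Heo) as [He Hte].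
  pose proof (Heh e He) as Hhn. pose proof (Hew e He) as Hw1.
  rewrite <- Ep1 in Ep. cbn [length] in HT.
  eexists. split; [ev|]. split; [|lia]. intros _.
  step. step. step. replace (S e - 1) with e by lia.
  assert (Hkeep : (e < mid -> In (eh e) A -> (key1 (eh e) <= key1 u + ew e)%R) ->
    dinv U key0 mid A M (fun d e0 => d <> u \/ In e0 (l1 ++ [e])) key1 tr1).
  { intros Hre. destruct Hinv1 as [I1 I2 I3 I4 I5 I6 I7 I8 I9 I10 I11]. constructor; auto.
    intros d e' H1 H2 H3 H4 H5 H6.
    destruct (Nat.eq_dec d u) as [->|]; [|auto].
    destruct H6 as [|H6]; [congruence|]. apply in_app_iff in H6.
    destruct H6 as [|[->|[]]]; auto. }
  step; [step|].
  + step. exists (300 * LG * length l2' + 5). split; [cost|].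
    exists (l1 ++ [e]), l2'. rewrite <- app_assoc. splits; look; auto.
    apply Hkeep. lia.
  + step. step. step. step. step; [step|].
    * step. exists (300 * LG * length l2' + 5). split; [cost|].
      exists (l1 ++ [e]), l2'. rewrite <- app_assoc. splits; look; auto.
    * assert (Hlt : (key1 u + ew e < key1 (eh e))%R) by lra.
      pose proof Hinv1 as [I1 I2 I3 I4 I5 I6 I7 I8 I9 I10 I11].
      assert (HvA : In (eh e) A).
      { destruct (in_dec Nat.eq_dec (eh e) A) as [|C]; auto.
        rewrite (I6 _ C) in Hlt. specialize (I7 u HuA). lra. }
      assert (HvM : In (eh e) M).
      { destruct (in_dec Nat.eq_dec (eh e) M) as [|C]; auto.
        specialize (Hdu1 _ HvA C). lra. }
      assert (Hvu : u <> eh e) by (intros C; rewrite <- C in HvM; auto).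
      step. step. step. step.
      assert (Elf : tr1 (n + eh e) = eh e + 1).
      { destruct I1 as [_ I1]. destruct (I1 (eh e)) as [C|C]; auto.
        apply I3 in HvM; auto. congruence. }
      eapply (wp_call w m); [exact w6 | eapply fixpath_leaf_ok with (m := m) (N := n) (v := eh e)
        (key := key1) (tr := tr1) (r := (key1 u + ew e)%R) (t := eh e + 1); look; auto; try lia | ].
      { rewrite <- Elf. now rewrite aset_id. }
      rewrite <- Elf, aset_id.
      intros s3 F3 (Hh3 & Hx3 & Hn3).
      remember (ia m s3 7) as tr3 eqn:Et3. symmetry in Et3.
      assert (Ek3 : ra m s3 1 = aset key1 (eh e) (key1 u + ew e)%R) by (look; auto).
      step. exists (300 * LG * length l2' + 5).
      split; [cost|].
      exists (l1 ++ [e]), l2'. rewrite <- app_assoc.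
      assert (Hdn : forall d, ~ In d M -> aset key1 (eh e) (key1 u + ew e)%R d = key1 d).
      { intros d Hd. apply aset_neq. congruence. }
      assert (Hdec : forall d, (aset key1 (eh e) (key1 u + ew e) d <= key1 d)%R).
      { intros d. destruct (Nat.eq_dec d (eh e)) as [->|].
        - rewrite aset_eq. lra. - rewrite aset_neq by auto. lra. }
      splits; look; auto.
      -- rewrite Hdn by auto. auto.
      -- intros d Hd1 Hd2. rewrite !Hdn by auto. auto.
      -- constructor; auto.
         ++ intros v Hv. rewrite Hx3 by lia. auto.
         ++ intros v Hv. rewrite aset_neq; auto. congruence.
         ++ intros v Hv. destruct (Nat.eq_dec v (eh e)) as [->|].
            ** rewrite aset_eq. specialize (I7 u HuA). lra.
            ** rewrite aset_neq by auto. auto.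
         ++ intros d v Hd1 Hd2 Hv. rewrite Hdn by auto.
            destruct (Nat.eq_dec v (eh e)) as [->|].
            ** rewrite aset_eq. specialize (Hdu1 _ Hd1 Hd2). lra.
            ** rewrite aset_neq by auto. auto.
         ++ intros d e' H1 H2 H3 H4 H5 H6. rewrite (Hdn d) by auto.
            destruct (Nat.eq_dec d u) as [->|Hdu'].
            ** destruct H6 as [|H6]; [congruence|]. apply in_app_iff in H6.
               destruct H6 as [H6|[->|[]]].
               --- eapply Rle_trans; [apply Hdec|]. auto.
               --- rewrite aset_eq. lra.
            ** eapply Rle_trans; [apply Hdec|]. auto.
         ++ intros v Hv. eapply Rle_trans; [apply Hdec|]. auto.
         ++ intros v Hv. destruct (Nat.eq_dec v (eh e)) as [->|].
            ** rewrite aset_eq. apply HU; auto; [lia|]. rewrite Hte. auto.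
            ** rewrite aset_neq by auto. auto.
Qed.

(** Optimality of the keys is not claimed. What is used later are the relaxed inequalities inside
    the group ([di_rel] with every vertex settled), the fact that keys only decrease from [key0],
    and the legitimacy [U] of every key. *)
Lemma dijkstra_ok s U key0 mid A :
  static s -> ivar s 17 = mid -> closed_up U mid -> (forall v, In v A -> v < n) ->
  dinv U key0 mid A A (fun _ _ => True) (ra m s 1) (ia m s 7) ->
  tri w dijkstra s (list_sum (map (fun v => 300 * LG * (1 + length (outl v))) A) + 50)
   (fun s' => dinv U key0 mid A [] (fun _ _ => True) (ra m s' 1) (ia m s' 7) /\
     tree_empty n (ia m s' 7)).
Proof.
intros [] E17 HU HA Hinv.
eapply (tri_while w m) with (I := fun T s => exists M,
  dinv U key0 mid A M (fun _ _ => True) (ra m s 1) (ia m s 7) /\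
  list_sum (map (fun v => 300 * LG * (1 + length (outl v))) M) + 50 <= T).
{ exact w6. }
{ exists A. auto. }
intros T s1 F (M & Hinv1 & HT).
remember (ia m s1 7) as tr1 eqn:Et1. symmetry in Et1.
remember (ra m s1 1) as key1 eqn:Ek1. symmetry in Ek1.
pose proof Hinv1 as [I1 I2 I3 I4 I5 I6 I7 I8 I9 I10 I11].
eexists. split; [ev|]. split.
- intros Hr. destruct (heap_root_min n key1 tr1) as (R1 & R2 & R3); auto; [lia|].
  set (u := tr1 1 - 1) in *.
  assert (Hu : u < n) by lia.
  assert (HuM : In u M) by (apply I3; auto; lia).
  apply in_split in HuM. destruct HuM as (M1 & M2 & EM).
  step. step. fold u. step. step. step. step. step.
  eapply (wp_call w m); [exact w6 | eapply fixpath_leaf_ok with (m := m) (N := n) (v := u)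
    (key := key1) (tr := tr1) (r := key1 u) (t := 0); look; rewrite ?aset_id; auto; try lia | ].
  rewrite aset_id. intros s3 F3 (Hh3 & Hx3 & Hn3).
  remember (ia m s3 7) as tr3 eqn:Et3. symmetry in Et3.
  assert (Ek3 : ra m s3 1 = key1) by (look; auto).
  assert (HuM' : ~ In u (M1 ++ M2)) by (rewrite EM in I5; now apply NoDup_remove_2 in I5).
  assert (HMi : forall v, In v M <-> v = u \/ In v (M1 ++ M2)).
  { intros v. rewrite EM, !in_app_iff. cbn. intuition. }
  assert (HuA : In u A) by (apply I4, HMi; auto).
  step. step. step. step.
  eapply (wp_call w m); [exact w6 | eapply outloop_ok with (M := M1 ++ M2) (u := u); look; eauto | ].
  { constructor; look; auto. }
  { intros d Hd1 Hd2. destruct (Nat.eq_dec d u) as [->|]; [apply Rle_refl|].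
    apply I8; auto; rewrite HMi; tauto. }
  { constructor; auto.
    - intros v Hv. rewrite Hx3 by lia. destruct (Nat.eq_dec v u) as [->|].
      + rewrite aset_eq. tauto.
      + rewrite aset_neq by lia. rewrite I3, HMi by auto. tauto.
    - intros v Hv. apply I4, HMi. auto.
    - rewrite EM in I5. now apply NoDup_remove_1 in I5.
    - intros d v Hd1 Hd2 Hv. assert (In v M) by (apply HMi; auto).
      destruct (Nat.eq_dec d u) as [->|].
      + apply R3; [auto|]. apply I3; auto.
      + apply I8; auto. rewrite HMi. tauto.
    - intros d e H1 H2 H3 H4 H5 H6. apply I9; auto. rewrite HMi. tauto. }
  intros s4 F4 Hinv4.
  exists (list_sum (map (fun v => 300 * LG * (1 + length (outl v))) (M1 ++ M2)) + 50).
  split; [|exists (M1 ++ M2); auto].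
  rewrite EM in HT. rewrite map_app, list_sum_app in *. cbn [map list_sum fold_right] in HT.
  unfold list_sum in *. cost.
- intros Hr. assert (Er : tr1 1 = 0) by lia. split; [cost|].
  pose proof (heap_empty_root n key1 tr1 I1 n1 Er) as Hem.
  assert (M = []) as ->.
  { destruct M as [|v M]; auto. exfalso.
    assert (Hv : v < n) by (apply HA, I4; cbn; auto).
    destruct (I3 v Hv) as [_ C]. apply C; cbn; auto. apply Hem. lia. }
  auto.
Qed.
(** The least scale whose value is at least the key, raised to [rlo] where necessary. Raising keeps
    the scales monotone in time; it preserves the upper bound, and the lower bound is then inherited
    from the later end of the interval. *)
Definition rounds (r : rcd) (k : R) (x : nat) : Prop :=
  rlo r <= x <= rhi r /\ (k <= pw x)%R /\ (x = rlo r \/ x = 0 \/ (pw (x - 1)%nat < k)%R).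

Definition qat (s : state) (i : nat) (rs : list rcd) : Prop :=
  qseg (ia m s 8) (ia m s 9) (ia m s 10) (ia m s 11) i rs.

Definition qkeep (b : nat) (s s' : state) : Prop :=
  forall i, i < b -> ia m s' 8 i = ia m s 8 i /\ ia m s' 9 i = ia m s 9 i /\
    ia m s' 10 i = ia m s 10 i /\ ia m s' 11 i = ia m s 11 i.

Lemma qkeep_qat b s s' i rs : qkeep b s s' -> i + length rs <= b -> qat s i rs -> qat s' i rs.
Proof. intros H Hb. apply qseg_ext. intros j Hj. apply H. lia. Qed.

Lemma qkeep_trans b b' s s' s'' : b <= b' -> qkeep b s s' -> qkeep b' s' s'' -> qkeep b s s''.
Proof.
intros Hb H H' i Hi.
destruct (H' i) as (-> & -> & -> & ->); [lia|]. apply H; auto.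
Qed.

Lemma passC_ok s grp l qs qe key :
  static s -> ivar s 13 = qe -> ivar s 16 = l -> ivar s 18 = qs ->
  ivar s 19 = qs + length grp -> ra m s 1 = key ->
  qat s qs grp -> qs + length grp <= qe -> qe + length grp <= Lim ->
  (forall r, In r grp -> rl r = l /\ rv r < n /\ rlo r <= rhi r <= sc) ->
  NoDup (map rv grp) ->
  (forall r, In r grp -> (key (rv r) <= pw (rhi r))%R) ->
  tri w passC s (400 * LG * length grp + 10) (fun s' => exists X,
    (forall r, In r grp -> rounds r (key (rv r)) (X (rv r))) /\
    ivar s' 13 = qe + length (lefts X grp) /\ qkeep qe s s' /\ qat s' qe (lefts X grp) /\
    qxseg (ia m s' 12) X qs grp /\
    (forall v, In v (map rv grp) -> ra m s' 1 v = 0%R) /\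
    (forall v, ~ In v (map rv grp) -> ra m s' 1 v = key v)).
Proof.
intros [] E13 E16 E18 E19 Ek Hq Hqe HLim Hgrp Hnd Hkp.
eapply (tri_while w m) with (I := fun T s' => exists g1 g2 X, grp = g1 ++ g2 /\
    ivar s' 18 = qs + length g1 /\
    (forall r, In r g1 -> rounds r (key (rv r)) (X (rv r))) /\
    ivar s' 13 = qe + length (lefts X g1) /\ length (lefts X g1) <= length g1 /\
    qkeep qe s s' /\ qat s' qe (lefts X g1) /\
    qxseg (ia m s' 12) X qs g1 /\
    (forall v, In v (map rv g1) -> ra m s' 1 v = 0%R) /\
    (forall v, ~ In v (map rv g1) -> ra m s' 1 v = key v) /\
    400 * LG * length g2 + 10 <= T).
{ exact w6. }
{ exists [], grp, (fun _ => 0). splits; look; auto; try easy; cbn; lia. }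
intros T s1 F (g1 & g2 & X & Eg & Ei & Hr1 & E13' & Hll & Hkeep & Hqat & Hqx & Hz & Hnz & HT).
assert (Hlen : length grp = length g1 + length g2) by (rewrite Eg; apply length_app).
eexists. split; [ev|]. split.
2:{ intros C. split; [cost|]. destruct g2 as [|r g2]; [|cbn in *; lia].
    rewrite app_nil_r in Eg. subst g1. exists X. splits; auto. }
intros Hlt. destruct g2 as [|r g2]; [cbn in *; lia|].
assert (Hq1 : qat s1 (qs + length g1) (r :: g2)).
{ eapply qkeep_qat; eauto; [lia|]. unfold qat in *. rewrite Eg in Hq.
  apply qseg_app in Hq. apply Hq. }
destruct Hq1 as [(Q1 & Q2 & Q3 & Q4) _].
assert (Hrg : In r grp) by (rewrite Eg; apply in_app_iff; cbn; auto).
destruct (Hgrp r Hrg) as (R1 & R2 & R3). specialize (Hkp r Hrg).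
assert (Hnr : ~ In (rv r) (map rv g1)).
{ rewrite Eg, map_app in Hnd. cbn in Hnd. apply NoDup_remove_2 in Hnd.
  intros C. apply Hnd, in_app_iff. auto. }
cbn [length] in HT, Hlen.
step. step. rewrite Q2. step. step. rewrite (Hnz _ Hnr).
step. step. step. step. rewrite Q3. step.
eapply (wp_call w m); [exact w6 | eapply bsearch_ok with (lo := 0) (hi := rhi r) (m := m)
  (P := fun x => (key (rv r) <= pw x)%R); look; auto; try lia | ].
{ intros s' x Fx Ex Hx. ev. }
intros s2 F2 (rd & E25 & Hrd & Hrd1 & Hrd2).
step.
set (x := Nat.max (rlo r) rd).
assert (Hround : rounds r (key (rv r)) x).
{ split; [lia|]. split.
  - apply Rle_trans with (pw rd); [destruct Hrd1 as [->|]; auto | apply Hpw; lia].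
  - destruct (le_lt_dec rd (rlo r)); [left; lia|]. right.
    replace x with rd by lia. destruct Hrd2 as [->|C]; auto. right. lra. }
join m 60 (fun s' => ivar s' 25 = x).
{ step; [step|step]; (split; [lia|]); look; lia. }
intros s3 F3 E25'. clear E25.
step. step. step. step. step.
set (X' := aset X (rv r) x).
assert (EX : X' (rv r) = x) by apply aset_eq.
assert (HX' : lefts X' g1 = lefts X g1) by (now apply lefts_aset).
join m 120 (fun s' => ivar s' 13 = qe + length (lefts X' (g1 ++ [r])) /\ qkeep qe s s' /\
  qat s' qe (lefts X' (g1 ++ [r]))).
{ rewrite lefts_snoc, HX', EX. unfold qat, qkeep in *. step.
  - step. split; [lia|]. look. rewrite Q3 in *.
    destruct (Nat.ltb_spec x (rhi r)); [lia|]. rewrite app_nil_r. look. auto.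
  - rewrite Q3 in *. destruct (Nat.ltb_spec x (rhi r)); [|lia].
    unfold append. step. step. step. step. step. step. step. step. step. split; [lia|].
    look. rewrite length_app. cbn [length]. split; [lia|]. split.
    + intros i Hi. rewrite !aset_neq by lia. auto.
    + replace l with (rl r). rewrite Q3.
      apply (qseg_snoc _ _ _ _ _ _ (Rcd (rl r) (rv r) (rhi r) x)); auto. }
intros s4 F4 (E13'' & Hkeep4 & Hqat4).
assert (Hlg : Nat.log2 (2 * (rhi r - 0)) <= LG).
{ eapply Nat.le_trans; [|exact LGs]. apply Nat.log2_le_mono. lia. }
step. exists (400 * LG * length g2 + 10). split; [cost|].
exists (g1 ++ [r]), g2, X'. rewrite <- app_assoc. splits; look; auto.
- rewrite length_app. cbn. lia.
- intros r' Hr'. apply in_app_iff in Hr'. destruct Hr' as [Hr'|[<-|[]]].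
  + unfold X'. rewrite aset_neq; auto. intros C. apply Hnr. rewrite <- C. now apply in_map.
  + rewrite EX. auto.
- rewrite lefts_snoc, HX', !length_app. destruct (X' (rv r) <? rhi r); cbn; lia.
- apply qxseg_app. split; [now apply qxseg_aset|]. cbn. rewrite aset_eq. auto.
- intros v Hv. rewrite map_app, in_app_iff in Hv. cbn in Hv.
  destruct (Nat.eq_dec v (rv r)) as [->|]; [now rewrite aset_eq|].
  rewrite aset_neq by auto. apply Hz. intuition congruence.
- intros v Hv. rewrite map_app, in_app_iff in Hv. cbn in Hv.
  rewrite aset_neq by (intros ->; tauto). apply Hnz. tauto.
Qed.

Lemma passD_ok s grp mid qs qe cur X :
  static s -> ivar s 13 = qe -> ivar s 17 = mid -> ivar s 18 = qs ->
  ivar s 19 = qs + length grp -> ia m s 6 = cur ->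
  qat s qs grp -> qs + length grp <= qe -> qe + length grp <= Lim ->
  (forall r, In r grp -> rv r < n /\ rlo r <= sc) ->
  NoDup (map rv grp) -> qxseg (ia m s 12) X qs grp ->
  tri w passD s (200 * LG * length grp + 10) (fun s' =>
    ivar s' 13 = qe + length (rights X mid grp) /\ qkeep qe s s' /\
    qat s' qe (rights X mid grp) /\ ivar s' 18 = qs + length grp /\
    (forall r, In r grp -> ia m s' 6 (rv r) = rlo r) /\
    (forall v, ~ In v (map rv grp) -> ia m s' 6 v = cur v)).
Proof.
intros [] E13 E17 E18 E19 E6 Hq Hqe HLim Hgrp Hnd Hqx.
eapply (tri_while w m) with (I := fun T s' => exists g1 g2, grp = g1 ++ g2 /\
    ivar s' 18 = qs + length g1 /\
    ivar s' 13 = qe + length (rights X mid g1) /\ length (rights X mid g1) <= length g1 /\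
    qkeep qe s s' /\ qat s' qe (rights X mid g1) /\
    (forall r, In r g1 -> ia m s' 6 (rv r) = rlo r) /\
    (forall v, ~ In v (map rv g1) -> ia m s' 6 v = cur v) /\
    200 * LG * length g2 + 10 <= T).
{ exact w6. }
{ exists [], grp. splits; look; auto; try easy; cbn; lia. }
intros T s1 F (g1 & g2 & Eg & Ei & E13' & Hll & Hkeep & Hqat & Hz & Hnz & HT).
assert (Hlen : length grp = length g1 + length g2) by (rewrite Eg; apply length_app).
eexists. split; [ev|]. split.
2:{ intros C. split; [cost|]. destruct g2 as [|r g2]; [|cbn in *; lia].
    rewrite app_nil_r in Eg. subst g1. splits; auto. }
intros Hlt. destruct g2 as [|r g2]; [cbn in *; lia|].
assert (Hq1 : qat s1 (qs + length g1) (r :: g2)).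
{ eapply qkeep_qat; eauto; [lia|]. unfold qat in *. rewrite Eg in Hq.
  apply qseg_app in Hq. apply Hq. }
destruct Hq1 as [(Q1 & Q2 & Q3 & Q4) _].
assert (Q5 : ia m s 12 (qs + length g1) = X (rv r)).
{ rewrite Eg in Hqx. apply qxseg_app in Hqx. apply Hqx. }
assert (Hrg : In r grp) by (rewrite Eg; apply in_app_iff; cbn; auto).
destruct (Hgrp r Hrg) as (R2 & R3).
assert (Hnr : ~ In (rv r) (map rv g1)).
{ rewrite Eg, map_app in Hnd. cbn in Hnd. apply NoDup_remove_2 in Hnd.
  intros C. apply Hnd, in_app_iff. auto. }
cbn [length] in HT, Hlen.
step. step. rewrite Q2. step. step. rewrite Q5. step. step. rewrite Q4. step.
join m 110 (fun s' => ivar s' 13 = qe + length (rights X mid (g1 ++ [r])) /\ qkeep qe s s' /\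
  qat s' qe (rights X mid (g1 ++ [r]))).
{ rewrite rights_snoc. unfold qat, qkeep in *. step.
  - step. split; [lia|].
    destruct (Nat.ltb_spec (rlo r) (X (rv r))); [lia|]. rewrite app_nil_r. look. auto.
  - destruct (Nat.ltb_spec (rlo r) (X (rv r))); [|lia].
    unfold append. step. step. step. step. step. step. step. step. step. split; [lia|].
    look. rewrite length_app. cbn [length]. split; [lia|]. split.
    + intros i Hi. rewrite !aset_neq by lia. auto.
    + apply (qseg_snoc _ _ _ _ _ _ (Rcd mid (rv r) (X (rv r)) (rlo r))); auto. }
intros s4 F4 (E13'' & Hkeep4 & Hqat4).
step. step. step. exists (200 * LG * length g2 + 10). split; [cost|].
exists (g1 ++ [r]), g2. rewrite <- app_assoc. unfold qkeep, qat in *. splits; look; auto.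
- rewrite length_app. cbn. lia.
- rewrite rights_snoc, !length_app. destruct (rlo r <? X (rv r)); cbn; lia.
- intros r' Hr'. apply in_app_iff in Hr'. destruct Hr' as [Hr'|[<-|[]]].
  + rewrite aset_neq; auto. intros C. apply Hnr. rewrite <- C. now apply in_map.
  + now rewrite aset_eq.
- intros v Hv. rewrite map_app, in_app_iff in Hv. cbn in Hv.
  rewrite aset_neq by (intros ->; tauto). apply Hnz. tauto.
Qed.
(** The work caused by one record of [v]: the constant covers the four passes, each visiting the
    vertex or one of its adjacency lists, with a logarithmic factor for the tournament and the
    binary search. *)
Definition gcost (v : nat) : nat := 1600 * LG * (1 + length (inl v) + length (outl v)).

Lemma gcost_sum (grp : list rcd) :
  list_sum (map (fun r => 400 * LG + 70 * length (inl (rv r))) grp) +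
  list_sum (map (fun v => 300 * LG * (1 + length (outl v))) (map rv grp)) +
  400 * LG * length grp + 200 * LG * length grp + 250 * length grp
  <= list_sum (map (fun r => gcost (rv r)) grp).
Proof.
unfold list_sum. induction grp as [|r grp IH]; cbn [map fold_right length]; [lia|].
unfold gcost at 1. nia.
Qed.

(** The predicate [U] abstracts legitimate upper estimates at the midpoint: the program proof uses
    only that it is closed under edges. The clauses on [X] and [kf] are the ones needed for
    [group_valid]. *)
Lemma group_ok s grp rest l half qs qe en cur (U : nat -> R -> Prop) :
  static s -> ivar s 12 = qs -> ivar s 13 = qe -> ivar s 14 = half -> ivar s 15 = en ->
  ia m s 6 = cur -> qat s qs (grp ++ rest) -> grp <> [] ->
  en = qs + length (grp ++ rest) -> en <= qe -> qe + 2 * length grp <= Lim ->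
  l + half <= Lim ->
  (forall r, In r grp -> rl r = l /\ rv r < n /\ rlo r <= rhi r <= sc) ->
  NoDup (map rv grp) -> match rest with [] => True | r :: _ => rl r <> l end ->
  (forall v, cur v <= sc) -> (forall v, ra m s 1 v = 0%R) ->
  tree_empty n (ia m s 7) -> (forall y, ia m s 7 y <= n) ->
  closed_up U (l + half) -> (forall r, In r grp -> U (rv r) (pw (rhi r))) ->
  (forall e, e < m -> e < l + half -> U (eh e) (pw (cur (et e)) + ew e)%R) ->
  tri w group s (list_sum (map (fun r => gcost (rv r)) grp)) (fun s' => exists X kf,
    (forall r, In r grp -> rounds r (kf (rv r)) (X (rv r)) /\ U (rv r) (kf (rv r)) /\
       forall e, e < m -> e < l + half -> eh e = rv r ->
         (kf (rv r) <= pw (cur (et e)) + ew e)%R /\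
         forall r', In r' grp -> et e = rv r' -> (kf (rv r) <= kf (rv r') + ew e)%R) /\
    ivar s' 12 = qs + length grp /\
    ivar s' 13 = qe + length (lefts X grp ++ rights X (l + half) grp) /\
    qkeep qe s s' /\ qat s' qe (lefts X grp ++ rights X (l + half) grp) /\
    (forall r, In r grp -> ia m s' 6 (rv r) = rlo r) /\
    (forall v, ~ In v (map rv grp) -> ia m s' 6 v = cur v) /\
    (forall v, ra m s' 1 v = 0%R) /\ tree_empty n (ia m s' 7) /\
    (forall y, ia m s' 7 y <= n)).
Proof.
intros st E12 E13 E14 E15 E6 Hq Hne Een Hen HLim HlL Hgrp Hnd Hrest Hcur Hkey Htr Htrn HU HU1 HU2.
pose proof st as [].
pose proof (gcost_sum grp) as Hcost.
assert (Hlen : 1 <= length grp) by (destruct grp; [congruence | cbn; lia]).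
rewrite length_app in Een.
assert (Hql : ia m s 8 qs = l).
{ destruct grp as [|r grp]; [congruence|]. destruct (Hgrp r) as [<- _]; [cbn; auto|].
  apply Hq. }
assert (HA : forall v, In v (map rv grp) -> v < n).
{ intros v Hv. apply in_map_iff in Hv. destruct Hv as (r & <- & Hr). now apply Hgrp. }
unfold group, tri.
step. step. rewrite Hql. step. step. step. step. step.
eapply (wp_call w m); [exact w6 | eapply passA_ok with (grp := grp) (rest := rest)
  (tr := ia m s 7); look; auto | ].
{ constructor; look; auto. }
{ rewrite length_app. auto. }
{ lia. }
{ intros r Hr. destruct (Hgrp r Hr). lia. }
intros s2 F2 (E18 & Hh2 & Htr2 & Hmem2 & Hz2 & Hki2).
step. step.
remember (ra m s2 1) as key0 eqn:Ek0. symmetry in Ek0.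
assert (Hpos : forall i, i <= sc -> (0 <= pw i)%R).
{ intros i Hi. rewrite <- Hpw0. apply Hpw. lia. }
step. eapply (wp_call w m); [exact w6 | eapply dijkstra_ok with (A := map rv grp) (U := U)
  (key0 := key0); look; eauto | ].
{ constructor; look; auto. }
{ constructor; look; auto.
  - apply incl_refl.
  - intros v Hv. apply in_map_iff in Hv. destruct Hv as (r & <- & Hr).
    destruct (Hgrp r Hr) as (_ & _ & Hr').
    destruct (Hki2 r Hr) as (_ & _ & [->|(e & [He _] & ->)]); [apply Hpos; lia|].
    apply Inl in He; [|apply HA, in_map; auto]. destruct He as [He _].
    pose proof (Hew e He). pose proof (Hpos _ (Hcur (et e))). lra.
  - tauto.
  - tauto.
  - intros v Hv. apply Rle_refl.
  - intros v Hv. apply in_map_iff in Hv. destruct Hv as (r & <- & Hr).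
    destruct (Hki2 r Hr) as (_ & _ & [->|(e & [He Hm] & ->)]); [auto|].
    apply Inl in He; [|apply HA, in_map; auto]. destruct He as [He <-]. auto. }
intros s3 F3 (D3 & Hem3).
remember (ra m s3 1) as kf eqn:Ekf. symmetry in Ekf.
destruct D3 as [I1 I2 I3 I4 I5 I6 I7 I8 I9 I10 I11].
assert (Hkf : forall r, In r grp -> (kf (rv r) <= pw (rhi r))%R).
{ intros r Hr. eapply Rle_trans; [apply I10, in_map; auto|]. apply Hki2. auto. }
step. step. step.
eapply (wp_call w m); [exact w6 | eapply passC_ok with (grp := grp) (key := kf) (qs := qs)
  (qe := qe) (l := l); look; auto; try lia | ].
{ constructor; look; auto. }
{ unfold qat in *. look. apply qseg_app in Hq. apply Hq. }
intros s4 F4 (X & Hrd & E13' & Hk4 & Hq4 & Hx4 & Hz4 & Hnz4).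
assert (Hll : length (lefts X grp) <= length grp).
{ apply lefts_length. }
step. step. step.
eapply (wp_call w m); [exact w6 | eapply passD_ok with (grp := grp) (cur := cur) (qs := qs)
  (qe := qe + length (lefts X grp)) (X := X) (mid := l + half); look; auto; try lia | ].
{ constructor; look; auto. }
{ assert (qat s4 qs grp) as Hq4'.
  { eapply qkeep_qat; [exact Hk4 | lia |]. unfold qat in *. look.
    apply qseg_app in Hq. apply Hq. }
  exact Hq4'. }
{ intros r Hr. destruct (Hgrp r Hr). lia. }
intros s5 F5 (E13'' & Hk5 & Hq5 & E18' & Hc5 & Hnc5).
step. split; [lia|].
exists X, kf. splits; look; auto.
- intros r Hr. assert (Hvn : rv r < n) by (apply HA, in_map; auto).
  splits; [auto | apply I11, in_map; auto |].
  intros e He Hm Heh'. split.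
  + eapply Rle_trans; [apply I10, in_map; auto|].
    apply (proj1 (proj2 (Hki2 r Hr))). rewrite Inl; auto.
  + intros r' Hr' Het'. rewrite <- Heh', <- Het'. apply I9; auto.
    * rewrite Het'. now apply in_map.
    * rewrite Outl; auto.
    * rewrite Heh'. now apply in_map.
- rewrite length_app. lia.
- eapply qkeep_trans with (b' := qe + length (lefts X grp)) (s' := s4); [lia | |].
  + intros i Hi. destruct (Hk4 i Hi) as (A & B & C & D). revert A B C D. look. auto.
  + intros i Hi. destruct (Hk5 i Hi) as (A & B & C & D). revert A B C D. look. auto.
- unfold qat in *. apply qseg_app. look. split; [|exact Hq5].
  eapply qseg_ext; [|exact Hq4]. intros j Hj.
  destruct (Hk5 j) as (A & B & C & D); [lia|]. revert A B C D. look. auto.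
- intros v. destruct (in_dec Nat.eq_dec v (map rv grp)) as [Hv|Hv]; auto.
  rewrite Hnz4; auto.
Qed.

(** * All levels of the bisection for one source *)

Section Source.
Variables (F src : nat) (q : R) (Hd : list nat) (reach : nat -> nat -> R -> Prop).
Let HS (v : nat) : Prop := In v Hd /\ v <> src.
Hypothesis LF : F <= Lim.
Hypothesis Hsrc : src < n.
Hypothesis q1 : (1 <= q)%R.
Hypothesis sc2 : 2 <= sc.
Hypothesis pw1 : pw 1 = 1%R.
Hypothesis pwS : forall i, 1 <= i < sc -> pw (S i) = (q * pw i)%R.
Hypothesis pw_top : forall i, i < sc -> (pw i < pw sc)%R.
Hypothesis Hd_n : forall v, In v Hd -> v < n.
Hypothesis Hd_m : length Hd <= m.
Hypothesis Hd_eh : forall e, e < m -> In (eh e) Hd.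
Hypothesis Hd_nd : NoDup Hd.
Hypothesis reach_mono : forall t t' v x, t <= t' -> reach t v x -> reach t' v x.
Hypothesis reach_src : forall t, reach t src 0%R.
Hypothesis reach_step : forall t e x,
  e < m -> e < t -> reach t (et e) x -> reach t (eh e) (x + ew e)%R.
Hypothesis reach_ind : forall t (P : nat -> R -> Prop), P src 0%R ->
  (forall e x, e < m -> e < t -> reach t (et e) x -> P (et e) x -> P (eh e) (x + ew e)%R) ->
  forall v x, reach t v x -> P v x.

Lemma HS_dec v : HS v \/ ~ HS v.
Proof.
unfold HS. destruct (in_dec Nat.eq_dec v Hd), (Nat.eq_dec v src); tauto.
Qed.

Definition heads_at (s : state) : Prop :=
  ivar s 6 = length Hd /\ forall i, i < length Hd -> ia m s 5 i = nth i Hd 0.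

(** What every group leaves behind: zero keys and an empty tournament. Since a group restores this
    by visiting only its own vertices, there is no clearing cost proportional to the graph. *)
Definition idle (s : state) : Prop :=
  (forall v, ra m s 1 v = 0%R) /\ tree_empty n (ia m s 7) /\ (forall y, ia m s 7 y <= n) /\
  (forall v, ia m s 6 v <= sc) /\
  (forall v, v < n -> ~ HS v -> v <> src -> ia m s 6 v = sc).

Lemma reset_ok s :
  static s -> heads_at s -> ivar s 11 = src -> idle s ->
  tri w reset s (60 * length Hd + 40)
    (fun s' => idle s' /\ ia m s' 6 src = 0 /\ forall v, HS v -> ia m s' 6 v = sc).
Proof.
intros [] [E6 Hh] E11 (W1 & W2 & W3 & W4 & W5).
unfold reset, tri. step. step. step.
eapply (wp_call w m); [exact w6 | eapply (tri_while w m) with (T0 := 60 * length Hd + 10)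
  (P := fun s' => (forall v, ia m s' 6 v <= sc) /\
     (forall v, v < n -> v <> src -> ia m s' 6 v = sc))
  (I := fun T s' => exists i, ivar s' 18 = i /\ i <= length Hd /\
     (forall v, ia m s' 6 v <= sc) /\
     (forall v, v < n -> v <> src -> ia m s' 6 v = sc \/ HS v) /\
     (forall j, j < i -> ia m s' 6 (nth j Hd 0) = sc) /\ 60 * (length Hd - i) + 10 <= T)|].
- exact w6.
- exists 0. splits; look; auto; try lia. intros v Hv Hs.
  destruct (HS_dec v); auto.
- intros T s1 F1 (i & E18 & Hi & C1 & C2 & C3 & HT).
  eexists. split; [ev|]. split.
  + intros Hlt. assert (Hv : nth i Hd 0 < n) by (apply Hd_n, nth_In; lia).
    step. eapply wp_st; [vm_compute; reflexivity | | ev | ].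
    { eapply ev_ad; [look; reflexivity | | apply Nat.ltb_lt; reflexivity |].
      - eapply ev_ld; [ev|]. look. apply Hh. lia.
      - lia. }
    cbv beta. step. exists (60 * (length Hd - (i + 1)) + 10). split; [cost|].
    assert (C3' : forall j, j < i + 1 -> aset (ia m s1 6) (nth i Hd 0) sc (nth j Hd 0) = sc).
    { intros j Hj. destruct (Nat.eq_dec (nth j Hd 0) (nth i Hd 0)) as [->|].
      - apply aset_eq. - rewrite aset_neq by auto. apply C3.
        destruct (Nat.eq_dec j i); [congruence | lia]. }
    exists (i + 1). splits; look; auto; try lia.
    * intros v. destruct (Nat.eq_dec v (nth i Hd 0)) as [->|]; [now rewrite aset_eq|].
      now rewrite aset_neq by auto.
    * intros v Hv' Hs. destruct (Nat.eq_dec v (nth i Hd 0)) as [->|]; [rewrite aset_eq; auto|].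
      rewrite aset_neq by auto. auto.
  + intros C. split; [cost|]. split; auto. intros v Hv Hs.
    destruct (C2 v Hv Hs) as [|[Hin _]]; auto.
    destruct (In_nth Hd v 0 Hin) as (j & Hj & <-). apply C3. lia.
- intros s2 F2 (C1 & C2). step. split; [lia|].
  unfold idle. splits; look; auto.
  + intros v. destruct (Nat.eq_dec v src) as [->|]; [rewrite aset_eq; lia|].
    now rewrite aset_neq by auto.
  + intros v Hv Hn Hs. rewrite aset_neq by auto. auto.
  + now rewrite aset_eq.
  + intros v [Hv Hs]. rewrite aset_neq by auto. apply C2; auto.
Qed.

Lemma length_le_wsum rs :
  (forall r, In r rs -> rlo r < rhi r) -> length rs <= wsum (fun _ => 1) rs.
Proof.
unfold wsum, list_sum. induction rs as [|r rs IH]; cbn [map fold_right length]; auto.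
intros H. pose proof (H r (or_introl eq_refl)).
specialize (IH (fun r' Hr' => H r' (or_intror Hr'))). lia.
Qed.

(** One iteration of the loop is one group. The sweep is advanced to the starting time of the next
    record, and [group_valid] turns the result of the program into the hypotheses of
    [sweep_step]. *)
Lemma level_ok s half c D Rs qs qe :
  static s -> heads_at s -> ivar s 11 = src -> ivar s 12 = qs -> ivar s 13 = qe ->
  ivar s 14 = 2 * half -> idle s ->
  1 <= half -> (1 <= c)%R -> Nat.divide (2 * half) F ->
  qat s qs Rs -> qe = qs + length Rs ->
  level_fun F sc pw HS reach (2 * half) c D -> level_recs HS (2 * half) F D Rs ->
  qe + 3 * wsum (fun _ => 1) Rs <= Lim ->
  tri w level s (list_sum (map (fun r => gcost (rv r) + 10) Rs) + 60 * length Hd + 100)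
    (fun s' => exists D' Out,
       ivar s' 12 = qe /\ ivar s' 13 = qe + length Out /\ ivar s' 14 = half /\ idle s' /\
       qat s' qe Out /\ level_fun F sc pw HS reach half (c * q) D' /\
       level_recs HS half F D' Out /\ forall g, wsum g Out = wsum g Rs).
Proof.
intros st Hh E11 E12 E13 E14 Hid half1 c1 HF Hq Eqe HD HR HLim.
pose proof st as [].
unfold level, tri. step.
eapply (wp_call w m); [exact w6 | eapply reset_ok; eauto |].
intros s1 F1 (Hid1 & Es1 & Hs1).
assert (st1 : static s1) by (constructor; look; auto).
step. step. step. step.
assert (Eh : 2 * half / 2 = half) by (rewrite Nat.mul_comm; apply Nat.div_mul; lia).
rewrite Eh.
assert (HSs : ~ HS src) by (unfold HS; tauto).
assert (HSh : forall e, e < m -> eh e <> src -> HS (eh e)) by (unfold HS; auto).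
set (s2 := set_ivar (set_ivar s1 14 half) 15 qe).
eapply (wp_call w m); [exact w6 | eapply (tri_while w m) with
  (T0 := list_sum (map (fun r => gcost (rv r) + 10) Rs) + 10)
  (P := fun s' => exists D' Out,
       ivar s' 12 = qe /\ ivar s' 13 = qe + length Out /\ ivar s' 14 = half /\ idle s' /\
       qat s' qe Out /\ level_fun F sc pw HS reach half (c * q) D' /\
       level_recs HS half F D' Out /\ forall g, wsum g Out = wsum g Rs)
  (I := fun T s' => exists t0 P R D' Out,
     sweep F sc q pw HS reach half c D Rs t0 P R D' Out /\
     cur_at sc m src HS et D t0 (ia m s' 6) /\ idle s' /\
     ivar s' 12 = qs + length P /\ ivar s' 13 = qe + length Out /\
     qat s' (qs + length P) R /\ qat s' qe Out /\
     list_sum (map (fun r => gcost (rv r) + 10) R) + 10 <= T)|].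
- exact w6.
- exists 0, [], Rs, (fun t v => D (t / (2 * half) * (2 * half)) v), [].
  rewrite !Nat.add_0_r.
  splits; auto; try (unfold s2; look; auto; fail).
  + apply sweep_init; auto.
  + unfold s2. split; [look; auto|]. split.
    * intros v Hv. look. rewrite Hs1 by auto. symmetry. apply (lf_0 _ _ _ _ _ _ _ _ HD). auto.
    * intros e He Hn Hs. look. apply Hid1; auto.
  + unfold s2, qat in *. look. auto.
  + exact I.
- intros T s3 F3 (t0 & P & R & D' & Out & Hsw & Hcur & Hid3 & E12' & E13' & HqR & HqO & HT).
  pose proof Hsw as [S1 S2 S3 S4 S5 S6 S7 S8 S9 S10].
  assert (ER : length Rs = length P + length R) by (rewrite S3; apply length_app).
  assert (Hst3 : static s3) by (unfold s2 in *; constructor; look; auto).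
  assert (E14' : ivar s3 14 = half) by (unfold s2 in *; look; auto).
  assert (E15' : ivar s3 15 = qe) by (unfold s2 in *; look; auto).
  eexists. split; [pose proof Hst3 as []; ev|]. split.
  + intros Hlt. destruct R as [|r R]; [cbn in *; lia|].
    assert (HrRs : In r Rs) by (rewrite S3, in_app_iff; cbn; auto).
    destruct (lr_rec _ _ _ _ _ HR r HrRs) as (Dv & Lv & _).
    assert (Hl0 : t0 <= rl r) by (apply S5; cbn; auto).
    assert (Hlk : exists k, rl r = t0 + k * (2 * half)).
    { destruct Dv as [a Ea], S1 as [b Eb]. exists (a - b). rewrite Ea, Eb in *. nia. }
    destruct Hlk as [k Ek].
    assert (Hord : ordered (r :: R)).
    { pose proof (lr_ord _ _ _ _ _ HR) as Ho. rewrite S3 in Ho. apply ordered_app in Ho. apply Ho. }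
    assert (HlR : forall r', In r' (r :: R) -> rl r <= rl r').
    { intros r' [<-|Hr']; auto. destruct Hord as [Ho _]. destruct (Ho r' Hr') as [|[]]; lia. }
    destruct (sweep_advance F sc m src q pw HS et eh ew reach) with (half := half) (c := c)
      (D := D) (Rs := Rs) (k := k) (t0 := t0) (P := P) (R := r :: R) (D' := D') (Out := Out)
      as (D2 & Hsw2 & ED); auto; try lia.
    { intros r' Hr'. rewrite <- Ek. auto. }
    rewrite <- Ek in Hsw2, ED. set (l := rl r) in *.
    assert (Hcur2 : cur_at sc m src HS et D l (ia m s3 6)).
    { destruct Hcur as (A & B & C). splits; auto. split; auto. split; auto.
      intros v Hv. rewrite ED by auto. auto. }
    destruct (span_level l (r :: R)) as (grp & rest & EG & Hg & Hrest).
    rewrite EG in *. clear Hl0 Hsw.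
    pose proof Hsw2 as [S1' S2' S3' S4' S5' S6' S7' S8' S9' S10'].
    assert (Hrest' : forall r', In r' rest -> rl r' <> l).
    { apply ordered_app in Hord. destruct Hord as (_ & Ho & _).
      destruct rest as [|r0 rest]; [easy|]. cbn in Ho.
      assert (l <= rl r0) by (apply HlR, in_app_iff; cbn; auto).
      intros r' [<-|Hr']; auto. destruct Ho as [Ho _]. destruct (Ho r' Hr') as [|[]]; lia. }
    assert (Hgne : grp <> []).
    { intros ->. cbn in EG. subst rest. now apply Hrest. }
    assert (HgRs : forall r, In r grp -> In r Rs) by (intros; rewrite S3', !in_app_iff; auto).
    assert (HlF : l < F) by lia.
    destruct Hid3 as (W1 & W2 & W3 & W4 & W5).
    destruct (group_estimates F sc m src pw HS et eh ew reach) with (half := half) (c := c)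
      (D := D) (Rs := Rs) (l := l) (cur := ia m s3 6) (grp := grp) as [U1 U2]; auto.
    { apply HS_dec. }
    assert (HlenO : length Out <= wsum (fun _ => 1) Rs).
    { eapply Nat.le_trans; [apply length_le_wsum; intros r' Hr';
        apply (lr_rec _ _ _ _ _ S9 r' Hr')|].
      rewrite S10, S3, wsum_app. lia. }
    assert (HlenR : length Rs <= wsum (fun _ => 1) Rs).
    { apply length_le_wsum. intros r' Hr'. apply (lr_rec _ _ _ _ _ HR r' Hr'). }
    rewrite length_app in ER. rewrite map_app, list_sum_app in HT.
    eapply (wp_call w m); [exact w6 | eapply group_ok with (grp := grp) (rest := rest) (l := l)
      (half := half) (U := Uat sc pw reach (l + half)); eauto; try lia |].
    { rewrite length_app. lia. }
    { intros r' Hr'. destruct (lr_rec _ _ _ _ _ HR r' (HgRs r' Hr')) as (A1 & A2 & A3 & A4 & A5 & A6).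
      splits; auto; try lia. { apply Hd_n, A3. }
      rewrite A4. apply (lf_le _ _ _ _ _ _ _ _ HD); auto. lia. }
    { eapply ordered_nodup with (l := l); eauto. apply ordered_app in Hord. apply Hord. }
    { intros e x He Ht. eapply Uat_step; eauto. }
    intros s4 F4 (X & kf & HX & E12'' & E13'' & Hk4 & Hq4 & Hc4 & Hnc4 & Hz4 & Hem4 & Htn4).
    destruct (sweep_step F sc m src q pw HS et eh ew reach) with (half := half) (c := c)
      (D := D) (Rs := Rs) (t0 := l) (P := P) (grp := grp) (R' := rest) (D' := D2) (Out := Out)
      (X := X) as (D3 & Hsw3); auto.
    { eapply group_valid with (F := F) (m := m) (et := et) (eh := eh) (ew := ew) (src := src) (D := D)
        (Rs := Rs) (kf := kf) (cur := ia m s3 6); eauto.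
      intros r' Hr'. destruct (HX r' Hr') as ((G1 & G2 & G3) & G4 & G5). splits; auto; lia. }
    exists (list_sum (map (fun r => gcost (rv r) + 10) rest) + 10). split.
    { assert (list_sum (map (fun r => gcost (rv r) + 10) grp) =
        list_sum (map (fun r => gcost (rv r)) grp) + 10 * length grp).
      { clear. unfold list_sum. induction grp as [|r grp IH]; cbn [map fold_right length]; lia. }
      assert (1 <= length grp) by (destruct grp; [congruence | cbn; lia]).
      cost. }
    exists (l + 2 * half), (P ++ grp), rest, D3,
      (Out ++ lefts X grp ++ rights X (l + half) grp).
    assert (Hal : forall v, HS v -> ~ In v (map rv grp) -> D l v = D (l + 2 * half) v).
    { intros v Hv Hn. destruct (Nat.eq_dec (D l v) (D (l + 2 * half) v)) as [|Hne]; auto.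
      exfalso. apply Hn. eapply drop_record with (F := F) (Rs := Rs); eauto. }
    splits; auto.
    * destruct Hcur2 as (A & B & C). split; [|split].
      -- rewrite Hnc4; auto. intros Ci. apply in_map_iff in Ci. destruct Ci as (r' & E & Hr').
         apply HSs. rewrite <- E. apply (lr_rec _ _ _ _ _ HR). auto.
      -- intros v Hv. destruct (in_dec Nat.eq_dec v (map rv grp)) as [Hi|Hi].
         ++ apply in_map_iff in Hi. destruct Hi as (r' & <- & Hr'). rewrite Hc4 by auto.
            destruct (lr_rec _ _ _ _ _ HR r' (HgRs r' Hr')) as (_ & _ & _ & _ & A5 & _).
            rewrite A5. now rewrite (Hg r' Hr').
         ++ rewrite Hnc4 by auto. rewrite B by auto. auto.
      -- intros e He Hn Hs. rewrite Hnc4; [auto|]. intros Ci. apply in_map_iff in Ci.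
         destruct Ci as (r' & E & Hr'). apply Hn. rewrite <- E. apply (lr_rec _ _ _ _ _ HR). auto.
    * unfold idle. splits; auto.
      -- intros v. destruct (in_dec Nat.eq_dec v (map rv grp)) as [Hi|Hi].
         ++ apply in_map_iff in Hi. destruct Hi as (r' & <- & Hr'). rewrite Hc4 by auto.
            destruct (lr_rec _ _ _ _ _ HR r' (HgRs r' Hr')) as (A1 & A2 & A3 & A4 & A5 & A6).
            rewrite A5. apply (lf_le _ _ _ _ _ _ _ _ HD); auto.
            apply Nat.divide_add_r; auto. apply Nat.divide_refl.
         ++ rewrite Hnc4 by auto. auto.
      -- intros v Hv Hn Hs. rewrite Hnc4; [auto|]. intros Ci. apply in_map_iff in Ci.
         destruct Ci as (r' & E & Hr'). apply Hn. rewrite <- E. apply (lr_rec _ _ _ _ _ HR). auto.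
    * rewrite length_app. lia.
    * rewrite length_app. lia.
    * rewrite length_app, Nat.add_assoc.
      apply qkeep_qat with (b := qe + length Out) (s := s3); auto.
      -- lia.
      -- apply qseg_app in HqR. apply HqR.
    * apply qseg_app. split.
      -- apply qkeep_qat with (b := qe + length Out) (s := s3); auto.
      -- exact Hq4.
  + intros Hge. assert (R = []) as -> by (destruct R; auto; cbn in *; lia).
    split; [cost|].
    assert (Hlk : exists k, F = t0 + k * (2 * half)).
    { destruct HF as [a Ea], S1 as [b Eb]. exists (a - b). rewrite Ea, Eb in *. nia. }
    destruct Hlk as [k Ek].
    destruct (sweep_advance F sc m src q pw HS et eh ew reach) with (half := half) (c := c)
      (D := D) (Rs := Rs) (k := k) (t0 := t0) (P := P) (R := @nil rcd) (D' := D') (Out := Out)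
      as (D2 & Hsw2 & ED); auto; try lia; [easy|].
    rewrite <- Ek in Hsw2.
    destruct (sweep_end F sc m src q pw HS et eh ew reach) with (half := half) (c := c)
      (D := D) (Rs := Rs) (P := P) (D' := D2) (Out := Out) as (G1 & G2 & G3); auto.
    exists D2, Out. splits; auto. cbn in ER. lia.
- intros s4 F4 HP. split; [lia|]. exact HP.
Qed.
Variable (K : nat).
Hypothesis EF : F = 2 ^ K.
Hypothesis LT : n * n * sc <= Lim.
(** Space for the queue, whose records are never removed: every level appends at most as many as the
    invariant sum [wsum] with unit weights, which is at most [sc * m]. *)
Hypothesis LQ : (K + 5) * (sc * m) <= Lim.

Let Hl : list nat := filter (fun v => negb (v =? src)) Hd.

Lemma Hl_HS v : In v Hl <-> HS v.
Proof.
unfold Hl, HS. rewrite filter_In. destruct (Nat.eqb_spec v src); cbn; intuition congruence.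
Qed.

Lemma Hl_len : length Hl <= m.
Proof. eapply Nat.le_trans; [apply filter_length_le | auto]. Qed.

(** The root of the bisection: a single interval on which every head falls from infinity to the
    trivial bound 0. *)
Definition recs0 : list rcd := map (fun v => Rcd 0 v sc 0) Hl.

Lemma wsum_recs0 g : wsum g recs0 = sc * list_sum (map g Hl).
Proof.
unfold wsum, recs0. rewrite map_map. cbn [rv rhi rlo].
unfold list_sum. induction Hl as [|v l IH]; cbn [map fold_right]; nia.
Qed.

Definition idle0 (s : state) : Prop :=
  (forall v, ra m s 1 v = 0%R) /\ tree_empty n (ia m s 7) /\ (forall y, ia m s 7 y <= n) /\
  (forall v, ia m s 6 v <= sc) /\ (forall v, v < n -> ~ In v Hd -> ia m s 6 v = sc).

Lemma initq_ok s :
  static s -> heads_at s -> ivar s 11 = src ->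
  tri w initq s (100 * length Hd + 30)
    (fun s' => ivar s' 12 = 0 /\ ivar s' 13 = length recs0 /\ qat s' 0 recs0).
Proof.
intros [] [E6 Hh] E11.
assert (LH : length Hd <= Lim) by lia.
unfold initq, tri. step. step. step. step. step. step.
eapply (wp_call w m); [exact w6 | eapply (tri_while w m) with (T0 := 100 * length Hd + 10)
  (P := fun s' => ivar s' 13 = length recs0 /\ qat s' 0 recs0)
  (I := fun T s' => exists h1 h2, Hd = h1 ++ h2 /\ ivar s' 18 = length h1 /\
    let rs := map (fun v => Rcd 0 v sc 0) (filter (fun v => negb (v =? src)) h1) in
    ivar s' 13 = length rs /\ qat s' 0 rs /\ 100 * length h2 + 10 <= T)|].
- exact w6.
- exists [], Hd. cbn. splits; look; auto.
- intros T s1 F1 (h1 & h2 & EH & E18 & E13 & Hq & HT).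
  assert (Hlen : length Hd = length h1 + length h2) by (rewrite EH; apply length_app).
  eexists. split; [ev|]. split.
  + intros Hlt. destruct h2 as [|v h2]; [cbn in *; lia|]. cbn [length] in *.
    assert (Ev : ia m s 5 (length h1) = v).
    { rewrite Hh by lia. rewrite EH, app_nth2 by lia. now rewrite Nat.sub_diag. }
    assert (Hv : v < n) by (apply Hd_n; rewrite EH; apply in_app_iff; cbn; auto).
    step. step. rewrite Ev. step.
    set (rs := map (fun v => Rcd 0 v sc 0) (filter (fun v => negb (v =? src)) h1)) in *.
    assert (Lrs : length rs <= length h1).
    { unfold rs. rewrite length_map. apply filter_length_le. }
    set (rs' := map (fun v => Rcd 0 v sc 0) (filter (fun v => negb (v =? src)) (h1 ++ [v]))).
    join m 80 (fun s' => ivar s' 13 = length rs' /\ qat s' 0 rs').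
    { unfold rs'. rewrite filter_app, map_app. fold rs. cbn [filter].
      unfold qat in *. step.
      - destruct (Nat.eqb_spec v src); [|congruence]. cbn [negb map]. rewrite app_nil_r.
        step. split; [lia|]. look. auto.
      - destruct (Nat.eqb_spec v src); [congruence|]. cbn [negb map].
        unfold append. step. step. step. step. step. step. step. step. step.
        split; [lia|]. look. rewrite length_app. cbn [length]. split; [lia|].
        apply (qseg_snoc _ _ _ _ _ _ (Rcd 0 v sc 0)); auto. }
    intros s2 F2 (E13' & Hq2). step.
    exists (100 * length h2 + 10). split; [cost|].
    exists (h1 ++ [v]), h2. rewrite <- app_assoc. cbv zeta. fold rs'. splits; look; auto.
    rewrite length_app. cbn. lia.
  + intros C. split; [cost|]. destruct h2; [|cbn in *; lia]. rewrite app_nil_r in EH.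
    subst h1. auto.
- intros s2 F2 (C1 & C2). split; [lia|]. splits; look; auto.
Qed.

Lemma ix_lim s v x : s < n -> v < n -> x < sc ->
  s * n < Lim /\ s * n + v < Lim /\ (s * n + v) * sc < Lim /\ ix n sc s v x < Lim.
Proof.
unfold ix. intros.
assert (A : s * n + v < n * n) by nia.
assert (B : (s * n + v) * sc + sc <= n * n * sc) by nia.
nia.
Qed.

Lemma fillrec_ok s r :
  static s -> ivar s 11 = src -> ivar s 16 = rl r -> ivar s 20 = rv r ->
  ivar s 25 = rlo r -> ivar s 26 = rhi r -> rv r < n -> rlo r <= rhi r <= sc -> rl r < Lim ->
  tri w fillrec s (60 * (rhi r - rlo r) + 10) (fun s' =>
    (forall x, rlo r <= x < rhi r -> ia m s' 13 (ix n sc src (rv r) x) = rl r + 1) /\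
    (forall i, (forall x, rlo r <= x < rhi r -> i <> ix n sc src (rv r) x) ->
       ia m s' 13 i = ia m s 13 i)).
Proof.
intros [] E11 E16 E20 E25 E26 Hv Hr Hrl.
eapply (tri_while w m) with (I := fun T s' => exists y, ivar s' 25 = y /\ rlo r <= y <= rhi r /\
  (forall x, rlo r <= x < y -> ia m s' 13 (ix n sc src (rv r) x) = rl r + 1) /\
  (forall i, (forall x, rlo r <= x < y -> i <> ix n sc src (rv r) x) ->
       ia m s' 13 i = ia m s 13 i) /\ 60 * (rhi r - y) + 10 <= T).
- exact w6.
- exists (rlo r). splits; auto; lia.
- intros T s1 F1 (y & E25' & Hy & C1 & C2 & HT).
  eexists. split; [ev|]. split.
  + intros Hlt. destruct (ix_lim src (rv r) y) as (L1 & L2 & L3 & L4); auto; [lia|].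
    unfold ix in L4.
    step. step. fold (ix n sc src (rv r) y). step.
    exists (60 * (rhi r - (y + 1)) + 10). split; [cost|].
    exists (y + 1). splits; look; auto; try lia.
    * intros x Hx. destruct (Nat.eq_dec x y) as [->|]; [now rewrite aset_eq|].
      rewrite aset_neq. { apply C1. lia. }
      intros E. apply ix_inj in E; lia.
    * intros i Hi. rewrite aset_neq by (apply Hi; lia). apply C2. intros x Hx. apply Hi. lia.
  + intros C. split; [cost|]. replace y with (rhi r) in * by lia. auto.
Qed.

Lemma fill_ok s D Rs qs c :
  static s -> ivar s 11 = src -> ivar s 12 = qs -> ivar s 13 = qs + length Rs ->
  qat s qs Rs -> qs + length Rs <= Lim ->
  level_fun F sc pw HS reach 1 c D -> level_recs HS 1 F D Rs ->
  tri w fill s (150 * wsum (fun _ => 1) Rs + 10) (fun s' =>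
    (forall v x, HS v -> x < sc -> exists t, ia m s' 13 (ix n sc src v x) = t + 1 /\ t < F /\
       D (t + 1) v <= x < D t v) /\
    (forall i, (forall v x, HS v -> x < sc -> i <> ix n sc src v x) ->
       ia m s' 13 i = ia m s 13 i)).
Proof.
intros st E11 E12 E13 Hq HLim HD HR. pose proof st as [].
assert (Hrec : forall r, In r Rs -> rl r + 1 <= F /\ HS (rv r) /\
  rhi r = D (rl r) (rv r) /\ rlo r = D (rl r + 1) (rv r) /\ rlo r < rhi r /\ rhi r <= sc).
{ intros r Hr. destruct (lr_rec _ _ _ _ _ HR r Hr) as (A1 & A2 & A3 & A4 & A5 & A6).
  splits; auto. rewrite A4. apply (lf_le _ _ _ _ _ _ _ _ HD); auto. lia. }
(* A cell is correct if it holds any time at which its scale is passed. In this form a cell may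
   safely be written again, and the uniqueness of the record that covers it need not be followed
   through the loop. *)
set (good := fun i t => exists v x, i = ix n sc src v x /\ HS v /\ x < sc /\ t < F /\
   D (t + 1) v <= x < D t v).
eapply (tri_weaken w m); [exact w6| |apply le_n|].
{ eapply (tri_while w m) with (I := fun T s' => exists P R, Rs = P ++ R /\
    ivar s' 12 = qs + length P /\
    (forall r x, In r P -> rlo r <= x < rhi r ->
       exists t, ia m s' 13 (ix n sc src (rv r) x) = t + 1 /\ good (ix n sc src (rv r) x) t) /\
    (forall i, (forall v x, HS v -> x < sc -> i <> ix n sc src v x) ->
       ia m s' 13 i = ia m s 13 i) /\ 150 * wsum (fun _ => 1) R + 10 <= T)
   (P := fun s' => (forall r x, In r Rs -> rlo r <= x < rhi r ->
       exists t, ia m s' 13 (ix n sc src (rv r) x) = t + 1 /\ good (ix n sc src (rv r) x) t) /\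
    (forall i, (forall v x, HS v -> x < sc -> i <> ix n sc src v x) ->
       ia m s' 13 i = ia m s 13 i)).
  - exact w6.
  - exists [], Rs. splits; auto; try easy. cbn. lia.
  - intros T s1 F1 (P & R & ERs & E12' & C1 & C2 & HT).
    assert (Hlen : length Rs = length P + length R) by (rewrite ERs; apply length_app).
    eexists. split; [ev|]. split.
    + intros Hlt. destruct R as [|r R]; [cbn in *; lia|].
      assert (HrRs : In r Rs) by (rewrite ERs, in_app_iff; cbn; auto).
      destruct (Hrec r HrRs) as (B1 & B2 & B3 & B4 & B5 & B6).
      assert (HqR : qat s1 (qs + length P) (r :: R)).
      { unfold qat in *. look. rewrite ERs in Hq. apply qseg_app in Hq. apply Hq. }
      destruct HqR as [(Q1 & Q2 & Q3 & Q4) _]. cbn [length] in Hlen.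
      assert (Hvn : rv r < n) by (apply Hd_n, B2).
      revert Q1 Q2 Q3 Q4. look. intros Q1 Q2 Q3 Q4.
      step. step. rewrite Q1. step. step. rewrite Q2. step. step. rewrite Q3. step. step. rewrite Q4.
      step. eapply (wp_call w m); [exact w6 | eapply fillrec_ok with (r := r); look; auto; try lia |].
      { constructor; look; auto. }
      look. intros s2 F2 (G1 & G2). step.
      exists (150 * wsum (fun _ => 1) R + 10). split.
      { unfold wsum, list_sum in *. cbn [map fold_right] in HT. cost. }
      assert (Hgood : forall x, rlo r <= x < rhi r -> good (ix n sc src (rv r) x) (rl r)).
      { intros x Hx. exists (rv r), x. splits; auto; lia. }
      exists (P ++ [r]), R. rewrite <- app_assoc. splits; look; auto.
      * rewrite length_app. cbn. lia.
      * intros r' x Hr' Hx.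
        assert (Hr'Rs : In r' Rs).
        { rewrite ERs, in_app_iff. apply in_app_iff in Hr'. cbn in *. tauto. }
        destruct (Hrec r' Hr'Rs) as (B1' & B2' & B3' & B4' & B5' & B6').
        destruct (Nat.eq_dec (rv r') (rv r)) as [Ev|Ev].
        -- destruct (le_lt_dec (rlo r) x) as [Hx1|Hx1].
           ++ destruct (le_lt_dec (rhi r) x) as [Hx2|Hx2].
              ** apply in_app_iff in Hr'. destruct Hr' as [Hr'|[<-|[]]]; [|lia].
                 destruct (C1 r' x Hr' Hx) as (t & Et & Ht). exists t. split; auto.
                 rewrite G2; auto. intros y Hy Ey. rewrite Ev in Ey. apply ix_inj in Ey; lia.
              ** exists (rl r). rewrite Ev. split; auto.
           ++ apply in_app_iff in Hr'. destruct Hr' as [Hr'|[<-|[]]]; [|lia].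
              destruct (C1 r' x Hr' Hx) as (t & Et & Ht). exists t. split; auto.
              rewrite G2; auto. intros y Hy Ey. rewrite Ev in Ey. apply ix_inj in Ey; lia.
        -- apply in_app_iff in Hr'. destruct Hr' as [Hr'|[<-|[]]]; [|congruence].
           destruct (C1 r' x Hr' Hx) as (t & Et & Ht). exists t. split; auto.
           rewrite G2; auto. intros y Hy Ey. apply ix_inj in Ey; try lia; auto.
           apply Hd_n, B2'.
      * intros i Hi. rewrite G2; auto. intros x Hx. apply Hi; auto. lia.
    + intros C. split; [cost|]. destruct R; [|cbn in *; lia]. rewrite app_nil_r in ERs.
      subst P. auto. }
intros s' Fs (C1 & C2). split; auto.
intros v x Hv Hx.
(* the value x is crossed exactly once between the times 0 and F *)
assert (Hcross : exists t, t < F /\ D (t + 1) v <= x < D t v).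
{ assert (H0 : x < D 0 v) by (rewrite (lf_0 _ _ _ _ _ _ _ _ HD); auto).
  assert (HFx : D F v <= x) by (rewrite (lf_F _ _ _ _ _ _ _ _ HD); auto; lia).
  clear - H0 HFx. induction F as [|k IH]; [lia|].
  destruct (le_lt_dec (D k v) x) as [L|L].
  - destruct (IH L) as (t & A & B). exists t. split; auto.
  - exists k. replace (k + 1) with (S k) by lia. auto. }
destruct Hcross as (t & Ht & Hxt).
destruct (lr_all _ _ _ _ _ HR t v) as (r & Hr & El & Ev); auto; try lia.
{ apply Nat.divide_1_l. }
destruct (Hrec r Hr) as (B1 & B2 & B3 & B4 & B5 & B6). rewrite El, Ev in *.
destruct (C1 r x Hr) as (t' & E' & (v2 & x2 & E2 & A2 & A3 & A4 & A5)); [lia|].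
rewrite Ev in *. apply ix_inj in E2; auto; [|apply Hd_n, Hv | apply Hd_n, A2].
destruct E2 as (_ & <- & <-). eauto.
Qed.

(* The entry x of the table is the time at which the scale becomes at most x, or 0 if it never
   does. *)
Definition oracle_for (T : nat -> nat) : Prop :=
  forall p v, p < F -> v < n -> v <> src -> exists d, d <= sc /\
    (forall x, x < sc -> 1 <= T (ix n sc src v x) <= p <-> d <= x) /\
    upper sc pw reach p v d /\ lower pw reach (q ^ K) p v d.

Definition GC : nat := list_sum (map (fun v => gcost v + 10) Hd).

(** Every record has a drop of at least 1, so the sum that is invariant under splitting bounds the
    work on each level. *)
Lemma list_sum_le_wsum g rs :
  (forall r, In r rs -> rlo r < rhi r) -> list_sum (map (fun r => g (rv r)) rs) <= wsum g rs.
Proof.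
unfold wsum, list_sum. induction rs as [|r rs IH]; cbn [map fold_right]; auto.
intros H. pose proof (H r (or_introl eq_refl)) as Hr.
specialize (IH (fun r' Hr' => H r' (or_intror Hr'))).
assert (g (rv r) * 1 <= g (rv r) * (rhi r - rlo r)) by (apply Nat.mul_le_mono_l; lia). lia.
Qed.

Lemma list_sum_filter g (f : nat -> bool) l :
  list_sum (map g (filter f l)) <= list_sum (map g l).
Proof.
unfold list_sum. induction l as [|a l IH]; cbn [filter map fold_right]; auto.
destruct (f a); cbn [map fold_right]; lia.
Qed.

Lemma level_mono D c p p' v :
  level_fun F sc pw HS reach 1 c D -> HS v -> p <= p' -> p' <= F -> D p' v <= D p v.
Proof.
intros HD Hv H HF. induction H as [|p' H IH]; auto.
eapply Nat.le_trans; [|apply IH; lia].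
replace (S p') with (p' + 1) by lia. apply (lf_mono _ _ _ _ _ _ _ _ HD); auto; [|lia].
apply Nat.divide_1_l.
Qed.

(** At time 0 only the source is reachable, so for every other vertex infinity is valid both as an
    upper and as a lower estimate. *)
Lemma level_fun0 : level_fun F sc pw HS reach F 1 (fun t _ => if t =? 0 then sc else 0) /\
  level_recs HS F F (fun t _ => if t =? 0 then sc else 0) recs0.
Proof.
assert (HF1 : 1 <= F) by (rewrite EF; apply Nat.neq_0_lt_0, Nat.pow_nonzero; lia).
assert (HdF : forall t, Nat.divide F t -> t <= F -> t = 0 \/ t = F).
{ intros t [k ->] H. destruct k as [|[|k]]; [auto | right; lia | nia]. }
assert (EF0 : F =? 0 = false) by (apply Nat.eqb_neq; lia).
assert (H0 : forall v x, reach 0 v x -> v = src).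
{ intros v x. revert v x. apply reach_ind; auto. intros. lia. }
split; constructor; auto.
- intros. now rewrite EF0.
- intros t v Hv Ht Hb. destruct (HdF t Ht); [lia| |]; subst t; [|lia]. cbn.
  rewrite EF0. lia.
- intros t v Hv Ht Hb. destruct (t =? 0); lia.
- intros t v Hv Ht Hb. destruct (HdF t Ht); [lia| |]; subst t; [|lia]. cbn. intros C. lia.
- intros t v Hv Ht Hb. destruct (HdF t Ht Hb); subst t.
  + cbn. intros x Hx. apply H0 in Hx. subst v. destruct Hv. congruence.
  + rewrite EF0. intros x Hx. rewrite Hpw0.
    assert (0 <= x)%R.
    { eapply reach_pos with (reach := reach); eauto. }
    lra.
- intros r Hr. unfold recs0 in Hr. apply in_map_iff in Hr. destruct Hr as (v & <- & Hv).
  apply Hl_HS in Hv. cbn. rewrite EF0. splits; auto; [apply Nat.divide_0_r | lia].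
- intros t v Ht Hb Hv Hne. destruct (HdF t Ht); [lia| |]; subst t; [|lia].
  exists (Rcd 0 v sc 0). splits; auto. unfold recs0. apply in_map_iff. exists v.
  rewrite Hl_HS. auto.
- unfold recs0. assert (Hn : NoDup Hl) by (apply NoDup_filter; auto). revert Hn.
  induction Hl as [|v l IH]; cbn; intros Hn; auto. inversion Hn; subst. split; auto.
  intros r' Hr'. apply in_map_iff in Hr'. destruct Hr' as (v' & <- & Hv'). right. cbn.
  split; auto. congruence.
Qed.

(** By the invariance of [wsum], each of the K levels costs at most [sc * GC], as if every head were
    recomputed once per scale. The factor of the lower bound is q^j after j levels, hence q^K in the
    table. *)
Lemma source_ok s :
  static s -> heads_at s -> ivar s 11 = src -> ivar s 8 = F -> idle0 s ->
  (forall v x, v < n -> x < sc -> ia m s 13 (ix n sc src v x) = 0) ->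
  tri w source s ((K + 1) * (sc * GC + 60 * length Hd + 110) + 150 * (sc * m) +
      100 * length Hd + 200)
    (fun s' => idle0 s' /\ oracle_for (ia m s' 13) /\
      forall i, (forall v x, v < n -> x < sc -> i <> ix n sc src v x) ->
        ia m s' 13 i = ia m s 13 i).
Proof.
intros st Hh E11 E8 Hid Hfresh. pose proof st as [].
destruct level_fun0 as [HD0 HR0].
set (W1 := wsum (fun _ => 1) recs0).
assert (HW1 : W1 <= sc * m).
{ unfold W1. rewrite wsum_recs0. apply Nat.mul_le_mono_l.
  eapply Nat.le_trans; [|apply Hl_len]. unfold list_sum. clear.
  induction Hl as [|v l IH]; cbn [map fold_right length]; lia. }
set (LC := sc * GC + 60 * length Hd + 100).
unfold source, tri. step.
eapply (wp_call w m); [exact w6 | eapply initq_ok; auto |].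
intros s1 F1 (E12 & E13 & Hq1).
step. step. step.
assert (Hid1 : idle s1).
{ destruct Hid as (I1 & I2 & I3 & I4 & I5). unfold idle. splits; look; auto.
  intros v Hv Hn Hs. apply I5; auto. unfold HS in Hn. tauto. }
eapply (wp_call w m); [exact w6 | eapply (tri_while w m) with (T0 := K * (LC + 5) + 5)
  (P := fun s' => exists D Rs qs, ivar s' 12 = qs /\ ivar s' 13 = qs + length Rs /\
     idle s' /\ qat s' qs Rs /\ (forall g, wsum g Rs = wsum g recs0) /\
     level_fun F sc pw HS reach 1 (q ^ K) D /\ level_recs HS 1 F D Rs /\
     qs + length Rs <= (K + 1) * W1)
  (I := fun T s' => exists j D Rs qs, j <= K /\ ivar s' 14 = 2 ^ j /\
     ivar s' 12 = qs /\ ivar s' 13 = qs + length Rs /\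
     idle s' /\ qat s' qs Rs /\ (forall g, wsum g Rs = wsum g recs0) /\
     level_fun F sc pw HS reach (2 ^ j) (q ^ (K - j)) D /\ level_recs HS (2 ^ j) F D Rs /\
     qs + length Rs <= (K - j + 1) * W1 /\ j * (LC + 5) + 5 <= T)|].
- exact w6.
- exists K, (fun t _ => if t =? 0 then sc else 0), recs0, 0. rewrite Nat.sub_diag, <- EF.
  splits; look; auto.
  + rewrite Nat.add_0_l, Nat.mul_1_l. apply length_le_wsum.
    intros r Hr. apply (lr_rec _ _ _ _ _ HR0 r Hr).
- intros T s2 F2 (j & D & Rs & qs & Hj & E14 & E12' & E13' & Hid2 & Hq2 & Hsum & HD & HR & Hqe & HT).
  eexists. split; [ev|].
  destruct j as [|j].
  + split; [cbn; lia|]. intros _. split; [cost|]. rewrite Nat.sub_0_r in *.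
    exists D, Rs, qs. splits; auto.
  + assert (H2j : 2 ^ S j = 2 * 2 ^ j) by (cbn; lia).
    assert (Hpj : 1 <= 2 ^ j) by (apply Nat.neq_0_lt_0, Nat.pow_nonzero; lia).
    split; [|intros C; exfalso; lia]. intros _.
    rewrite H2j in *.
    assert (HcK : (1 <= q ^ (K - S j))%R) by (apply pow_R1_Rle; auto).
    eapply (wp_call w m); [exact w6 | eapply level_ok with (half := 2 ^ j) (c := (q ^ (K - S j))%R)
      (D := D) (Rs := Rs) (qs := qs); eauto |].
    { constructor; look; auto. }
    { destruct Hh. split; look; auto. }
    { look; auto. }
    { exists (2 ^ (K - S j)). rewrite <- H2j, EF, <- Nat.pow_add_r. f_equal. lia. }
    { rewrite Hsum. fold W1.
      assert ((K - S j + 1) * W1 + 3 * W1 <= (K + 5) * W1) by nia.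
      assert ((K + 5) * W1 <= (K + 5) * (sc * m)) by (apply Nat.mul_le_mono_l; auto). lia. }
    intros s3 F3 (D' & Out & G1 & G2 & G3 & G4 & G5 & G6 & G7 & G8).
    exists (j * (LC + 5) + 5).
    split.
    { assert (list_sum (map (fun r => gcost (rv r) + 10) Rs) <= sc * GC).
      { eapply Nat.le_trans.
        - apply (list_sum_le_wsum (fun v => gcost v + 10)).
          intros r Hr. apply (lr_rec _ _ _ _ _ HR r Hr).
        - rewrite Hsum, wsum_recs0. apply Nat.mul_le_mono_l. apply list_sum_filter. }
      unfold LC in *. cost. }
    exists j, D', Out, (qs + length Rs).
    replace (q ^ (K - j))%R with (q ^ (K - S j) * q)%R.
    2:{ replace (K - j) with (S (K - S j)) by lia. cbn. ring. }
    splits; auto; try lia.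
    * intros g. rewrite G8. auto.
    * assert (length Out <= W1).
      { eapply Nat.le_trans; [apply length_le_wsum; intros r Hr;
          apply (lr_rec _ _ _ _ _ G7 r Hr)|]. rewrite G8, Hsum. auto. }
      replace (K - j + 1) with (S (K - S j + 1)) by lia. cbn [Nat.mul]. lia.
- intros s2 F2 (D & Rs & qs & E12' & E13' & Hid2 & Hq2 & Hsum & HD & HR & Hqe).
  assert (HqeL : qs + length Rs <= Lim).
  { assert ((K + 1) * W1 <= (K + 5) * (sc * m)) by (apply Nat.mul_le_mono; lia). lia. }
  step. eapply (wp_call w m); [exact w6 | eapply fill_ok with (qs := qs) (Rs := Rs); eauto |].
  { constructor; look; auto. }
  { look; auto. }
  intros s3 F3 (G1 & G2). step. split.
  { rewrite Hsum. fold W1. unfold LC. nia. }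
  assert (E13s : ia m s2 13 = ia m s 13) by (look; auto). rewrite E13s in G2.
  splits; look; auto.
  + destruct Hid2 as (I1 & I2 & I3 & I4 & I5). unfold idle0. splits; look; auto.
    * intros v. destruct (Nat.eq_dec v src) as [->|]; [now rewrite aset_eq|].
      now rewrite aset_neq by auto.
    * intros v Hv Hn. destruct (Nat.eq_dec v src) as [->|]; [now rewrite aset_eq|].
      rewrite aset_neq by auto. apply I5; auto. unfold HS. tauto.
  + intros p v Hp Hv Hs. destruct (HS_dec v) as [HSv|HSv].
    * exists (D p v). splits.
      -- apply (lf_le _ _ _ _ _ _ _ _ HD); auto; [apply Nat.divide_1_l | lia].
      -- intros x Hx. destruct (G1 v x HSv Hx) as (t & Et & HtF & Hxt). rewrite Et. split.
         ++ intros [_ Htp].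
            assert (D p v <= D (t + 1) v) by (eapply level_mono; eauto; lia). lia.
         ++ intros Hd'. split; [lia|]. destruct (le_lt_dec (t + 1) p); auto. exfalso.
            assert (D t v <= D p v) by (eapply level_mono; eauto; lia). lia.
      -- apply (lf_up _ _ _ _ _ _ _ _ HD); auto. apply Nat.divide_1_l.
      -- apply (lf_low _ _ _ _ _ _ _ _ HD); auto; [apply Nat.divide_1_l | lia].
    (* A vertex that is neither the source nor the head of an edge is unreachable; its cells are
       still 0, which reads as the infinite scale. *)
    * exists sc. splits; auto.
      -- intros x Hx. rewrite G2.
         ++ rewrite Hfresh by auto. lia.
         ++ intros v' x' Hv' Hx' E. apply ix_inj in E; auto.
            ** destruct E as (_ & -> & _). auto.
            ** apply Hd_n, Hv'.
      -- intros C. lia.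
      -- intros x Hx. exfalso.
         assert (HH : v = src \/ In v Hd).
         { revert Hx. pattern v, x. revert v x Hv Hs HSv.
           assert (G : forall v x, reach p v x -> v = src \/ In v Hd).
           { intros v x. revert v x. apply reach_ind; auto. }
           intros v x _ _ _ Hx. eauto. }
         unfold HS in HSv. tauto.
  + intros i Hi. apply G2. intros v x HSv Hx. apply Hi; auto. apply Hd_n, HSv.
Qed.
End Source.
End Group.

(** * Paths *)

Lemma path_app G i j k l l' : path G i j l -> path G j k l' -> path G i k (l + l')%R.
Proof.
induction 1 as [|e j l He H IH]; intros H'; [now rewrite Rplus_0_l|].
rewrite Rplus_assoc. constructor; auto.
Qed.

Lemma path_snoc G i e l : In e G -> path G i (tail e) l -> path G i (head e) (l + weight e)%R.
Proof.
intros He H. eapply path_app; eauto. rewrite <- (Rplus_0_r (weight e)).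
constructor; auto. constructor.
Qed.

Lemma path_incl G G' i j l : incl G G' -> path G i j l -> path G' i j l.
Proof. intros H; induction 1; constructor; auto. Qed.

(** Paths are built from the front, while shortest-path arguments append the last edge; this is the
    induction in that direction. *)
Lemma path_ind_right G i (P : nat -> R -> Prop) :
  P i 0%R ->
  (forall e l, In e G -> path G i (tail e) l -> P (tail e) l -> P (head e) (l + weight e)%R) ->
  forall j l, path G i j l -> P j l.
Proof.
intros H0 Hs.
assert (G1 : forall i' j l, path G i' j l -> forall l0, path G i i' l0 -> P i' l0 ->
  P j (l0 + l)%R).
{ induction 1 as [i'|e j l He H IH]; intros l0 Hp Hl0; [now rewrite Rplus_0_r|].
  rewrite <- Rplus_assoc. apply IH; [now apply path_snoc | auto]. }
intros j l H. rewrite <- (Rplus_0_l l). eapply G1; eauto. constructor.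
Qed.

(** Paths without repeated vertices, together with the list of these vertices, which bounds the
    number of edges by n. *)
Inductive spath (G : list edge) : nat -> nat -> R -> list nat -> Prop :=
| spath_nil i : spath G i i 0 [i]
| spath_cons e j l vs : In e G -> spath G (head e) j l vs -> ~ In (tail e) vs ->
    spath G (tail e) j (weight e + l) (tail e :: vs).

Lemma spath_suffix G i j l vs x :
  spath G i j l vs -> In x vs -> exists l' vs', spath G x j l' vs'.
Proof.
induction 1 as [i|e j l vs He H IH Hn]; intros Hx.
- destruct Hx as [<-|[]]. do 2 eexists. constructor.
- destruct Hx as [<-|Hx]; [|auto]. do 2 eexists. constructor; eauto.
Qed.

Lemma path_spath G i j l : path G i j l -> exists l' vs, spath G i j l' vs.
Proof.
induction 1 as [i|e j l He H (l' & vs & IH)].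
- do 2 eexists. constructor.
- destruct (in_dec Nat.eq_dec (tail e) vs) as [Hi|Hi].
  + eapply spath_suffix; eauto.
  + do 2 eexists. constructor; eauto.
Qed.

Lemma spath_facts G n W i j l vs :
  (forall e, In e G -> tail e < n /\ head e < n /\ (1 <= weight e <= W)%R) -> i < n ->
  spath G i j l vs ->
  path G i j l /\ NoDup vs /\ (forall v, In v vs -> v < n) /\ (l <= (INR (length vs) - 1) * W)%R.
Proof.
intros HG Hi H. revert Hi. induction H as [i|e j l vs He H IH Hn]; intros Hi.
- splits; [constructor | | |].
  + constructor; [auto | constructor].
  + intros v [<-|[]]; auto.
  + cbn. lra.
- destruct (HG e He) as (A & B & C). destruct (IH B) as (I1 & I2 & I3 & I4).
  splits; [now constructor | now constructor | |].
  + intros v [<-|Hv]; auto.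
  + cbn [length]. rewrite S_INR. nra.
Qed.

(* Cutting the cycles bounds the length of some path by nW. *)
Lemma path_short G n W i j l :
  (forall e, In e G -> tail e < n /\ head e < n /\ (1 <= weight e <= W)%R) -> i < n ->
  (1 <= W)%R -> path G i j l -> exists l', path G i j l' /\ (l' <= INR n * W)%R.
Proof.
intros HG Hi HW H. apply path_spath in H. destruct H as (l' & vs & H).
destruct (spath_facts G n W i j l' vs HG Hi H) as (A & B & C & D).
exists l'. split; auto. eapply Rle_trans; [exact D|].
assert (length vs <= n).
{ rewrite <- (length_seq n 0). apply NoDup_incl_length; auto.
  intros v Hv. apply in_seq. specialize (C v Hv). lia. }
apply Rmult_le_compat_r; [lra|]. apply le_INR in H0. lra.
Qed.

Lemma path_ge0 G i j l :
  (forall e, In e G -> (0 <= weight e)%R) -> path G i j l -> (0 <= l)%R.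
Proof.
intros HG. induction 1 as [|e j l He H IH]; [lra|]. specialize (HG e He). lra.
Qed.

Definition edge0 : edge := Edge 0 0 0.

(** * Paths among the first predicted edges, in terms of the arrays of the program *)

Section Reach.
Variables (sh : list edge) (et eh : nat -> nat) (ew : nat -> R).
Let m := length sh.
Hypothesis Het : forall e, e < m -> et e = tail (nth e sh edge0).
Hypothesis Heh : forall e, e < m -> eh e = head (nth e sh edge0).
Hypothesis Hew : forall e, e < m -> ew e = weight (nth e sh edge0).

Definition reach (src t v : nat) (x : R) : Prop := path (firstn t sh) src v x.

Lemma in_firstn e t :
  In e (firstn t sh) <-> exists i, i < t /\ i < m /\ e = nth i sh edge0.
Proof.
split.
- intros H. destruct (In_nth _ _ edge0 H) as (i & Hi & E). rewrite length_firstn in Hi.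
  exists i. splits; try (unfold m; lia). rewrite <- E. symmetry.
  rewrite <- (firstn_skipn t sh) at 1. rewrite app_nth1; auto. rewrite length_firstn. auto.
- intros (i & H1 & H2 & ->). rewrite <- (firstn_skipn t sh) at 1.
  assert (i < length (firstn t sh)) by (rewrite length_firstn; unfold m in *; lia).
  rewrite app_nth1 by auto. now apply nth_In.
Qed.

Lemma reach_mono src t t' v x : t <= t' -> reach src t v x -> reach src t' v x.
Proof.
intros Ht. apply path_incl. intros e He. apply in_firstn in He. destruct He as (i & A & B & C).
apply in_firstn. exists i. splits; auto. lia.
Qed.

Lemma reach_src src t : reach src t src 0%R.
Proof. constructor. Qed.

Lemma reach_step src t e x :
  e < m -> e < t -> reach src t (et e) x -> reach src t (eh e) (x + ew e)%R.
Proof.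
intros He Ht H. rewrite Heh, Hew by auto. rewrite Het in H by auto.
apply path_snoc; auto. apply in_firstn. eauto.
Qed.

Lemma reach_ind src t (P : nat -> R -> Prop) : P src 0%R ->
  (forall e x, e < m -> e < t -> reach src t (et e) x -> P (et e) x -> P (eh e) (x + ew e)%R) ->
  forall v x, reach src t v x -> P v x.
Proof.
intros H0 Hs. apply path_ind_right; auto. intros e l He Hp HP.
apply in_firstn in He. destruct He as (i & A & B & ->).
rewrite <- Het in Hp, HP by auto. rewrite <- Heh, <- Hew by auto. auto.
Qed.
End Reach.

Lemma flat_map_nth_even sh e :
  e < length sh ->
  nth (2 * e) (flat_map (fun e => [tail e; head e]) sh) 0 = tail (nth e sh edge0) /\
  nth (2 * e + 1) (flat_map (fun e => [tail e; head e]) sh) 0 = head (nth e sh edge0).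
Proof.
revert e. induction sh as [|a sh IH]; intros e He; [cbn in He; lia|].
destruct e as [|e]; [cbn; auto|]. cbn [length] in He.
replace (2 * S e) with (S (S (2 * e))) by lia. cbn [flat_map app nth Nat.add].
apply IH. lia.
Qed.

Lemma flat_map_length_2 (sh : list edge) :
  length (flat_map (fun e => [tail e; head e]) sh) = 2 * length sh.
Proof. induction sh as [|a sh IH]; cbn [flat_map length app]; auto. rewrite IH. lia. Qed.

(** * The preprocessing program *)

Definition setup_time : com := seqs [
  ISet 7 (IConst 0); ISet 8 (IConst 1);
  While (BILe (IVar 8) (IVar 1)) (seqs [
    ISet 8 (IMul (IConst 2) (IVar 8));
    ISet 7 (IAdd (IVar 7) (IConst 1))])].

(** The machine computes no logarithm: powers of q are generated until one reaches n W (1 + eps),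
    the largest value a finite answer can need. One further power is the value of the infinite
    scale. *)
Definition setup_scales (c0 : nat) : com := seqs [
  RSet 4 (RAdd (ROfInt (IConst 1))
    (RDiv (RVar 0) (ROfInt (IMul (IConst c0) (IAdd (IVar 7) (IConst 1))))));
  RSet 7 (RMul (RMul (ROfInt (IVar 0)) (RVar 1)) (RAdd (ROfInt (IConst 1)) (RVar 0)));
  RSet 8 (ROfInt (IConst 1));
  ISet 5 (IConst 1);
  RSt 0 (IVar 5) (RVar 8);
  While (BNot (BRLe (RVar 7) (RVar 8))) (seqs [
    RSet 8 (RMul (RVar 4) (RVar 8));
    ISet 5 (IAdd (IVar 5) (IConst 1));
    RSt 0 (IVar 5) (RVar 8)]);
  RSet 8 (RMul (RVar 4) (RVar 8));
  ISet 5 (IAdd (IVar 5) (IConst 1));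
  RSt 0 (IVar 5) (RVar 8)].

(** A vertex is recorded as a head when its list of in-edges is still empty, so that the list of
    heads has no repetition. *)
Definition setup_edges : com := seqs [
  ISet 6 (IConst 0); ISet 18 (IConst 0);
  While (BNot (BILe (IVar 1) (IVar 18))) (seqs [
    ISet 20 (ILoad (IMul (IConst 2) (IVar 18)));
    ISet 29 (ILoad (IAdd (IMul (IConst 2) (IVar 18)) (IConst 1)));
    RSet 5 (RLoad (IVar 18));
    St 15 (IVar 18) (IVar 20);
    St 16 (IVar 18) (IVar 29);
    RSt 2 (IVar 18) (RVar 5);
    St 0 (IAdd (IMul (IVar 20) (IVar 0)) (IVar 29)) (IAdd (IVar 18) (IConst 1));
    If (BIEq (Ld 1 (IVar 29)) (IConst 0)) (seqs [
      St 5 (IVar 6) (IVar 29);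
      ISet 6 (IAdd (IVar 6) (IConst 1))]) Skip;
    St 2 (IVar 18) (Ld 1 (IVar 29));
    St 1 (IVar 29) (IAdd (IVar 18) (IConst 1));
    St 4 (IVar 18) (Ld 3 (IVar 20));
    St 3 (IVar 20) (IAdd (IVar 18) (IConst 1));
    ISet 18 (IAdd (IVar 18) (IConst 1))])].

Definition setup_cur : com := seqs [
  ISet 18 (IConst 0);
  While (BNot (BILe (IVar 0) (IVar 18))) (seqs [
    St 6 (IVar 18) (IVar 5);
    ISet 18 (IAdd (IVar 18) (IConst 1))])].

Definition sources : com := seqs [
  ISet 11 (IConst 0);
  While (BNot (BILe (IVar 0) (IVar 11))) (seqs [
    source;
    ISet 11 (IAdd (IVar 11) (IConst 1))])].

Definition preprocess (c0 : nat) : com :=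
  seqs [setup_edges; setup_time; setup_scales c0; setup_cur; sources].

(** The number of binary digits of [m], that is the least K with m < 2^K. The inequality is strict
    so that every prefix, of length at most m, stays before the last time, at which the scales are
    artificial. *)
Definition Kof (m : nat) : nat := if m =? 0 then 0 else S (Nat.log2 m).

Lemma Kof_spec m :
  m < 2 ^ Kof m <= 2 * m + 1 /\ Kof m <= m + 1 /\ forall j, j < Kof m -> 2 ^ j <= m.
Proof.
unfold Kof. destruct (Nat.eqb_spec m 0) as [->|Hm].
- cbn. splits; auto; lia.
- destruct (Nat.log2_spec m) as [A B]; [lia|]. pose proof (Nat.log2_le_lin m).
  splits; auto; try lia. { rewrite Nat.pow_succ_r'. lia. }
  intros j Hj. eapply Nat.le_trans; [|exact A]. apply Nat.pow_le_mono_r; lia.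
Qed.

Lemma setup_time_ok w m s :
  6 <= w -> ivar s 1 = m -> 4 * m + 4 < 2 ^ w ->
  tri w setup_time s (30 * Kof m + 20) (fun s' => ivar s' 7 = Kof m /\ ivar s' 8 = 2 ^ Kof m).
Proof.
intros w6 Em Hw.
destruct (Kof_spec m) as (HK & HK2 & Hmin). set (K := Kof m) in *.
unfold setup_time, tri. step. step. step. step.
eapply (wp_call w m); [exact w6 | eapply (tri_while w m) with (T0 := 30 * K + 10)
  (P := fun s' => ivar s' 7 = K /\ ivar s' 8 = 2 ^ K)
  (I := fun T s' => exists j, j <= K /\ ivar s' 7 = j /\ ivar s' 8 = 2 ^ j /\
     30 * (K - j) + 10 <= T)|].
- exact w6.
- exists 0. splits; look; auto; lia.
- intros T s1 F1 (j & Hj & E7 & E8 & HT). eexists. split; [ev|].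
  assert (HjK : j = K \/ j < K) by lia. split.
  + intros Hle. destruct HjK as [->|HjK]; [lia|].
    step. step. step. exists (30 * (K - (j + 1)) + 10). split; [cost|].
    exists (j + 1). splits; look; auto; try lia. rewrite Nat.add_1_r. cbn. lia.
  + intros Hn. split; [cost|]. destruct HjK as [->|HjK]; auto. apply Hmin in HjK. lia.
- intros s' _ H. split; [lia | exact H].
Qed.

(** [N] is an a priori bound on the exponent that serves as termination measure. As scale i has the
    value q^(i - 1), the last claim concerns the largest finite scale, sc - 1. *)
Lemma setup_scales_ok w m c0 s n K N (W eps q : R) :
  6 <= w -> ivar s 0 = n -> ivar s 1 = m -> ivar s 7 = K -> rvar s 0 = eps -> rvar s 1 = W ->
  1 <= c0 -> c0 < 2 ^ w -> c0 * (K + 1) < 2 ^ w -> 32 * (m + N + 4) < 2 ^ w ->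
  q = (1 + eps / INR (c0 * (K + 1)))%R ->
  (INR n * W * (1 + eps) <= q ^ N)%R -> ra m s 0 0 = 0%R ->
  tri w (setup_scales c0) s (60 * N + 200) (fun s' => exists sc, ivar s' 5 = sc /\
    2 <= sc <= N + 2 /\ ra m s' 0 0 = 0%R /\
    (forall i, 1 <= i <= sc -> ra m s' 0 i = (q ^ (i - 1))%R) /\
    (INR n * W * (1 + eps) <= q ^ (sc - 2))%R).
Proof.
intros w6 E0 E1 E7 R0 R1 Hc0 Hc0w HcK HN Eq HqN Hp0.
assert (K + 1 <= c0 * (K + 1)) by nia.
unfold setup_scales, tri.
step. step. step. step. step. step. step. step. step. step. step.
replace (INR 1) with 1%R by reflexivity. rewrite <- Eq.
eapply (wp_call w m); [exact w6 | eapply (tri_while w m) with (T0 := 60 * N + 20)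
  (P := fun s' => exists i, ivar s' 5 = i + 1 /\ i <= N /\ rvar s' 8 = (q ^ i)%R /\
     (INR n * W * (1 + eps) <= q ^ i)%R /\ ra m s' 0 0 = 0%R /\
     (forall j, 1 <= j <= i + 1 -> ra m s' 0 j = (q ^ (j - 1))%R))
  (I := fun T s' => exists i, ivar s' 5 = i + 1 /\ i <= N /\ rvar s' 8 = (q ^ i)%R /\
     ra m s' 0 0 = 0%R /\
     (forall j, 1 <= j <= i + 1 -> ra m s' 0 j = (q ^ (j - 1))%R) /\ 60 * (N - i) + 20 <= T)|].
- exact w6.
- exists 0. splits; look; auto; try lia.
  intros j Hj. replace j with 1 by lia. now rewrite aset_eq.
- intros T s1 F1 (i & E5 & Hi & E8 & Hz & Hj & HT). eexists. split; [ev|]. split.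
  + intros Hn. assert (i < N).
    { destruct (Nat.eq_dec i N) as [->|]; [|lia]. contradiction. }
    step. step. step. step. step.
    exists (60 * (N - (i + 1)) + 20). split; [cost|].
    exists (i + 1). replace (q ^ (i + 1))%R with (q * q ^ i)%R by (rewrite Nat.add_1_r; reflexivity).
    splits; look; auto; try lia.
    * rewrite aset_neq by lia. auto.
    * intros j Hj'. destruct (Nat.eq_dec j (i + 1 + 1)) as [->|].
      -- rewrite aset_eq. replace (i + 1 + 1 - 1) with (S i) by lia. reflexivity.
      -- rewrite aset_neq by lia. apply Hj. lia.
  + intros Hn. split; [cost|]. exists i. splits; auto.
    apply NNPP. auto.
- intros s2 F2 (i & E5 & Hi & E8 & HM & Hz & Hj).
  step. step. step. step. step. split; [lia|].
  exists (i + 1 + 1). replace (i + 1 + 1 - 2) with i by lia. splits; look; auto; try lia.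
  + rewrite aset_neq by lia. auto.
  + intros j Hj'. destruct (Nat.eq_dec j (i + 1 + 1)) as [->|].
    * rewrite aset_eq. replace (i + 1 + 1 - 1) with (S i) by lia. reflexivity.
    * rewrite aset_neq by lia. apply Hj. lia.
Qed.

Lemma chain_ext nx nx' p l :
  (forall e, In e l -> nx' e = nx e) -> chain nx p l -> chain nx' p l.
Proof.
intros H. induction 1 as [|e l Hc IH]; constructor.
rewrite H by (cbn; auto). apply IH. intros; apply H; cbn; auto.
Qed.

(** In decreasing order, because the lists in memory grow at the front. *)
Definition adj (f : nat -> nat) (k v : nat) : list nat :=
  filter (fun e => f e =? v) (rev (seq 0 k)).

Lemma adj_S f k v : adj f (S k) v = if f k =? v then k :: adj f k v else adj f k v.
Proof. unfold adj. rewrite seq_S, rev_app_distr. cbn. destruct (f k =? v); auto. Qed.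

Lemma in_adj f k v e : In e (adj f k v) <-> e < k /\ f e = v.
Proof.
unfold adj. rewrite filter_In, <- in_rev, in_seq, Nat.eqb_eq. intuition lia.
Qed.

(** * Reading the predicted edges *)

Section Edges.
Variables (w n Lim : nat) (sh : list edge).
Let m := length sh.
Let tlf (e : nat) : nat := tail (nth e sh edge0).
Let hdf (e : nat) : nat := head (nth e sh edge0).
Hypothesis w6 : 6 <= w.
Hypothesis Hw : 32 * (m + Lim + 2) < 2 ^ w.
Hypothesis Ln : n * n <= Lim.
Hypothesis Ln1 : n <= Lim.
Hypothesis Lm : 2 * m <= Lim.
Hypothesis Htl : forall e, e < m -> tlf e < n.
Hypothesis Hhd : forall e, e < m -> hdf e < n.
Hypothesis Hnd : forall e e', e < m -> e' < m -> tlf e = tlf e' -> hdf e = hdf e' -> e = e'.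

(** The input lies below the addresses 2m and m, all arrays start at 32m; hence writing arrays never
    destroys input that is still to be read. *)
Definition raw_keep (s s' : state) : Prop :=
  (forall a, a < 2 * m -> imem s' a = imem s a) /\ (forall a, a < m -> rmem s' a = rmem s a).

Lemma raw_keep_ia s s' j i v : raw_keep s s' -> raw_keep s (set_ia m s' j i v).
Proof.
intros [A B]. split; auto. intros a Ha. rewrite <- A by auto.
unfold set_ia, set_imem, upd. cbn [imem].
destruct (Nat.eqb_spec a (32 * (m + i) + j)); auto. lia.
Qed.
Lemma raw_keep_ra s s' j i v : raw_keep s s' -> raw_keep s (set_ra m s' j i v).
Proof.
intros [A B]. split; auto. intros a Ha. rewrite <- B by auto.
unfold set_ra, set_rmem, upd. cbn [rmem].
destruct (Nat.eqb_spec a (32 * (m + i) + j)); auto. lia.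
Qed.
Lemma raw_keep_ivar s s' x v : raw_keep s s' -> raw_keep s (set_ivar s' x v).
Proof. auto. Qed.
Lemma raw_keep_rvar s s' x v : raw_keep s s' -> raw_keep s (set_rvar s' x v).
Proof. auto. Qed.

Record edges_at (k : nat) (Hd : list nat) (s : state) : Prop := EdgesAt {
  ea_h : ivar s 6 = length Hd;
  ea_hd : forall i, i < length Hd -> ia m s 5 i = nth i Hd 0;
  ea_nd : NoDup Hd;
  ea_len : length Hd <= k;
  ea_in : forall v, In v Hd <-> exists e, e < k /\ hdf e = v;
  ea_et : forall e, e < k -> ia m s 15 e = tlf e;
  ea_eh : forall e, e < k -> ia m s 16 e = hdf e;
  ea_ew : forall e, e < k -> ra m s 2 e = weight (nth e sh edge0);
  ea_pos : forall e, e < k -> ia m s 0 (tlf e * n + hdf e) = e + 1;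
  ea_inl : forall v, chain (ia m s 2) (ia m s 1 v) (adj hdf k v);
  ea_outl : forall v, chain (ia m s 4) (ia m s 3 v) (adj tlf k v) }.

Lemma chain_push f nx hd k :
  (forall v, chain nx (hd v) (adj f k v)) ->
  forall v, chain (aset nx k (hd (f k))) (aset hd (f k) (k + 1) v) (adj f (S k) v).
Proof.
intros H v. rewrite adj_S. destruct (Nat.eqb_spec (f k) v) as [<-|Hne].
- rewrite aset_eq, Nat.add_1_r. constructor. rewrite aset_eq.
  eapply chain_ext; [|apply H]. intros e He. apply in_adj in He. apply aset_neq. lia.
- rewrite aset_neq by auto. eapply chain_ext; [|apply H].
  intros e He. apply in_adj in He. apply aset_neq. lia.
Qed.

Lemma setup_edges_ok s :
  ivar s 0 = n -> ivar s 1 = m ->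
  (forall a, a < 2 * m -> imem s a = nth a (flat_map (fun e => [tail e; head e]) sh) 0) ->
  (forall a, a < m -> rmem s a = nth a (map weight sh) 0%R) ->
  (forall v, ia m s 1 v = 0) -> (forall v, ia m s 3 v = 0) ->
  tri w setup_edges s (250 * m + 30) (fun s' => exists Hd, edges_at m Hd s').
Proof.
intros E0 E1 Hraw Hrawr Hz1 Hz3.
unfold setup_edges, tri. step. step. step. step.
eapply (wp_call w m); [exact w6 | eapply (tri_while w m) with (T0 := 250 * m + 10)
  (P := fun s' => exists Hd, edges_at m Hd s')
  (I := fun T s' => exists k Hd, k <= m /\ ivar s' 18 = k /\ edges_at k Hd s' /\
     raw_keep s s' /\ 250 * (m - k) + 10 <= T)|].
- exact w6.
- exists 0, []. splits; look; auto; try lia.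
  + constructor; look; auto; try easy; try (cbn; lia).
    * constructor.
    * intros v. split; [easy | intros (e & He & _); lia].
    * intros v. rewrite Hz1. constructor.
    * intros v. rewrite Hz3. constructor.
  + split; auto.
- intros T s1 F1 (k & Hd & Hk & E18 & Hed & Hrk & HT).
  destruct Hed as [A1 A2 A3 A4 A5 A6 A7 A8 A9 A10 A11].
  eexists. split; [ev|]. split.
  + intros Hlt. assert (Hkm : k < m) by lia.
    pose proof (Htl k Hkm) as Tk. pose proof (Hhd k Hkm) as Dk.
    destruct (flat_map_nth_even sh k Hkm) as [Ev Od].
    destruct Hrk as [RK1 RK2].
    assert (Ru : imem s1 (2 * k) = tlf k) by (rewrite RK1, Hraw by lia; exact Ev).
    assert (Rv : imem s1 (2 * k + 1) = hdf k) by (rewrite RK1, Hraw by lia; exact Od).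
    assert (Rw : rmem s1 k = weight (nth k sh edge0)).
    { rewrite RK2, Hrawr by lia. change 0%R with (weight edge0). apply map_nth. }
    assert (Lp : tlf k * n + hdf k < n * n) by nia.
    assert (Lp2 : tlf k * n <= n * n) by nia.
    step. eapply wp_iset; [vm_compute; reflexivity | eapply ev_load; [ev | exact Ru] | cbv beta].
    step. eapply wp_iset; [vm_compute; reflexivity | eapply ev_load; [ev | exact Rv] | cbv beta].
    step. eapply wp_rset; [vm_compute; reflexivity | eapply re_load; [ev | exact Rw] | cbv beta].
    step. step. step. step. step. step. step. step. step.
    remember (ia m s1 1) as hin eqn:Ehin. symmetry in Ehin.
    remember (ia m s1 3) as hout eqn:Ehout. symmetry in Ehout.
    match goal with |- wp _ _ ?st _ _ => set (s2 := st) in * end.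
    assert (Hrk2 : raw_keep s s2).
    { unfold s2. do 6 (first [apply raw_keep_ia | apply raw_keep_ra | apply raw_keep_rvar
        | apply raw_keep_ivar]). split; auto. }
    join m 60 (fun s' => exists Hd', ivar s' 6 = length Hd' /\
      (forall i, i < length Hd' -> ia m s' 5 i = nth i Hd' 0) /\ NoDup Hd' /\
      length Hd' <= k + 1 /\ (forall v, In v Hd' <-> v = hdf k \/ In v Hd) /\ raw_keep s s').
    (* By the invariant the list of in-edges of a vertex is empty exactly if no earlier edge ends
       there, so one test decides whether the head is new. *)
    { assert (Hh0 : hin (hdf k) = 0 <-> ~ In (hdf k) Hd).
      { rewrite A5. specialize (A10 (hdf k)). split.
        - intros E. rewrite E in A10. inversion A10 as [X Y|]. intros (e & He & Ee).
          assert (Hi : In e (adj hdf k (hdf k))) by (apply in_adj; auto).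
          rewrite <- Y in Hi. destruct Hi.
        - intros Hn. inversion A10 as [X Y|e l Hc X Y]; auto. exfalso. apply Hn.
          exists e. apply in_adj. rewrite <- Y. cbn; auto. }
      assert (E6 : ivar s2 6 = length Hd) by (unfold s2; look; auto).
      assert (E5 : ia m s2 5 = ia m s1 5) by (unfold s2; look; auto).
      assert (E29 : ivar s2 29 = hdf k) by (unfold s2; look; auto).
      assert (E1' : ia m s2 1 = hin) by (unfold s2; look; auto).
      assert (Em : ivar s2 1 = m) by (unfold s2; look; auto).
      step.
      - assert (Hn : ~ In (hdf k) Hd) by (now apply Hh0).
        step. step. step. split; [lia|]. exists (Hd ++ [hdf k]).
        splits; look; auto.
        + rewrite length_app. auto.
        + intros i Hi. rewrite length_app in Hi. cbn in Hi.
          destruct (Nat.eq_dec i (length Hd)) as [->|].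
          * rewrite aset_eq, app_nth2, Nat.sub_diag by lia. reflexivity.
          * rewrite aset_neq by auto. rewrite app_nth1 by lia. apply A2. lia.
        + apply NoDup_app; auto.
          * constructor; [auto | constructor].
          * intros x Hx [<-|[]]. auto.
        + rewrite length_app. cbn. lia.
        + intros v. rewrite in_app_iff. cbn. intuition.
        + apply raw_keep_ivar, raw_keep_ia. auto.
      - step. split; [lia|]. exists Hd.
        assert (Hi : In (hdf k) Hd).
        { destruct (in_dec Nat.eq_dec (hdf k) Hd); auto. exfalso. tauto. }
        splits; look; auto; try lia. intros v. split; auto. intros [->|]; auto. }
    intros s3 F3 (Hd' & H6 & H5 & Hnd' & Hl' & Hin' & Hrk3).
    assert (E18' : ivar s3 18 = k) by (unfold s2 in *; look; auto).
    assert (E29 : ivar s3 29 = hdf k) by (unfold s2 in *; look; auto).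
    assert (E20 : ivar s3 20 = tlf k) by (unfold s2 in *; look; auto).
    assert (E1' : ia m s3 1 = hin) by (unfold s2 in *; look; auto).
    assert (E3' : ia m s3 3 = hout) by (unfold s2 in *; look; auto).
    assert (E2' : ia m s3 2 = ia m s1 2) by (unfold s2 in *; look; auto).
    assert (E4' : ia m s3 4 = ia m s1 4) by (unfold s2 in *; look; auto).
    assert (E15' : ia m s3 15 = aset (ia m s1 15) k (tlf k)) by (unfold s2 in *; look; auto).
    assert (E16' : ia m s3 16 = aset (ia m s1 16) k (hdf k)) by (unfold s2 in *; look; auto).
    assert (E2r : ra m s3 2 = aset (ra m s1 2) k (weight (nth k sh edge0)))
      by (unfold s2 in *; look; auto).
    assert (E0' : ia m s3 0 = aset (ia m s1 0) (tlf k * n + hdf k) (k + 1))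
      by (unfold s2 in *; look; auto).
    assert (Em3 : ivar s3 1 = m) by (unfold s2 in *; look; auto).
    clear F3. clearbody s2.
    step. step. step. step. step. step. step. step. step.
    exists (250 * (m - (k + 1)) + 10). split; [cost|].
    exists (k + 1), Hd'. splits; look; auto; try lia.
    * constructor; look; auto.
      -- intros v. rewrite Hin', A5. split.
         ++ intros [->|(e & He & Ee)]; [exists k; split; auto; lia | exists e; split; auto; lia].
         ++ intros (e & He & Ee). destruct (Nat.eq_dec e k) as [->|]; [auto|].
            right. exists e. split; auto. lia.
      -- intros e He. destruct (Nat.eq_dec e k) as [->|]; [now rewrite aset_eq|].
         rewrite aset_neq by auto. apply A6. lia.
      -- intros e He. destruct (Nat.eq_dec e k) as [->|]; [now rewrite aset_eq|].
         rewrite aset_neq by auto. apply A7. lia.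
      -- intros e He. destruct (Nat.eq_dec e k) as [->|]; [now rewrite aset_eq|].
         rewrite aset_neq by auto. apply A8. lia.
      -- intros e He. destruct (Nat.eq_dec e k) as [->|]; [now rewrite aset_eq|].
         rewrite aset_neq. { apply A9. lia. }
         (* Division with remainder by n recovers both ends from the cell number, and distinct edges
            have distinct pairs of ends. *)
         intros E. assert (He' : e < m) by lia. pose proof (Htl e He'). pose proof (Hhd e He').
         apply n0. apply Hnd; auto.
         ++ apply (f_equal (fun t => t / n)) in E. rewrite !Nat.div_add_l in E by lia.
            rewrite !Nat.div_small in E by lia. lia.
         ++ apply (f_equal (fun t => t mod n)) in E. rewrite !(Nat.add_comm (_ * n)) in E.
            rewrite !Nat.Div0.mod_add, !Nat.mod_small in E by lia. auto.
      -- intros v. replace (adj hdf (k + 1) v) with (adj hdf (S k) v) by (now rewrite Nat.add_1_r).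
         apply chain_push; auto.
      -- intros v. replace (adj tlf (k + 1) v) with (adj tlf (S k) v) by (now rewrite Nat.add_1_r).
         apply chain_push; auto.
    * repeat (first [apply raw_keep_ivar | apply raw_keep_ia]). auto.
  + intros C. split; [cost|]. exists Hd. replace k with m in * by lia. constructor; auto.
- intros s' _ H. split; [lia | exact H].
Qed.
End Edges.
Lemma setup_cur_ok w m n sc Lim s :
  6 <= w -> 32 * (m + Lim + 2) < 2 ^ w -> n <= Lim ->
  ivar s 0 = n -> ivar s 1 = m -> ivar s 5 = sc -> (forall v, ia m s 6 v <= sc) ->
  tri w setup_cur s (40 * n + 20) (fun s' => (forall v, ia m s' 6 v <= sc) /\
    forall v, v < n -> ia m s' 6 v = sc).
Proof.
intros w6 Hw Ln E0 E1 E5 Hz.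
unfold setup_cur, tri. step. step.
eapply (wp_call w m); [exact w6 | eapply (tri_while w m) with (T0 := 40 * n + 10)
  (P := fun s' => (forall v, ia m s' 6 v <= sc) /\ forall v, v < n -> ia m s' 6 v = sc)
  (I := fun T s' => exists k, k <= n /\ ivar s' 18 = k /\ (forall v, ia m s' 6 v <= sc) /\
     (forall v, v < k -> ia m s' 6 v = sc) /\ 40 * (n - k) + 10 <= T)|].
- exact w6.
- exists 0. splits; look; auto; lia.
- intros T s1 F1 (k & Hk & E18 & H1 & H2 & HT). eexists. split; [ev|]. split.
  + intros Hlt. step. step. step. exists (40 * (n - (k + 1)) + 10). split; [cost|].
    exists (k + 1). splits; look; auto; try lia.
    * intros v. destruct (Nat.eq_dec v k) as [->|]; [now rewrite aset_eq|].
      rewrite aset_neq by auto. auto.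
    * intros v Hv. destruct (Nat.eq_dec v k) as [->|]; [now rewrite aset_eq|].
      rewrite aset_neq by auto. apply H2. lia.
  + intros C. split; [cost|]. split; auto. intros v Hv. apply H2. lia.
- intros s' _ H. split; [lia | exact H].
Qed.

(** The lists of distinct vertices are disjoint, so together they contain each edge at most once. *)
Lemma adj_total f k Hd : NoDup Hd -> list_sum (map (fun v => length (adj f k v)) Hd) <= k.
Proof.
intros Hn. unfold list_sum. induction k as [|k IH].
- clear. induction Hd as [|v l IH]; cbn [map fold_right]; auto.
- assert (G : forall l, NoDup l ->
    fold_right Nat.add 0 (map (fun v => length (adj f (S k) v)) l) <=
    (if in_dec Nat.eq_dec (f k) l then 1 else 0) +
    fold_right Nat.add 0 (map (fun v => length (adj f k v)) l)).
  { induction 1 as [|v l Hv Hl IHl]; cbn [map fold_right]; [lia|]. rewrite adj_S.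
    destruct (Nat.eqb_spec (f k) v) as [E|E]; cbn [length].
    - destruct (in_dec Nat.eq_dec (f k) l); [congruence|].
      destruct (in_dec Nat.eq_dec (f k) (v :: l)) as [|C]; [lia|]. exfalso. apply C. cbn; auto.
    - destruct (in_dec Nat.eq_dec (f k) l).
      + destruct (in_dec Nat.eq_dec (f k) (v :: l)) as [|C]; [lia|]. exfalso. apply C. cbn; auto.
      + destruct (in_dec Nat.eq_dec (f k) (v :: l)); lia. }
  specialize (G Hd Hn). destruct (in_dec Nat.eq_dec (f k) Hd); lia.
Qed.

Lemma GC_le LG f g m Hd :
  NoDup Hd -> length Hd <= m -> 1 <= LG ->
  GC LG (adj f m) (adj g m) Hd <= 4810 * LG * m.
Proof.
intros Hn Hl HLG.
assert (E : forall l, GC LG (adj f m) (adj g m) l =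
  1600 * LG * (length l + list_sum (map (fun v => length (adj f m v)) l) +
     list_sum (map (fun v => length (adj g m v)) l)) + 10 * length l).
{ unfold GC, gcost, list_sum. induction l as [|v l IH]; cbn [map fold_right length]; [lia|].
  rewrite IH. lia. }
rewrite E. pose proof (adj_total f m Hd Hn). pose proof (adj_total g m Hd Hn).
assert (1600 * LG * (length Hd + list_sum (map (fun v => length (adj f m v)) Hd) +
     list_sum (map (fun v => length (adj g m v)) Hd)) <= 1600 * LG * (3 * m))
  by (apply Nat.mul_le_mono_l; lia).
nia.
Qed.

Lemma mul_ge_l a b : 1 <= b -> a <= a * b.
Proof. intros H. rewrite <- (Nat.mul_1_r a) at 1. now apply Nat.mul_le_mono_l. Qed.

(** Every summand is absorbed by the product [X], all of whose factors are at least 1 because of the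
    shifts by 1 and 2. *)
Lemma preprocess_cost n m K N LG sc gc h :
  1 <= LG -> 2 <= sc <= N + 2 -> gc <= 4810 * LG * m -> h <= m ->
  250 * m + 30 * K + 60 * N + 40 * n + 400 +
  n * ((K + 1) * (sc * gc + 60 * h + 110) + 150 * (sc * m) + 100 * h + 200 + 20)
  <= 70 * 100 * ((n + 1) * (m + 1) * (K + 1) * (N + 2) * LG).
Proof.
intros HLG Hsc Hgc Hh.
set (X := (m + 1) * (K + 1) * (N + 2) * LG).
assert (A : sc * gc <= (N + 2) * (4810 * LG * m)) by (apply Nat.mul_le_mono; lia).
assert (A' : (K + 1) * (sc * gc) <= (K + 1) * ((N + 2) * (4810 * LG * m)))
  by (apply Nat.mul_le_mono_l; exact A).
assert (A2 : forall c, (K + 1) * ((N + 2) * (c * LG * m)) + c * ((K + 1) * (N + 2) * LG) = c * X)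
  by (intros c; unfold X; ring).
specialize (A2 4810).
assert (HNL : 1 <= (N + 2) * LG) by (apply (Nat.mul_le_mono 1 (N + 2) 1 LG); lia).
assert (B : (K + 1) * (m + 1) <= X).
{ replace X with ((K + 1) * (m + 1) * ((N + 2) * LG)) by (unfold X; ring). now apply mul_ge_l. }
assert (B' : (K + 1) * (60 * h + 110) <= (K + 1) * (110 * (m + 1)))
  by (apply Nat.mul_le_mono_l; lia).
assert (HKL : 1 <= (K + 1) * LG) by (apply (Nat.mul_le_mono 1 (K + 1) 1 LG); lia).
assert (C : (N + 2) * (m + 1) <= X).
{ replace X with ((N + 2) * (m + 1) * ((K + 1) * LG)) by (unfold X; ring). now apply mul_ge_l. }
assert (C' : sc * m <= (N + 2) * (m + 1)) by (apply Nat.mul_le_mono; lia).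
assert (D1 : m + 1 <= (N + 2) * (m + 1)) by (rewrite Nat.mul_comm; apply mul_ge_l; lia).
assert (D2 : N + 2 <= (N + 2) * (m + 1)) by (apply mul_ge_l; lia).
assert (D3 : K + 1 <= (K + 1) * (m + 1)) by (apply mul_ge_l; lia).
assert (E : (K + 1) * (sc * gc + 60 * h + 110) + 150 * (sc * m) + 100 * h + 200 + 20 <= 60 * 100 * X).
{ rewrite <- (Nat.add_assoc (sc * gc)), Nat.mul_add_distr_l. lia. }
apply (Nat.mul_le_mono_l _ _ n) in E.
rewrite (Nat.mul_shuffle3 n (60 * 100) X) in E.
replace ((n + 1) * (m + 1) * (K + 1) * (N + 2) * LG) with (n * X + X) by (unfold X; ring).
assert (n <= n * X) by (apply mul_ge_l; lia).
lia.
Qed.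

(** * Geometric scales and the state after preprocessing *)

Definition geometric (sc : nat) (q : R) (pw : nat -> R) : Prop :=
  pw 0 = 0%R /\ forall i, 1 <= i <= sc -> pw i = (q ^ (i - 1))%R.

Section GeometricFacts.
Variables (sc : nat) (q : R) (pw : nat -> R).
Hypothesis q1 : (1 < q)%R.
Hypothesis Hg : geometric sc q pw.

Lemma geometric_lt i j : i < j <= sc -> (pw i < pw j)%R.
Proof.
intros H. destruct Hg as [H0 H1]. rewrite (H1 j) by lia.
destruct i as [|i]; [rewrite H0; apply pow_lt; lra|].
rewrite H1 by lia. apply Rlt_pow; auto. lia.
Qed.

Lemma geometric_le i j : i <= j <= sc -> (pw i <= pw j)%R.
Proof.
intros H. destruct (Nat.eq_dec i j) as [->|]; [lra|]. left. apply geometric_lt. lia.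
Qed.

Lemma geometric_succ i : 1 <= i < sc -> pw (S i) = (q * pw i)%R.
Proof.
intros H. destruct Hg as [_ H1]. rewrite !H1 by lia.
replace (S i - 1) with (S (i - 1)) by lia. reflexivity.
Qed.
End GeometricFacts.

(** All that the online phase reads of the preprocessing, except for the prefix, the window and the
    marks. Updates and queries write none of these cells, so the record is carried along by
    frames. *)
Record tables (n sc K : nat) (q : R) (pw : nat -> R) (sh : list edge) (s : state) : Prop := Tables {
  tb_n : ivar s 0 = n;
  tb_m : ivar s 1 = length sh;
  tb_sc : ivar s 5 = sc;
  tb_et : forall e, e < length sh -> ia (length sh) s 15 e = tail (nth e sh edge0);
  tb_eh : forall e, e < length sh -> ia (length sh) s 16 e = head (nth e sh edge0);
  tb_ew : forall e, e < length sh -> ra (length sh) s 2 e = weight (nth e sh edge0);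
  tb_pos : forall e, e < length sh ->
    ia (length sh) s 0 (tail (nth e sh edge0) * n + head (nth e sh edge0)) = e + 1;
  tb_pw : ra (length sh) s 0 = pw;
  tb_T : forall src, src < n ->
    oracle_for n sc pw (2 ^ K) src q (reach sh src) K (ia (length sh) s 13) }.

Section Preprocess.
Variables (w n c0 N : nat) (W eps : R) (sh : list edge).
Let m := length sh.
Let K := Kof m.
Let q : R := (1 + eps / INR (c0 * (K + 1)))%R.
(** A bound for all array indices: the first summand is for the table of n n sc cells, the second
    for the queue of one source, with sc <= N + 2 and K <= m + 1. *)
Let Lim := (n + 1) * (n + 1) * (N + 2) + (m + 6) * ((N + 2) * (m + 1)) + 2 * n + 2 * m + 2 * N + 10.
Let LG := Nat.log2 (2 * n) + Nat.log2 (2 * (N + 2)) + 1.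
Hypothesis w6 : 6 <= w.
Hypothesis Hw : 32 * (m + Lim + 2) < 2 ^ w.
Hypothesis Hc0 : 1 <= c0.
Hypothesis Hc0w : c0 * (m + 2) < 2 ^ w.
Hypothesis Heps : (0 < eps)%R.
Hypothesis HqN : (INR n * W * (1 + eps) <= q ^ N)%R.
Hypothesis Hsh : edge_sequence n W sh.

Lemma edge_nth e : e < m -> tail (nth e sh edge0) < n /\ head (nth e sh edge0) < n /\
  (1 <= weight (nth e sh edge0) <= W)%R.
Proof. intros He. apply Hsh. now apply nth_In. Qed.

Lemma ends_inj e e' : e < m -> e' < m ->
  tail (nth e sh edge0) = tail (nth e' sh edge0) ->
  head (nth e sh edge0) = head (nth e' sh edge0) -> e = e'.
Proof.
intros He He' E1 E2. destruct Hsh as [Hn _].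
apply (proj1 (NoDup_nth (map ends sh) (ends edge0)) Hn); try (rewrite length_map; auto).
rewrite !map_nth. unfold ends. congruence.
Qed.

Lemma preprocess_ok :
  tri w (preprocess c0) (input n W eps sh)
    (70 * 100 * ((n + 1) * (m + 1) * (K + 1) * (N + 2) * LG))
    (fun s' => exists sc pw, 2 <= sc <= N + 2 /\ geometric sc q pw /\
       (INR n * W * (1 + eps) <= pw (sc - 1)%nat)%R /\ tables n sc K q pw sh s' /\
       (forall i, ia m s' 14 i = 0) /\ ivar s' 9 = 0 /\ ivar s' 10 = 0).
Proof.
set (s := input n W eps sh).
assert (I0 : ivar s 0 = n) by reflexivity.
assert (I1 : ivar s 1 = m) by reflexivity.
assert (Iz : forall j i, ia m s j i = 0).
{ intros j i. unfold ia, s, input. cbn [imem]. apply nth_overflow.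
  rewrite flat_map_length_2. fold m. lia. }
assert (Rz : forall j i, ra m s j i = 0%R).
{ intros j i. unfold ra, s, input. cbn [rmem]. apply nth_overflow.
  rewrite length_map. fold m. lia. }
destruct (Kof_spec m) as (HK1 & HK2 & _). fold K in HK1, HK2.
assert (HcK : c0 * (K + 1) <= c0 * (m + 2)) by (apply Nat.mul_le_mono_l; lia).
assert (Hqpos : (0 < INR (c0 * (K + 1)))%R) by (apply lt_0_INR; nia).
assert (q1 : (1 < q)%R).
{ unfold q. assert (0 < eps / INR (c0 * (K + 1)))%R by (now apply Rdiv_lt_0_compat). lra. }
assert (LG1 : 1 <= LG) by (unfold LG; lia).
assert (L1 : m + N + 4 <= m + Lim + 2) by (unfold Lim; lia).
assert (c0 <= c0 * (m + 2)) by nia.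
assert (Lnn : n * n <= (n + 1) * (n + 1) * (N + 2)) by nia.
assert (Hnn : n * n <= Lim) by (unfold Lim; lia).
unfold preprocess, tri. step.
eapply (wp_call w m); [exact w6 | apply (setup_edges_ok w n Lim sh); auto | ].
{ unfold Lim; lia. }
{ unfold Lim; fold m; lia. }
{ intros e He. now apply edge_nth. }
{ intros e He. now apply edge_nth. }
{ intros e e' He He' A B. now apply ends_inj. }
intros s1 F1 (Hd & Hed). fold m in Hed.
step. eapply (wp_call w m); [exact w6 | apply (setup_time_ok w m s1); [auto | look; auto | unfold Lim in *; lia] |].
fold K. intros s2 F2 (E7 & E8).
step. eapply (wp_call w m); [exact w6 | eapply (setup_scales_ok w m c0 s2 n K N W eps q);
  look; auto; try reflexivity; try lia |].
intros s3 F3 (sc & E5 & Hsc & P0 & Pi & HM).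
remember (ra m s3 0) as pw eqn:Epw. symmetry in Epw.
assert (Hgeo : geometric sc q pw) by (split; auto).
step. eapply (wp_call w m); [exact w6 | eapply (setup_cur_ok w m n sc Lim s3); look; auto |].
{ unfold Lim; lia. }
{ intros v. rewrite Iz. lia. }
intros s4 F4 (Hc1 & Hc2).
destruct Hed as [A1 A2 A3 A4 A5 A6 A7 A8 A9 A10 A11].
fold m in A2, A6, A7, A8, A9, A10, A11.
set (inl := adj (fun e => head (nth e sh edge0)) m) in *.
set (outl := adj (fun e => tail (nth e sh edge0)) m) in *.
set (et := ia m s1 15) in *. set (eh := ia m s1 16) in *. set (ew := ra m s1 2) in *.
set (hin := ia m s1 1) in *. set (nin := ia m s1 2) in *.
set (hout := ia m s1 3) in *. set (nout := ia m s1 4) in *.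
set (CS := (K + 1) * (sc * GC LG inl outl Hd + 60 * length Hd + 110) + 150 * (sc * m) +
      100 * length Hd + 200).
assert (Et : forall e, e < m -> et e < n) by (intros e He; rewrite A6 by auto; now apply edge_nth).
assert (Eh : forall e, e < m -> eh e < n) by (intros e He; rewrite A7 by auto; now apply edge_nth).
unfold sources. step. step.
eapply (wp_call w m); [exact w6 | eapply (tri_while w m) with (T0 := n * (CS + 20) + 10)
  (P := fun s' => forall src, src < n ->
      oracle_for n sc pw (2 ^ K) src q (reach sh src) K (ia m s' 13))
  (I := fun T s' => exists k, k <= n /\ ivar s' 11 = k /\ idle0 m n sc Hd s' /\
     (forall src, src < k -> oracle_for n sc pw (2 ^ K) src q (reach sh src) K (ia m s' 13)) /\
     (forall src v x, k <= src -> src < n -> v < n -> x < sc -> ia m s' 13 (ix n sc src v x) = 0) /\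
     (n - k) * (CS + 20) + 10 <= T)|].
- exact w6.
- exists 0. splits; look; auto; try lia.
  + unfold idle0. splits; look; auto.
    * intros y Hy. apply Iz.
    * intros y. rewrite Iz. lia.
- intros T s5 F5 (k & Hk & E11 & Hid & Hor & Hfr & HT).
  eexists. split; [ev|]. split.
  + intros Hlt. assert (Hkn : k < n) by lia. step.
    eapply (wp_call w m); [exact w6 | eapply (source_ok w m n sc LG Lim et eh ew pw hin nin hout nout
      inl outl) with (F := 2 ^ K) (src := k) (q := q) (Hd := Hd) (reach := reach sh k) (K := K);
      look; auto; try (unfold Lim; fold m; lia) |].
    all: try (unfold Lim in *; lia).
    { unfold LG. assert (Nat.log2 (2 * sc) <= Nat.log2 (2 * (N + 2))) by (apply Nat.log2_le_mono; lia).
      lia. }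
    { intros i j. now apply geometric_le with (q := q). }
    { intros v e Hv. unfold inl. rewrite in_adj. split; intros [B1 B2]; split; auto.
      - rewrite A7; auto. - rewrite <- A7; auto. }
    { intros v e Hv. unfold outl. rewrite in_adj. split; intros [B1 B2]; split; auto.
      - rewrite A6; auto. - rewrite <- A6; auto. }
    { intros e He. rewrite A8 by auto. now apply edge_nth. }
    { lra. }
    { apply Pi. lia. }
    { intros i Hi. apply (geometric_succ sc q pw); auto. }
    { intros i Hi. apply (geometric_lt sc q pw); auto. }
    { intros v Hv. apply A5 in Hv. destruct Hv as (e & He & <-). now apply edge_nth. }
    { intros e He. rewrite A7 by auto. apply A5. eauto. }
    { intros. eapply reach_mono; eauto. }
    { intros. apply reach_src. }
    { intros t e x He Ht Hr. eapply reach_step; eauto. }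
    { intros t P HP0 HPs. eapply reach_ind; eauto. }
    { assert (n * n * sc <= (n + 1) * (n + 1) * (N + 2)) by (apply Nat.mul_le_mono; nia).
      unfold Lim; lia. }
    { assert ((K + 5) * (sc * m) <= (m + 6) * ((N + 2) * (m + 1)))
        by (apply Nat.mul_le_mono; [lia | apply Nat.mul_le_mono; lia]).
      unfold Lim; lia. }
    { constructor; look; auto. }
    { split; look; auto. }
    intros s6 F6 (Hid6 & Hor6 & Hoth6). step.
    exists ((n - (k + 1)) * (CS + 20) + 10). split.
    { replace (n - k) with (S (n - (k + 1))) in HT by lia. cbn [Nat.mul] in HT.
      unfold CS in *. cost. }
    assert (Hsame : forall src v x, src <> k -> v < n -> x < sc ->
      ia m s6 13 (ix n sc src v x) = ia m s5 13 (ix n sc src v x)).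
    { intros src v x Hs Hv Hx. apply Hoth6. intros v' x' Hv' Hx' E.
      eapply ix_inj in E; eauto; try lia. }
    exists (k + 1). splits; look; auto; try lia.
    * intros src Hs. destruct (Nat.eq_dec src k) as [->|]; auto.
      intros p v Hp Hv Hvs. destruct (Hor src) with (p := p) (v := v) as (d & D1 & D2 & D3 & D4); auto; [lia|].
      exists d. splits; auto. intros x Hx. rewrite Hsame; auto.
    * intros src v x Hs1 Hs2 Hv Hx. rewrite Hsame by (auto; lia). apply Hfr; auto. lia.
  + intros C. split; [cost|]. intros src Hs. apply Hor. lia.
- intros s5 F5 Hor. fold m. split.
  { assert (HGC : GC LG inl outl Hd <= 4810 * LG * m) by (apply GC_le; auto).
    pose proof (preprocess_cost n m K N LG sc (GC LG inl outl Hd) (length Hd) LG1 Hsc HGC A4).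
    unfold CS. lia. }
  exists sc, pw. splits; auto; try lia.
  + rewrite Pi by lia. replace (sc - 1 - 1) with (sc - 2) by lia. auto.
  + constructor; fold m; look; auto.
  + intros i. look. apply Iz.
  + look. reflexivity.
  + look. reflexivity.
Qed.
End Preprocess.

(** * Updates and queries *)

Definition update : com := seqs [
  ISet 18 (ISub (Ld 0 (IAdd (IMul (IVar 2) (IVar 0)) (IVar 3))) (IConst 1));
  St 14 (IVar 18) (IConst 1);
  If (BILe (IVar 10) (IVar 18)) (ISet 10 (IAdd (IVar 18) (IConst 1))) Skip;
  If (BIEq (Ld 14 (IVar 9)) (IConst 1)) (ISet 9 (IAdd (IVar 9) (IConst 1))) Skip].

Definition cell : iexp :=
  Ld 13 (IAdd (IMul (IAdd (IMul (IVar 21) (IVar 0)) (IVar 22)) (IVar 5)) (IVar 27)).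

(** Searches for the first scale reached by time p. For equal vertices the search interval is empty,
    which yields scale 0 of value 0; the table has no meaningful row in that case. *)
Definition oracle : com := seqs [
  ISet 25 (IConst 0);
  If (BIEq (IVar 21) (IVar 22)) (ISet 26 (IConst 0)) (ISet 26 (IVar 5));
  bsearch (BAnd (BILe (IConst 1) cell) (BILe cell (IVar 9)))].

Definition addnode (t h : iexp) (x v : rexp) : com := seqs [
  St 17 (IVar 13) t; St 18 (IVar 13) h; RSt 3 (IVar 13) x; RSt 4 (IVar 13) v;
  St 19 (IVar 13) (IConst 0); ISet 13 (IAdd (IVar 13) (IConst 1))].

Definition rzero : rexp := ROfInt (IConst 0).

(** The nodes are edges rather than vertices: going from node a to node b means following the table
    from the head of a to the tail of b and then the edge b. Initial values are 0 for the start and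
    the value of the infinite scale for all others. *)
Definition collect : com := seqs [
  ISet 13 (IConst 0);
  addnode (IVar 2) (IVar 2) rzero rzero;
  ISet 18 (IVar 9);
  While (BNot (BILe (IVar 10) (IVar 18))) (seqs [
    If (BIEq (Ld 14 (IVar 18)) (IConst 1))
      (addnode (Ld 15 (IVar 18)) (Ld 16 (IVar 18)) (RLd 2 (IVar 18)) (RLd 0 (IVar 5))) Skip;
    ISet 18 (IAdd (IVar 18) (IConst 1))]);
  addnode (IVar 3) (IVar 3) rzero (RLd 0 (IVar 5))].

Definition findmin : com := seqs [
  ISet 20 (IConst 0); ISet 18 (IConst 0);
  While (BNot (BILe (IVar 13) (IVar 18))) (seqs [
    If (BAnd (BIEq (Ld 19 (IVar 18)) (IConst 0))
         (BNot (BAnd (BNot (BIEq (IVar 20) (IConst 0)))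
            (BRLe (RLd 4 (ISub (IVar 20) (IConst 1))) (RLd 4 (IVar 18))))))
      (ISet 20 (IAdd (IVar 18) (IConst 1))) Skip;
    ISet 18 (IAdd (IVar 18) (IConst 1))])].

Definition relax : com := seqs [
  ISet 18 (IConst 0);
  While (BNot (BILe (IVar 13) (IVar 18))) (seqs [
    ISet 21 (Ld 18 (IVar 29)); ISet 22 (Ld 17 (IVar 18));
    oracle;
    RSet 6 (RAdd (RAdd (RLd 4 (IVar 29)) (RLd 0 (IVar 25))) (RLd 3 (IVar 18)));
    If (BRLe (RLd 4 (IVar 18)) (RVar 6)) Skip (RSt 4 (IVar 18) (RVar 6));
    ISet 18 (IAdd (IVar 18) (IConst 1))])].

(* Dijkstra's algorithm on the edges outside of the prefix, framed by the artificial loops of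
   weight 0 at the two vertices of the query. *)
Definition dense : com := seqs [
  ISet 12 (IConst 0);
  While (BNot (BILe (IVar 13) (IVar 12))) (seqs [
    findmin;
    ISet 29 (ISub (IVar 20) (IConst 1));
    St 19 (IVar 29) (IConst 1);
    relax;
    ISet 12 (IAdd (IVar 12) (IConst 1))])].

Definition query : com := seqs [
  collect; dense;
  RSet 3 (RLd 4 (ISub (IVar 13) (IConst 1)));
  If (BRLe (RLd 0 (IVar 5)) (RVar 3)) (ISet 4 (IConst 0)) (ISet 4 (IConst 1))].

(** * Distances as infima, and the nodes of a query *)

Lemma dist_le G i j y : path G i j y -> Rbar_le (dist G i j) (Finite y).
Proof. intros H. unfold dist. destruct (Glb_Rbar_correct (path G i j)) as [A _]. now apply A. Qed.

Lemma dist_none G i j : (forall y, ~ path G i j y) -> dist G i j = p_infty.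
Proof.
intros H. apply is_glb_Rbar_unique. split.
- intros y Hy. now apply H in Hy.
- intros b _. now destruct b.
Qed.

(** The bound x / c on every length passes to the infimum. The path of length [y0] excludes an
    infinite distance. *)
Lemma dist_factor G i j c x y0 :
  (0 < c)%R -> (forall e, In e G -> (0 <= weight e)%R) -> path G i j y0 ->
  (forall y, path G i j y -> (x <= c * y)%R) ->
  Rbar_le (Finite x) (Rbar_mult (Finite c) (dist G i j)).
Proof.
intros Hc HG H0 H. pose proof (dist_le G i j y0 H0) as Hle.
unfold dist in *. destruct (Glb_Rbar_correct (path G i j)) as [_ A].
assert (B : Rbar_le (Finite (x / c)) (Glb_Rbar (path G i j))).
{ apply A. intros y Hy. cbn. apply Rmult_le_reg_l with c; auto.
  replace (c * (x / c))%R with x by (field; lra). auto. }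
destruct (Glb_Rbar (path G i j)) as [d| |]; cbn in Hle, B; try easy.
cbn. apply Rmult_le_compat_l with (r := c) in B; [|lra].
replace (c * (x / c))%R with x in B by (field; lra). exact B.
Qed.

Definition nodes_at (Big : R) (xt xh : nat -> nat) (xw val : nat -> R) (dn : nat -> nat)
    (ns : list edge) : Prop :=
  forall a, a < length ns -> xt a = tail (nth a ns edge0) /\ xh a = head (nth a ns edge0) /\
    xw a = weight (nth a ns edge0) /\ val a = (if a =? 0 then 0%R else Big) /\ dn a = 0.

Lemma nodes_snoc Big xt xh xw val dn ns k e v :
  nodes_at Big xt xh xw val dn ns -> k = length ns -> v = (if k =? 0 then 0%R else Big) ->
  nodes_at Big (aset xt k (tail e)) (aset xh k (head e)) (aset xw k (weight e)) (aset val k v)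
    (aset dn k 0) (ns ++ [e]).
Proof.
intros H -> -> a Ha. rewrite length_app in Ha. cbn in Ha.
destruct (Nat.eq_dec a (length ns)) as [->|Hne].
- rewrite !aset_eq, app_nth2, Nat.sub_diag by lia. cbn. auto.
- rewrite !aset_neq by auto. rewrite app_nth1 by lia. apply H. lia.
Qed.

(** * Correctness and cost of one update and one query *)

Section Serve.
Variables (w n sc K Lim LS : nat) (q : R) (pw : nat -> R) (sh : list edge).
Let m := length sh.
Hypothesis w6 : 6 <= w.
Hypothesis Hw : 32 * (m + Lim + 2) < 2 ^ w.
Hypothesis Lnns : n * n * sc <= Lim.
Hypothesis Lnn : n * n <= Lim.
Hypothesis Ln : n <= Lim.
Hypothesis Lm : 2 * m + 4 <= Lim.
Hypothesis Lsc : 2 * sc <= Lim.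
Hypothesis HLS : Nat.log2 (2 * sc) <= LS.
Hypothesis LS1 : 1 <= LS.
Hypothesis sc2 : 2 <= sc.
Hypothesis q1 : (1 < q)%R.
Hypothesis Hgeo : geometric sc q pw.
Hypothesis HmK : m < 2 ^ K.
Hypothesis Hsh : forall e, In e sh -> tail e < n /\ head e < n /\ (1 <= weight e)%R.

(** The guarantee of a lookup for the graph of the first p predicted edges, including the case of
    equal vertices. *)
Definition est (p u v d : nat) : Prop :=
  d <= sc /\ (d < sc -> exists x, path (firstn p sh) u v x /\ (x <= pw d)%R) /\
  (forall x, path (firstn p sh) u v x -> (pw d <= q ^ K * x)%R).

Lemma oracle_ok s p u v :
  tables n sc K q pw sh s -> ivar s 9 = p -> p <= m -> ivar s 21 = u -> ivar s 22 = v ->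
  u < n -> v < n ->
  tri w oracle s (80 * LS + 60) (fun s' => exists d, ivar s' 25 = d /\ est p u v d).
Proof.
intros [Tn Tm Tsc Tet Teh Tew Tpos Tpw TT] E9 Hp E21 E22 Hu Hv.
fold m in Tm, Tet, Teh, Tew, Tpos, Tpw, TT.
assert (A1 : u * n + v < n * n) by nia.
assert (A2 : (u * n + v) * sc + sc <= n * n * sc) by nia.
assert (A3 : u * n <= n * n) by nia.
unfold oracle, tri. step. step. step.
set (hi := if u =? v then 0 else sc).
join m 20 (fun s' => ivar s' 26 = hi).
{ unfold hi. step; step; (split; [lia|]); look; destruct (Nat.eqb_spec u v); congruence. }
intros s1 F1 E26.
assert (Hhi : hi <= sc) by (unfold hi; destruct (u =? v); lia).
eapply (wp_call w m); [exact w6 | eapply bsearch_ok with (m := m) (lo := 0) (hi := hi)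
  (P := fun x => 1 <= ia m s 13 (ix n sc u v x) /\ ia m s 13 (ix n sc u v x) <= p);
  look; auto; try lia |].
{ intros s' x Fx Ex Hx. assert ((u * n + v) * sc + x < n * n * sc) by lia.
  unfold ix, cell. ev. }
intros s2 F2 (r & E25 & Hr & Hr1 & Hr2). split.
{ rewrite Nat.sub_0_r.
  match goal with |- context [bcost ?b] =>
    let c := eval vm_compute in (bcost b) in change (bcost b) with c end.
  assert (Nat.log2 (2 * hi) <= LS).
  { eapply Nat.le_trans; [|exact HLS]. apply Nat.log2_le_mono. lia. }
  lia. }
exists r. split; auto. unfold hi in *. destruct (Nat.eqb_spec u v) as [->|Huv].
- replace r with 0 by lia. destruct Hgeo as [G0 _]. split; [lia|]. split.
    * intros _. exists 0%R. rewrite G0. split; [constructor | lra].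
    * intros x Hx. rewrite G0.
      assert (0 <= x)%R.
      { eapply path_ge0; [|exact Hx]. intros e He.
        assert (In e sh) by (rewrite <- (firstn_skipn p sh); apply in_app_iff; auto).
        destruct (Hsh e) as (_ & _ & C); auto. lra. }
      assert (0 < q ^ K)%R by (apply pow_lt; lra). nra.
- destruct (TT u Hu p v) as (d & D1 & D2 & D3 & D4); auto; [lia|].
  assert (r = d) as ->.
  { assert (B1 : d <= r).
    { destruct Hr1 as [->|Hr1]; [lia|]. destruct (Nat.eq_dec r sc) as [->|]; [lia|].
      apply D2; auto. lia. }
    assert (B2 : r <= d).
    { destruct Hr2 as [->|Hr2]; [lia|]. destruct (le_lt_dec r d); auto. exfalso. apply Hr2.
      apply D2; lia. }
    lia. }
  split; auto.
Qed.
Lemma findmin_ok s kn (ML : list nat) :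
  ivar s 1 = m -> ivar s 13 = kn -> kn <= Lim -> ML <> [] ->
  (forall u, In u ML <-> u < kn /\ ia m s 19 u = 0) ->
  tri w findmin s (100 * kn + 40) (fun s' => exists u, ivar s' 20 = u + 1 /\ In u ML /\
    forall v, In v ML -> (ra m s 4 u <= ra m s 4 v)%R).
Proof.
intros Em E13 Hkn Hne HML.
unfold findmin, tri. step. step. step. step.
eapply (wp_call w m); [exact w6 | eapply (tri_while w m) with (T0 := 100 * kn + 10)
  (P := fun s' => exists u, ivar s' 20 = u + 1 /\ In u ML /\
    forall v, In v ML -> (ra m s 4 u <= ra m s 4 v)%R)
  (I := fun T s' => exists i b, i <= kn /\ ivar s' 18 = i /\ ivar s' 20 = b /\
    (b = 0 -> forall v, In v ML -> i <= v) /\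
    (b <> 0 -> In (b - 1) ML /\ b <= i /\
       forall v, In v ML -> v < i -> (ra m s 4 (b - 1)%nat <= ra m s 4 v)%R) /\
    100 * (kn - i) + 10 <= T)|].
- exact w6.
- exists 0, 0. splits; look; auto; lia.
- intros T s1 F1 (i & b & Hi & E18 & E20 & H0 & H1 & HT).
  assert (Hb : b <= kn) by (destruct (Nat.eq_dec b 0); [lia | destruct (H1 n0); lia]).
  eexists. split; [ev|]. split.
  + intros Hlt. step.
    join m 70 (fun s' => exists b, ivar s' 20 = b /\ ivar s' 18 = i /\
      (b = 0 -> forall v, In v ML -> i + 1 <= v) /\
      (b <> 0 -> In (b - 1) ML /\ b <= i + 1 /\
         forall v, In v ML -> v < i + 1 -> (ra m s 4 (b - 1)%nat <= ra m s 4 v)%R)).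
    { step.
      - destruct H as [Hd Hc]. step. split; [lia|]. exists (i + 1). splits; look; auto; try lia.
        intros _. replace (i + 1 - 1) with i by lia. splits; auto.
        { apply HML. split; auto. lia. }
        intros v Hv Hvi. destruct (Nat.eq_dec v i) as [->|]; [lra|].
        destruct (Nat.eq_dec b 0) as [->|Hb0].
        { specialize (H0 eq_refl v Hv). lia. }
        destruct (H1 Hb0) as (A & B & C). specialize (C v Hv).
        assert (~ (ra m s 4 (b - 1) <= ra m s 4 i)%R) by (intros C'; apply Hc; auto).
        assert (v < i) by lia. specialize (C H2). lra.
      - step. split; [lia|]. exists b. splits; look; auto.
        + intros Hb0 v Hv. specialize (H0 Hb0 v Hv).
          destruct (Nat.eq_dec v i) as [->|]; [|lia]. exfalso. apply H. split.
          * apply HML in Hv. tauto.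
          * intros [C _]. congruence.
        + intros Hb0. destruct (H1 Hb0) as (A & B & C). splits; auto; try lia.
          intros v Hv Hvi. destruct (Nat.eq_dec v i) as [->|]; [|apply C; auto; lia].
          apply NNPP. intros C'. apply H. split; [apply HML in Hv; tauto|]. tauto. }
    intros s2 F2 (b' & G1 & G2 & G3 & G4). step.
    exists (100 * (kn - (i + 1)) + 10). split; [cost|].
    exists (i + 1), b'. splits; look; auto; lia.
  + intros C. split; [cost|]. assert (i = kn) as -> by lia.
    destruct (Nat.eq_dec b 0) as [->|Hb0].
    * exfalso. destruct ML as [|v ML]; [congruence|].
      assert (Hv : In v (v :: ML)) by (cbn; auto). pose proof (H0 eq_refl v Hv).
      apply HML in Hv. lia.
    * destruct (H1 Hb0) as (A & B & D). exists (b - 1). splits; auto; [lia|].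
      intros v Hv. apply D; auto. apply HML in Hv. lia.
- intros s' F' H. split; [lia | exact H].
Qed.

(** [Up a x] expresses that x is a legitimate value of node a. The program proof needs only that
    this is preserved by one hop. *)
Record nodes_ok (p kn : nat) (xt xh : nat -> nat) (xw : nat -> R) (Up : nat -> R -> Prop) : Prop :=
 NodesOk {
  nk_t : forall a, a < kn -> xt a < n;
  nk_h : forall a, a < kn -> xh a < n;
  nk_w : forall a, a < kn -> (0 <= xw a)%R;
  nk_up : forall a b d x, a < kn -> b < kn -> est p (xh a) (xt b) d -> Up a x -> (0 <= x)%R ->
    Up b (x + pw d + xw b)%R }.

Lemma pw_pos d : d <= sc -> (0 <= pw d)%R.
Proof. intros Hd. destruct Hgeo as [G0 _]. rewrite <- G0. apply (geometric_le sc q); auto; lia. Qed.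

Lemma relax_ok s p kn u xt xh xw Up (dn : nat -> Prop) :
  tables n sc K q pw sh s -> ivar s 9 = p -> p <= m -> ivar s 13 = kn -> kn <= Lim ->
  ivar s 29 = u -> u < kn -> ia m s 17 = xt -> ia m s 18 = xh -> ra m s 3 = xw ->
  nodes_ok p kn xt xh xw Up -> dn u ->
  (forall a, a < kn -> (0 <= ra m s 4 a)%R /\ Up a (ra m s 4 a)) ->
  (forall a, a < kn -> dn a -> (ra m s 4 a <= ra m s 4 u)%R) ->
  tri w relax s (kn * (80 * LS + 300) + 40) (fun s' =>
    (forall a, a < kn -> (0 <= ra m s' 4 a)%R /\ Up a (ra m s' 4 a)) /\
    (forall a, a < kn -> (ra m s' 4 a <= ra m s 4 a)%R) /\
    (forall a, a < kn -> dn a -> ra m s' 4 a = ra m s 4 a) /\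
    (forall a, a < kn -> (ra m s' 4 a >= Rmin (ra m s 4 a) (ra m s 4 u))%R) /\
    (forall a, a < kn -> exists d, est p (xh u) (xt a) d /\
       (ra m s' 4 a <= ra m s 4 u + pw d + xw a)%R)).
Proof.
intros Htb E9 Hp E13 Hkn E29 Hu E17 E18 E3 Hnk Hdu Hup Hdn.
pose proof Htb as [Tn Tm Tsc Tet Teh Tew Tpos Tpw TT].
fold m in Tm, Tet, Teh, Tew, Tpos, Tpw, TT. destruct Hnk as [N1 N2 N3 N4].
pose proof (N2 u Hu) as Hxu.
unfold relax, tri. step. step.
eapply (wp_call w m); [exact w6 | eapply (tri_while w m) with (T0 := kn * (80 * LS + 300) + 10)
  (P := fun s' =>
    (forall a, a < kn -> (0 <= ra m s' 4 a)%R /\ Up a (ra m s' 4 a)) /\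
    (forall a, a < kn -> (ra m s' 4 a <= ra m s 4 a)%R) /\
    (forall a, a < kn -> dn a -> ra m s' 4 a = ra m s 4 a) /\
    (forall a, a < kn -> (ra m s' 4 a >= Rmin (ra m s 4 a) (ra m s 4 u))%R) /\
    (forall a, a < kn -> exists d, est p (xh u) (xt a) d /\
       (ra m s' 4 a <= ra m s 4 u + pw d + xw a)%R))
  (I := fun T s' => exists i, i <= kn /\ ivar s' 18 = i /\
    (forall a, a < kn -> (0 <= ra m s' 4 a)%R /\ Up a (ra m s' 4 a)) /\
    (forall a, a < kn -> (ra m s' 4 a <= ra m s 4 a)%R) /\
    (forall a, a < kn -> dn a -> ra m s' 4 a = ra m s 4 a) /\
    (forall a, a < kn -> (ra m s' 4 a >= Rmin (ra m s 4 a) (ra m s 4 u))%R) /\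
    (forall a, a < i -> exists d, est p (xh u) (xt a) d /\
       (ra m s' 4 a <= ra m s 4 u + pw d + xw a)%R) /\
    (kn - i) * (80 * LS + 300) + 10 <= T)|].
- exact w6.
- exists 0. splits; look; auto; try lia.
  + intros a Ha. lra.
  + intros a Ha. apply Rle_ge, Rmin_l.
- intros T s1 F1 (i & Hi & E18' & B1 & B2 & B3 & B4 & B5 & HT).
  eexists. split; [ev|]. split.
  + intros Hlt. assert (Hik : i < kn) by lia. pose proof (N1 i Hik) as Hxi.
    step. step. step. step. step.
    eapply (wp_call w m); [exact w6 | eapply (oracle_ok _ p (xh u) (xt i)); look; auto |].
    { constructor; fold m; look; auto. }
    intros s2 F2 (d & E25 & Hest).
    assert (Hd : d <= sc) by apply Hest.
    pose proof (pw_pos d Hd) as Hpd. pose proof (N3 i Hik) as Hwi.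
    assert (Hu4 : ra m s1 4 u = ra m s 4 u) by (apply B3; auto).
    destruct (B1 u Hu) as [Hu0 HuU]. rewrite Hu4 in Hu0, HuU.
    step. step. rewrite Hu4. step.
    set (cand := (ra m s 4 u + pw d + xw i)%R) in *.
    remember (ra m s1 4) as val1 eqn:Ev1. symmetry in Ev1.
    join m 40 (fun s' => ra m s' 4 = val1 /\ (val1 i <= cand)%R \/
       ra m s' 4 = aset val1 i cand /\ (cand < val1 i)%R).
    { step.
      - step. split; [lia|]. left. split; [look; auto | auto].
      - step. split; [lia|]. right. split; [look; auto | lra]. }
    intros s3 F3 Hv3. step.
    exists ((kn - (i + 1)) * (80 * LS + 300) + 10). split.
    { replace (kn - i) with (S (kn - (i + 1))) in HT by lia. cbn [Nat.mul] in HT. cost. }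
    exists (i + 1). look.
    assert (Hval : forall a, a < kn -> (ra m s3 4 a = val1 a /\ (a = i -> val1 i <= cand)%R) \/
       (a = i /\ ra m s3 4 i = cand /\ (cand < val1 i)%R)).
    { intros a Ha. destruct Hv3 as [[-> H]|[-> H]]; [left; auto|].
      destruct (Nat.eq_dec a i) as [->|]; [right; rewrite aset_eq; auto|].
      left. rewrite aset_neq by auto. split; [auto | congruence]. }
    splits; auto; try lia.
    * intros a Ha. destruct (Hval a Ha) as [[-> _]|(-> & -> & _)]; auto.
      split; [unfold cand; lra|]. unfold cand. apply N4 with (a := u); auto.
    * intros a Ha. destruct (Hval a Ha) as [[-> _]|(-> & -> & C)]; auto.
      specialize (B2 i Ha). lra.
    * intros a Ha Hda. destruct (Hval a Ha) as [[-> _]|(-> & -> & C)]; auto.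
      rewrite (B3 i Ha Hda) in C. specialize (Hdn i Ha Hda). unfold cand in C. lra.
    * intros a Ha. destruct (Hval a Ha) as [[-> _]|(-> & -> & C)]; auto.
      assert (Rmin (ra m s 4 i) (ra m s 4 u) <= ra m s 4 u)%R by apply Rmin_r.
      unfold cand. lra.
    * intros a Ha. destruct (Nat.eq_dec a i) as [->|].
      -- exists d. split; auto. destruct (Hval i Hik) as [[-> C]|(_ & -> & _)].
         ++ apply C. auto. ++ unfold cand. lra.
      -- destruct (B5 a) as (d' & D1 & D2); [lia|]. exists d'. split; auto.
         destruct (Hval a) as [[-> _]|(C & _)]; [lia | auto | congruence].
  + intros C. split; [cost|]. assert (i = kn) as -> by lia. splits; auto.
- intros s' F' H. split; [lia | exact H].
Qed.

(** The result is a triangle inequality between all nodes, for some valid lookup [d]. Together with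
    the witnesses [Up], it replaces any statement about shortest paths in the graph of nodes. A
    processed node keeps its value, since later minima are not smaller and hops are nonnegative. *)
Lemma dense_ok s p kn xt xh xw Up :
  tables n sc K q pw sh s -> ivar s 9 = p -> p <= m -> ivar s 13 = kn -> kn <= Lim ->
  ia m s 17 = xt -> ia m s 18 = xh -> ra m s 3 = xw ->
  nodes_ok p kn xt xh xw Up -> (forall a, a < kn -> ia m s 19 a = 0) ->
  (forall a, a < kn -> (0 <= ra m s 4 a)%R /\ Up a (ra m s 4 a)) ->
  tri w dense s (kn * (kn * (80 * LS + 400) + 200) + 40) (fun s' =>
    (forall a, a < kn -> (0 <= ra m s' 4 a <= ra m s 4 a)%R /\ Up a (ra m s' 4 a)) /\
    (forall a b, a < kn -> b < kn -> exists d, est p (xh a) (xt b) d /\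
       (ra m s' 4 b <= ra m s' 4 a + pw d + xw b)%R)).
Proof.
intros Htb E9 Hp E13 Hkn E17 E18 E3 Hnk Hz Hup.
pose proof Htb as [Tn Tm Tsc Tet Teh Tew Tpos Tpw TT].
fold m in Tm, Tet, Teh, Tew, Tpos, Tpw, TT.
unfold dense, tri. step. step.
set (CR := kn * (80 * LS + 400) + 200).
eapply (wp_call w m); [exact w6 | eapply (tri_while w m) with (T0 := kn * CR + 10)
  (P := fun s' =>
    (forall a, a < kn -> (0 <= ra m s' 4 a <= ra m s 4 a)%R /\ Up a (ra m s' 4 a)) /\
    (forall a b, a < kn -> b < kn -> exists d, est p (xh a) (xt b) d /\
       (ra m s' 4 b <= ra m s' 4 a + pw d + xw b)%R))
  (I := fun T s' => exists rd ML, ivar s' 12 = rd /\ rd + length ML = kn /\ NoDup ML /\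
    (forall a, In a ML <-> a < kn /\ ia m s' 19 a = 0) /\
    (forall a, a < kn -> (0 <= ra m s' 4 a <= ra m s 4 a)%R /\ Up a (ra m s' 4 a)) /\
    (forall a b, a < kn -> ~ In a ML -> In b ML -> (ra m s' 4 a <= ra m s' 4 b)%R) /\
    (forall a b, a < kn -> ~ In a ML -> b < kn -> exists d, est p (xh a) (xt b) d /\
       (ra m s' 4 b <= ra m s' 4 a + pw d + xw b)%R) /\
    (kn - rd) * CR + 10 <= T)|].
- exact w6.
- exists 0, (seq 0 kn).
  assert (Hsq : forall a, In a (seq 0 kn) <-> a < kn) by (intros a; rewrite in_seq; lia).
  splits; look; auto.
  + now rewrite length_seq.
  + apply seq_NoDup.
  + intros a. rewrite Hsq. split; [auto | tauto].
  + intros a Ha. destruct (Hup a Ha). split; auto. lra.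
  + intros a b Ha Hn. exfalso. apply Hn, Hsq. auto.
  + intros a b Ha Hn. exfalso. apply Hn, Hsq. auto.
  + lia.
- intros T s1 F1 (rd & ML & E12 & Hrd & Hnd & HML & B1 & B2 & B3 & HT).
  eexists. split; [ev|]. split.
  + intros Hlt. step.
    eapply (wp_call w m); [exact w6 | eapply (findmin_ok s1 kn ML); look; auto |].
    { intros ->. cbn in *. lia. }
    intros s2 F2 (u & E20 & HuM & Hmin).
    assert (Hu : u < kn) by (apply HML in HuM; tauto).
    step. step. replace (u + 1 - 1) with u by lia. step. step. step.
    remember (ra m s1 4) as val1 eqn:Ev1. symmetry in Ev1.
    apply in_split in HuM. destruct HuM as (M1 & M2 & EM).
    assert (HuM' : ~ In u (M1 ++ M2)) by (rewrite EM in Hnd; now apply NoDup_remove_2 in Hnd).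
    assert (HMi : forall v, In v ML <-> v = u \/ In v (M1 ++ M2)).
    { intros v. rewrite EM, !in_app_iff. cbn. intuition. }
    match goal with |- wp _ _ ?st _ _ => set (s3 := st) end.
    assert (Ev3 : ra m s3 4 = val1) by (unfold s3; look; auto).
    eapply (wp_call w m); [exact w6 | eapply (relax_ok s3 p kn u xt xh xw Up
      (fun a => a < kn /\ ~ In a (M1 ++ M2))); rewrite ?Ev3; try (unfold s3; look; auto; fail); auto |].
    { constructor; fold m; unfold s3; look; auto. }
    { intros a Ha. destruct (B1 a Ha). split; auto. lra. }
    { intros a Ha [_ Hna]. destruct (Nat.eq_dec a u) as [->|]; [lra|].
      apply B2; auto; rewrite HMi; tauto. }
    rewrite Ev3. intros s4 F4 (C1 & C2 & C3 & C4 & C5).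
    assert (E12' : ivar s4 12 = rd) by (look; unfold s3; look; auto).
    assert (E19' : ia m s4 19 = aset (ia m s1 19) u 1) by (look; unfold s3; look; auto).
    step.
    exists ((kn - (rd + 1)) * CR + 10). split.
    { replace (kn - rd) with (S (kn - (rd + 1))) in HT by lia. cbn [Nat.mul] in HT.
      unfold CR in *. cost. }
    assert (Hlow : forall b, In b (M1 ++ M2) -> (val1 u <= ra m s4 4 b)%R).
    { intros b Hb. assert (HbM : In b ML) by (apply HMi; auto).
      assert (Hbk : b < kn) by (apply HML in HbM; tauto).
      specialize (C4 b Hbk). specialize (Hmin b HbM).
      rewrite Rmin_right in C4 by auto. lra. }
    exists (rd + 1), (M1 ++ M2). splits; look; auto.
    * rewrite EM, length_app in Hrd. cbn in Hrd. rewrite length_app. lia.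
    * rewrite EM in Hnd. now apply NoDup_remove_1 in Hnd.
    * intros a. destruct (Nat.eq_dec a u) as [->|Hau].
      -- rewrite aset_eq. split; [tauto | lia].
      -- rewrite aset_neq by auto. rewrite <- HML, HMi. tauto.
    * intros a Ha. destruct (B1 a Ha). destruct (C1 a Ha). specialize (C2 a Ha).
      split; auto. lra.
    * intros a b Ha Hna Hb. rewrite C3 by auto. specialize (Hlow b Hb).
      destruct (Nat.eq_dec a u) as [->|]; auto.
      assert (val1 a <= val1 u)%R; [|lra]. apply B2; auto; rewrite HMi; tauto.
    * intros a b Ha Hna Hb. rewrite (C3 a) by auto.
      destruct (Nat.eq_dec a u) as [->|Hau]; auto.
      destruct (B3 a b) as (d & D1 & D2); auto; [rewrite HMi; tauto|].
      exists d. split; auto. specialize (C2 b Hb). lra.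
  + intros C. split; [cost|]. assert (ML = []) as -> by (destruct ML; auto; cbn in *; lia).
    split; auto.
- intros s' F' H. split; [unfold CR; lia | exact H].
Qed.
Definition extras (mark : nat -> nat) (p k : nat) : list edge :=
  map (fun e => nth e sh edge0) (filter (fun e => mark e =? 1) (seq p k)).

Lemma extras_S mark p k :
  extras mark p (S k) = extras mark p k ++
    (if mark (p + k) =? 1 then [nth (p + k) sh edge0] else []).
Proof.
unfold extras. rewrite seq_S, filter_app, map_app. cbn. destruct (mark (p + k) =? 1); auto.
Qed.

Lemma extras_length mark p k : length (extras mark p k) <= k.
Proof.
unfold extras. rewrite length_map. eapply Nat.le_trans; [apply filter_length_le|].
now rewrite length_seq.
Qed.

Lemma collect_ok s p M i j :
  tables n sc K q pw sh s -> ivar s 9 = p -> p <= m -> ivar s 10 = M -> M <= m ->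
  ivar s 2 = i -> ivar s 3 = j ->
  tri w collect s (150 * (M - p) + 300) (fun s' =>
    let ns := Edge i i 0 :: extras (ia m s 14) p (M - p) ++ [Edge j j 0] in
    ivar s' 13 = length ns /\
    nodes_at (pw sc) (ia m s' 17) (ia m s' 18) (ra m s' 3) (ra m s' 4) (ia m s' 19) ns).
Proof.
intros Htb E9 Hp E10 HM E2 E3.
pose proof Htb as [Tn Tm Tsc Tet Teh Tew Tpos Tpw TT].
fold m in Tm, Tet, Teh, Tew, Tpos, Tpw, TT.
unfold collect, addnode, rzero, tri. step. step. step.
step. step. step. step. step. step. step. step. step. step. step.
step. step. step.
match goal with |- wp _ _ ?st _ _ => set (s0 := st) in * end.
assert (N0 : nodes_at (pw sc) (ia m s0 17) (ia m s0 18) (ra m s0 3) (ra m s0 4) (ia m s0 19)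
   [Edge i i 0]).
{ unfold s0. look.
  apply (nodes_snoc (pw sc) _ _ _ _ _ [] 0 (Edge i i 0) 0%R); auto. intros a Ha. cbn in Ha. lia. }
eapply (wp_call w m); [exact w6 | eapply (tri_while w m) with (T0 := 150 * (M - p) + 10)
  (P := fun s' => let ns := Edge i i 0 :: extras (ia m s 14) p (M - p) in
    ivar s' 13 = length ns /\
    nodes_at (pw sc) (ia m s' 17) (ia m s' 18) (ra m s' 3) (ra m s' 4) (ia m s' 19) ns)
  (I := fun T s' => exists k, k <= M - p /\ ivar s' 18 = p + k /\
    let ns := Edge i i 0 :: extras (ia m s 14) p k in
    ivar s' 13 = length ns /\
    nodes_at (pw sc) (ia m s' 17) (ia m s' 18) (ra m s' 3) (ra m s' 4) (ia m s' 19) ns /\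
    150 * (M - p - k) + 10 <= T)|].
- exact w6.
- exists 0. cbv zeta. splits; [lia | unfold s0; look; lia | unfold s0; look; reflexivity | exact N0 | lia].
- intros T s1 F1 (k & Hk & E18 & E13 & Hn & HT).
  set (ns := Edge i i 0 :: extras (ia m s 14) p k) in *.
  assert (Hln : length ns <= k + 1).
  { unfold ns. cbn [length]. pose proof (extras_length (ia m s 14) p k). lia. }
  assert (Hln1 : length ns <> 0) by (unfold ns; cbn; lia).
  assert (E9' : ivar s1 9 = p) by (look; unfold s0; look; auto).
  assert (E10' : ivar s1 10 = M) by (look; unfold s0; look; auto).
  assert (E1' : ivar s1 1 = m) by (look; unfold s0; look; auto).
  assert (E5' : ivar s1 5 = sc) by (look; unfold s0; look; auto).
  assert (E14' : ia m s1 14 = ia m s 14) by (look; unfold s0; look; auto).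
  assert (E15' : ia m s1 15 = ia m s 15) by (look; unfold s0; look; auto).
  assert (E16' : ia m s1 16 = ia m s 16) by (look; unfold s0; look; auto).
  assert (E2' : ra m s1 2 = ra m s 2) by (look; unfold s0; look; auto).
  assert (E0' : ra m s1 0 = pw) by (look; unfold s0; look; auto).
  eexists. split; [ev|]. split.
  + intros Hlt. assert (Hkm : p + k < m) by lia.
    pose proof (Tet _ Hkm) as Et. pose proof (Teh _ Hkm) as Eh. pose proof (Tew _ Hkm) as Ew.
    assert (He : In (nth (p + k) sh edge0) sh) by (now apply nth_In).
    destruct (Hsh _ He) as (Ht & Hh & _).
    step.
    set (ns' := Edge i i 0 :: extras (ia m s 14) p (S k)).
    join m 130 (fun s' => ivar s' 13 = length ns' /\ ivar s' 18 = p + k /\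
      nodes_at (pw sc) (ia m s' 17) (ia m s' 18) (ra m s' 3) (ra m s' 4) (ia m s' 19) ns').
    { unfold ns'. rewrite extras_S. rewrite app_comm_cons. fold ns. step.
      - replace (ia m s 14 (p + k) =? 1) with true by (symmetry; now apply Nat.eqb_eq).
        step. step. rewrite Et. step. step. rewrite Eh. step. step. rewrite Ew.
        step. step. step. step. step.
        split; [lia|]. look. rewrite length_app. cbn [length]. splits; auto.
        apply nodes_snoc; auto. destruct (Nat.eqb_spec (length ns) 0); [lia | auto].
      - replace (ia m s 14 (p + k) =? 1) with false by (symmetry; now apply Nat.eqb_neq).
        rewrite app_nil_r. step. split; [lia|]. look. auto. }
    intros s2 F2 (G1 & G2 & G3). step.
    exists (150 * (M - p - (k + 1)) + 10). split; [cost|].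
    exists (k + 1). replace (k + 1) with (S k) by lia. cbv zeta. fold ns'.
    splits; look; auto; lia.
  + intros C. split; [cost|]. replace (M - p) with k by lia. auto.
- intros s1 F1 (E13 & Hn).
  set (ns := Edge i i 0 :: extras (ia m s 14) p (M - p)) in *.
  assert (Hln : length ns <= m + 1).
  { unfold ns. cbn [length]. pose proof (extras_length (ia m s 14) p (M - p)). lia. }
  assert (E1' : ivar s1 1 = m) by (look; unfold s0; look; auto).
  assert (E3' : ivar s1 3 = j) by (look; unfold s0; look; auto).
  assert (E5' : ivar s1 5 = sc) by (look; unfold s0; look; auto).
  assert (E0' : ra m s1 0 = pw) by (look; unfold s0; look; auto).
  step. step. step. step. step. step. step. step. step. step. step.
  split; [lia|]. look. rewrite app_comm_cons. fold ns. rewrite length_app. cbn [length].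
  split; auto. change 0%R with (weight (Edge j j 0)) at 1.
  apply (nodes_snoc (pw sc) _ _ _ _ _ ns (length ns) (Edge j j 0) (pw sc)); auto.
Qed.

(** The marks represent the inserted graph as a set of predicted positions; those below [p] are all
    marked and none from [M] on is, so the edges outside of the prefix lie in a window of length M -
    p. *)
Record loaded (G : list edge) (p M : nat) (mark : nat -> nat) : Prop := Loaded {
  ld_p : p <= m;
  ld_M : M <= m;
  ld_sub : forall e, In e G -> exists k, k < m /\ e = nth k sh edge0 /\ mark k = 1;
  ld_mark : forall k, mark k = 1 -> k < M /\ In (nth k sh edge0) G;
  ld_pre : forall k, k < p -> mark k = 1 }.

(** Values are witnessed by paths of G, and they satisfy value <= q^K * length because a path of G
    is a concatenation of prefix pieces and extra edges, all bounded with the same factor. The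
    factor q^K is thus lost only once. *)
Lemma query_ok s G p M i j eps W :
  tables n sc K q pw sh s -> ivar s 9 = p -> ivar s 10 = M -> ivar s 2 = i -> ivar s 3 = j ->
  i < n -> j < n -> loaded G p M (ia m s 14) ->
  (0 < eps)%R -> (1 <= W)%R -> (forall e, In e sh -> (weight e <= W)%R) ->
  (q ^ K <= 1 + eps)%R -> (INR n * W * (1 + eps) <= pw (sc - 1)%nat)%R ->
  tri w query s (1000 * ((M - p + 2) * (M - p + 2) * LS)) (fun s' =>
    Rbar_le (dist G i j) (answer s') /\
    Rbar_le (answer s') (Rbar_mult (Finite (1 + eps)) (dist G i j))).
Proof.
intros Htb E9 E10 E2 E3 Hi Hj [Hp HM Hsub Hmark Hpre] Heps HW HWe Hq HMx.
pose proof Htb as [Tn Tm Tsc Tet Teh Tew Tpos Tpw TT].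
fold m in Tm, Tet, Teh, Tew, Tpos, Tpw, TT.
assert (HGsh : forall e, In e G -> In e sh).
{ intros e He. destruct (Hsub e He) as (k & Hk & -> & _). now apply nth_In. }
assert (HG0 : forall e, In e G -> (0 <= weight e)%R).
{ intros e He. destruct (Hsh e (HGsh e He)) as (_ & _ & C). lra. }
assert (HpG : incl (firstn p sh) G).
{ intros e He. apply in_firstn in He. destruct He as (k & A & B & ->).
  apply Hmark. auto. }
unfold query, tri. step.
eapply (wp_call w m); [exact w6 | eapply (collect_ok s p M i j); auto |].
cbv zeta. set (ns := Edge i i 0 :: extras (ia m s 14) p (M - p) ++ [Edge j j 0]).
intros s1 F1 (E13 & Hns).
pose proof (extras_length (ia m s 14) p (M - p)) as Hel.
assert (Hkn : length ns <= M - p + 2).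
{ unfold ns. cbn [length]. rewrite length_app. cbn [length]. lia. }
assert (Hkn2 : 2 <= length ns).
{ unfold ns. cbn [length]. rewrite length_app. cbn [length]. lia. }
set (kn := length ns) in *. set (nd := fun a => nth a ns edge0) in *.
assert (Hnd : forall e, In e ns -> e = Edge i i 0 \/ e = Edge j j 0 \/
   exists k, p <= k < M /\ ia m s 14 k = 1 /\ e = nth k sh edge0).
{ intros e [He|He]; [auto|]. apply in_app_iff in He. destruct He as [He|[He|[]]]; auto.
  right. right. unfold extras in He. apply in_map_iff in He. destruct He as (k & <- & Hk).
  apply filter_In in Hk. destruct Hk as [Hk1 Hk2]. apply in_seq in Hk1. apply Nat.eqb_eq in Hk2.
  exists k. splits; auto; lia. }
assert (Hnda : forall a, a < kn -> In (nd a) ns) by (intros a Ha; now apply nth_In).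
assert (Hhop : forall a, a < kn -> path G (tail (nd a)) (head (nd a)) (weight (nd a)) /\
   tail (nd a) < n /\ head (nd a) < n /\ (0 <= weight (nd a))%R).
{ intros a Ha. destruct (Hnd _ (Hnda a Ha)) as [->|[->|(k & Hk & Hm & ->)]]; cbn.
  - splits; auto; [constructor | lra].
  - splits; auto; [constructor | lra].
  - assert (He : In (nth k sh edge0) sh) by (apply nth_In; fold m; lia).
    destruct (Hsh _ He) as (A & B & C). splits; auto; [|lra].
    rewrite <- (Rplus_0_r (weight _)). constructor; [|constructor]. now apply Hmark. }
assert (Htb1 : tables n sc K q pw sh s1) by (constructor; fold m; look; auto).
assert (E9' : ivar s1 9 = p) by (look; auto).
remember (ia m s1 17) as xt eqn:Ext. symmetry in Ext.
remember (ia m s1 18) as xh eqn:Exh. symmetry in Exh.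
remember (ra m s1 3) as xw eqn:Exw. symmetry in Exw.
set (Up := fun (a : nat) (x : R) => (x < pw sc)%R -> exists y, path G i (head (nd a)) y /\ (y <= x)%R).
assert (Hnk : nodes_ok p kn xt xh xw Up).
{ constructor.
  - intros a Ha. destruct (Hns a Ha) as (-> & _). now apply Hhop.
  - intros a Ha. destruct (Hns a Ha) as (_ & -> & _). now apply Hhop.
  - intros a Ha. destruct (Hns a Ha) as (_ & _ & -> & _). now apply Hhop.
  - intros a b d x Ha Hb (D1 & D2 & D3) Hax Hx Hlt.
    destruct (Hns a Ha) as (_ & Eh & _). destruct (Hns b Hb) as (Et & _ & Ew & _).
    rewrite Eh, Et in *. rewrite Ew in *. destruct (Hhop b Hb) as (P1 & _ & _ & P2).
    fold (nd a) in *. fold (nd b) in *. pose proof (pw_pos d D1).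
    (* An infinite lookup makes the sum at least [pw sc], where nothing is claimed. *)
    destruct (Nat.eq_dec d sc) as [->|]; [lra|].
    destruct D2 as (z & Hz & Lz); [lia|]. destruct Hax as (y & Hy & Ly); [lra|].
    exists (y + z + weight (nd b))%R. split; [|lra].
    eapply path_app; [eapply path_app|]; [exact Hy | | exact P1].
    eapply path_incl; [exact HpG | exact Hz]. }
assert (Hlim : kn <= Lim) by lia.
assert (Hval0 : forall a, a < kn -> (0 <= ra m s1 4 a)%R /\ Up a (ra m s1 4 a)).
{ intros a Ha. destruct (Hns a Ha) as (_ & _ & _ & -> & _).
  destruct (Nat.eqb_spec a 0) as [->|].
  - split; [lra|]. intros _. exists 0%R. split; [constructor | lra].
  - split; [apply pw_pos; lia|]. intros C. lra. }
step. eapply (wp_call w m); [exact w6 | eapply (dense_ok s1 p kn xt xh xw Up); auto |].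
{ intros a Ha. now apply Hns. }
intros s2 F2 (B1 & B2).
set (val := ra m s2 4) in *.
assert (Hc1 : (1 <= q ^ K)%R) by (apply pow_R1_Rle; lra).
(* a path of G is cut at its last extra edge *)
assert (Hlow : forall v x, path G i v x -> exists a l1 l2, a < kn /\ x = (l1 + l2)%R /\
   (val a <= q ^ K * l1)%R /\ path (firstn p sh) (head (nd a)) v l2).
{ intros v x Hx. pattern v, x. revert v x Hx. apply path_ind_right.
  - exists 0, 0%R, 0%R. splits; [lia | lra | | constructor].
    destruct (B1 0) as [[_ C] _]; [lia|]. destruct (Hns 0) as (_ & _ & _ & E & _); [fold kn; lia|].
    rewrite E in C. cbn in C. lra.
  - intros e l He Hpl (a & l1 & l2 & Ha & -> & Hv & Hpa).
    destruct (Hsub e He) as (k & Hk & Ee & Hmk).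
    destruct (le_lt_dec p k) as [Hpk|Hpk].
    + assert (Hex : exists b, b < kn /\ nd b = e).
      { assert (Hin : In e ns).
        { unfold ns. right. apply in_app_iff. left. unfold extras. apply in_map_iff.
          exists k. split; auto. apply filter_In. split.
          - apply in_seq. destruct (Hmark k Hmk). lia.
          - now apply Nat.eqb_eq. }
        destruct (In_nth _ _ edge0 Hin) as (b & Hb & Eb). exists b. auto. }
      destruct Hex as (b & Hb & Eb).
      exists b, (l1 + l2 + weight e)%R, 0%R. splits; auto; [lra| |].
      (* The value before the hop, the lookup and the weight are each at most q^K times the
         corresponding part of the path. *)
      * destruct (B2 a b Ha Hb) as (d & (D1 & D2 & D3) & D4).
        destruct (Hns a Ha) as (_ & Eh & _). destruct (Hns b Hb) as (Et & _ & Ew & _).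
        rewrite Eh, Et in D3. rewrite Ew in D4. fold (nd a) in D3. fold (nd b) in D3, D4.
        rewrite Eb in D3, D4. specialize (D3 _ Hpa). specialize (HG0 e He).
        nra.
      * rewrite Eb. constructor.
    + exists a, l1, (l2 + weight e)%R. splits; auto; [lra|].
      apply path_snoc; auto. apply in_firstn. exists k. auto. }
assert (HB : nd (kn - 1) = Edge j j 0).
{ unfold nd, kn, ns. cbn [length]. rewrite length_app. cbn [length].
  replace (S (length (extras (ia m s 14) p (M - p)) + 1) - 1)
    with (S (length (extras (ia m s 14) p (M - p)))) by lia.
  cbn [nth]. rewrite app_nth2, Nat.sub_diag by lia. reflexivity. }
assert (Hfin : forall x, path G i j x -> (val (kn - 1)%nat <= q ^ K * x)%R).
{ intros x Hx. destruct (Hlow j x Hx) as (a & l1 & l2 & Ha & -> & Hv & Hpa).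
  assert (Hb : kn - 1 < kn) by lia.
  destruct (B2 a (kn - 1) Ha Hb) as (d & (D1 & D2 & D3) & D4).
  destruct (Hns a Ha) as (_ & Eh & _). destruct (Hns (kn - 1) Hb) as (Et & _ & Ew & _).
  rewrite Eh, Et in D3. rewrite Ew in D4. fold (nd a) in D3. fold (nd (kn - 1)) in D3, D4.
  rewrite HB in D3, D4. cbn [tail head weight] in D3, D4. specialize (D3 _ Hpa). lra. }
assert (HGx : forall e, In e G -> tail e < n /\ head e < n /\ (1 <= weight e <= W)%R).
{ intros e He. destruct (Hsh e (HGsh e He)) as (A & B & C). splits; auto; split; auto. }
(* A reachable target has a path of length at most n W, hence a value of at most n W (1 + eps),
   which is below the infinite scale; so the final test recognizes infinite distances exactly. *)
assert (Hx : forall x, path G i j x -> (val (kn - 1)%nat < pw sc)%R).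
{ intros x Hx. destruct (path_short G n W i j x HGx Hi HW Hx) as (l & Hl & Ll).
  specialize (Hfin l Hl).
  assert (0 <= l)%R by (eapply path_ge0; eauto).
  assert (pw (sc - 1)%nat < pw sc)%R by (apply (geometric_lt sc q); auto; lia). nra. }
destruct (B1 (kn - 1)) as [Bv BU]; [lia|].
assert (E13' : ivar s2 13 = kn) by (look; auto).
assert (E5' : ivar s2 5 = sc) by (look; auto).
assert (E1' : ivar s2 1 = m) by (look; auto).
assert (E0' : ra m s2 0 = pw) by (look; auto).
step. step. fold val.
assert (Hcost : 150 * (M - p) + 300 + (kn * (kn * (80 * LS + 400) + 200) + 40) + 60 <=
  1000 * ((M - p + 2) * (M - p + 2) * LS)).
{ set (D := M - p + 2) in *.
  assert (C1 : kn * (80 * LS + 400) <= D * (480 * LS)) by (apply Nat.mul_le_mono; lia).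
  assert (C2 : kn * (kn * (80 * LS + 400) + 200) <= D * (D * (480 * LS) + 200))
    by (apply Nat.mul_le_mono; lia).
  assert (C3 : D * (D * (480 * LS) + 200) = 480 * (D * D * LS) + 200 * D) by lia.
  assert (C4 : D * 2 <= D * D * LS).
  { rewrite <- Nat.mul_assoc. apply Nat.mul_le_mono_l. apply (Nat.mul_le_mono 2 D 1 LS); lia. }
  lia. }
step.
- assert (Hno : forall y, ~ path G i j y).
  { intros y Hy. specialize (Hx y Hy). lra. }
  step. split; [lia|]. rewrite (dist_none _ _ _ Hno). unfold answer. look.
  change (0 =? 0) with true. cbv iota. split; [apply Rbar_le_refl|].
  unfold Rbar_mult, Rbar_mult'. destruct (Rle_dec 0 (1 + eps)) as [H1|H1]; [|lra].
  destruct (Rle_lt_or_eq_dec 0 (1 + eps) H1); [apply Rbar_le_refl | lra].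
- step. split; [lia|]. unfold answer. look. change (1 =? 0) with false. cbv iota.
  destruct BU as (y & Hy & Ly). { lra. }
  rewrite HB in Hy. cbn [head] in Hy. split.
  + eapply Rbar_le_trans; [apply (dist_le _ _ _ y Hy)|]. exact Ly.
  + apply dist_factor with y; auto; [lra|]. intros z Hz. specialize (Hfin z Hz).
    assert (0 <= z)%R by (eapply path_ge0; eauto). nra.
Qed.

Lemma update_ok s G p M k :
  tables n sc K q pw sh s -> ivar s 9 = p -> ivar s 10 = M ->
  k < m -> ivar s 2 = tail (nth k sh edge0) -> ivar s 3 = head (nth k sh edge0) ->
  loaded G p M (ia m s 14) ->
  (forall i, m <= i -> ia m s 14 i <> 1) ->
  tri w update s 150 (fun s' => exists p' M', ivar s' 9 = p' /\ ivar s' 10 = M' /\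
    loaded (G ++ [nth k sh edge0]) p' M' (ia m s' 14) /\
    (forall i, m <= i -> ia m s' 14 i <> 1) /\ M' = Nat.max M (k + 1) /\
    (p' = p + 1 \/ p' = p /\ ia m s' 14 p <> 1) /\
    (forall i, ia m s' 14 i = 1 <-> i = k \/ ia m s 14 i = 1)).
Proof.
intros Htb E9 E10 Hk E2 E3 [Hp HM Hsub Hmark Hpre] Hbig.
pose proof Htb as [Tn Tm Tsc Tet Teh Tew Tpos Tpw TT].
fold m in Tm, Tet, Teh, Tew, Tpos, Tpw, TT.
assert (He : In (nth k sh edge0) sh) by (now apply nth_In).
destruct (Hsh _ He) as (Ht & Hh & _). specialize (Tpos k Hk).
set (u := tail (nth k sh edge0)) in *. set (v := head (nth k sh edge0)) in *.
assert (A1 : u * n + v < n * n) by nia.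
assert (A3 : u * n <= n * n) by nia.
unfold update, tri. step. step. rewrite Tpos. replace (k + 1 - 1) with k by lia.
step. step. step.
set (mk := aset (ia m s 14) k 1).
assert (Hmk : forall i, mk i = 1 <-> i = k \/ ia m s 14 i = 1).
{ intros i. unfold mk. destruct (Nat.eq_dec i k) as [->|].
  - rewrite aset_eq. tauto. - rewrite aset_neq by auto. tauto. }
join m 30 (fun s' => ivar s' 10 = Nat.max M (k + 1)).
{ step; step; (split; [lia|]); look; lia. }
intros s1 F1 E10'.
assert (E14' : ia m s1 14 = mk) by (look; auto).
assert (E9' : ivar s1 9 = p) by (look; auto).
assert (Em : ivar s1 1 = m) by (look; auto).
assert (HM' : Nat.max M (k + 1) <= m) by lia.
assert (L : forall p', p' <= m -> (forall i, i < p' -> mk i = 1) ->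
  loaded (G ++ [nth k sh edge0]) p' (Nat.max M (k + 1)) mk).
{ intros p' Hp' Hpre'. constructor; auto.
  - intros e He'. apply in_app_iff in He'. destruct He' as [He'|[<-|[]]].
    + destruct (Hsub e He') as (k' & B1 & B2 & B3). exists k'. splits; auto. apply Hmk. auto.
    + exists k. splits; auto. apply Hmk. auto.
  - intros i Hi. apply Hmk in Hi. rewrite in_app_iff. destruct Hi as [->|Hi].
    + split; [lia | cbn; auto].
    + destruct (Hmark i Hi). split; [lia | auto]. }
step.
- assert (Hpm : p < m).
  { destruct (le_lt_dec m p); auto. apply Hmk in H. destruct H as [->|H]; auto.
    now apply Hbig in H. }
  step. split; [lia|]. exists (p + 1), (Nat.max M (k + 1)). splits; look; auto.
  + apply L; [lia|]. intros i Hi. destruct (Nat.eq_dec i p) as [->|]; auto.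
    apply Hmk. right. apply Hpre. lia.
  + intros i Hi C. apply Hmk in C. destruct C as [->|C]; [lia|]. now apply Hbig in C.
- step. split; [lia|]. exists p, (Nat.max M (k + 1)). splits; look; auto.
  + apply L; auto. intros i Hi. apply Hmk. auto.
  + intros i Hi C. apply Hmk in C. destruct C as [->|C]; [lia|]. now apply Hbig in C.
Qed.
End Serve.

(** * Serving a sequence of events *)

Lemma tri_runs w c s T P (B : R) :
  tri w c s T P -> (INR T <= B)%R -> runs_within w c s B P.
Proof.
intros (k & s' & k' & E & L & L' & H) HB. exists k, s'. splits; auto.
eapply Rle_trans; [|exact HB]. apply le_INR. lia.
Qed.

Lemma runs_weaken w c s B (P Q : state -> Prop) m :
  6 <= w -> runs_within w c s B P -> (forall s', frame m c s s' -> P s' -> Q s') ->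
  runs_within w c s B Q.
Proof.
intros w6 (k & s' & E & L & H) HQ. exists k, s'. splits; auto. apply HQ; auto.
eapply exec_frame; eauto.
Qed.

Lemma index_nth l k :
  NoDup (map ends l) -> k < length l -> index (nth k l edge0) l = k.
Proof.
revert k. induction l as [|e l IH]; intros k Hn Hk; [cbn in Hk; lia|].
cbn [map] in Hn. inversion Hn as [|x y Hx Hy]; subst. destruct k as [|k]; cbn [nth index].
- unfold same_ends. now rewrite !Nat.eqb_refl.
- cbn [length] in Hk. destruct (same_ends (nth k l edge0) e) eqn:E.
  + exfalso. apply Hx. unfold same_ends in E. apply andb_prop in E. destruct E as [E1 E2].
    apply Nat.eqb_eq in E1, E2.
    replace (ends e) with (ends (nth k l edge0)) by (unfold ends; congruence).
    apply in_map, nth_In. lia.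
  + f_equal. apply IH; auto. lia.
Qed.

Lemma prediction_error_le s sh e :
  In e s -> nat_dist (index e s) (index e sh) <= prediction_error s sh.
Proof.
intros H. unfold prediction_error.
pose proof (proj1 (list_max_le (map (fun e => nat_dist (index e s) (index e sh)) s) _)
  (Nat.le_refl _)) as F.
rewrite Forall_forall in F. apply F. apply in_map_iff. eauto.
Qed.

Section Events.
Variables (w n sc K Lim LS : nat) (q eps W Tupd Tqry : R) (pw : nat -> R) (sigma sh : list edge).
Let m := length sh.
Let eta := prediction_error sigma sh.
Hypothesis w6 : 6 <= w.
Hypothesis Hw : 32 * (m + Lim + 2) < 2 ^ w.
Hypothesis Lnns : n * n * sc <= Lim.
Hypothesis Lnn : n * n <= Lim.
Hypothesis Ln : n <= Lim.
Hypothesis Lm : 2 * m + 4 <= Lim.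
Hypothesis Lsc : 2 * sc <= Lim.
Hypothesis HLS : Nat.log2 (2 * sc) <= LS.
Hypothesis LS1 : 1 <= LS.
Hypothesis sc2 : 2 <= sc.
Hypothesis q1 : (1 < q)%R.
Hypothesis Hgeo : geometric sc q pw.
Hypothesis HmK : m < 2 ^ K.
Hypothesis Hsig : edge_sequence n W sigma.
Hypothesis Hperm : Permutation sigma sh.
Hypothesis Heps : (0 < eps)%R.
Hypothesis HW : (1 <= W)%R.
Hypothesis HqK : (q ^ K <= 1 + eps)%R.
Hypothesis HMx : (INR n * W * (1 + eps) <= pw (sc - 1)%nat)%R.
Hypothesis HTu : (150 <= Tupd)%R.
Hypothesis HTq : (INR (1000 * ((2 * eta + 2) * (2 * eta + 2) * LS)) <= Tqry)%R.

Lemma sh_edge e : In e sh -> tail e < n /\ head e < n /\ (1 <= weight e <= W)%R.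
Proof.
intros He. apply Hsig. eapply Permutation_in; [apply Permutation_sym; exact Hperm | exact He].
Qed.

Lemma sh_nodup : NoDup (map ends sh).
Proof.
destruct Hsig as [H _]. eapply Permutation_NoDup; [|exact H]. now apply Permutation_map.
Qed.

Lemma sh_inj k k' : k < m -> k' < m -> nth k sh edge0 = nth k' sh edge0 -> k = k'.
Proof.
intros Hk Hk' E. rewrite <- (index_nth sh k), <- (index_nth sh k'); auto using sh_nodup.
now rewrite E.
Qed.

Lemma position_error t k e :
  t < length sigma -> k < m -> nth t sigma edge0 = e -> nth k sh edge0 = e ->
  t <= k + eta /\ k <= t + eta.
Proof.
intros Ht Hk Et Ek. pose proof (prediction_error_le sigma sh e) as H. fold eta in H.
assert (I1 : index e sigma = t) by (rewrite <- Et; apply index_nth; [apply Hsig | auto]).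
assert (I2 : index e sh = k) by (rewrite <- Ek; apply index_nth; [apply sh_nodup | auto]).
rewrite I1, I2 in H.
unfold nat_dist in H. assert (He : In e sigma) by (rewrite <- Et; now apply nth_In).
specialize (H He). lia.
Qed.

(** The two inequalities that accompany [loaded] say that the prefix lags by at most eta and that
    the window ends at most eta ahead of the current time; together they bound the window of every
    query by 2 eta. *)
Lemma serves_ok evs G s p M :
  sigma = G ++ insertions evs ->
  (forall i j, In (Query i j) evs -> i < n /\ j < n) ->
  tables n sc K q pw sh s -> ivar s 9 = p -> ivar s 10 = M ->
  loaded sh G p M (ia m s 14) -> (forall i, m <= i -> ia m s 14 i <> 1) ->
  length G <= p + eta -> M <= length G + eta ->
  serves w update query Tupd Tqry eps G evs s.
Proof.
revert G s p M. induction evs as [|ev evs IH]; intros G s p M Hs Hqr Htb E9 E10 Hld Hbig HpG HMG;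
  [exact I|].
assert (Hsh : forall e, In e sh -> tail e < n /\ head e < n /\ (1 <= weight e)%R).
{ intros e He. destruct (sh_edge e He) as (A & B & C & D). auto. }
assert (HW' : forall e, In e sh -> (weight e <= W)%R).
{ intros e He. destruct (sh_edge e He) as (A & B & C & D). auto. }
pose proof Htb as [Tn Tm Tsc Tet Teh Tew Tpos Tpw TT].
fold m in Tm, Tet, Teh, Tew, Tpos, Tpw, TT.
destruct ev as [e|i j]; cbn [serves].
- cbn [insertions flat_map app] in Hs. fold (insertions evs) in Hs.
  set (t := length G).
  assert (Ht : t < length sigma) by (rewrite Hs, length_app; cbn; unfold t; lia).
  assert (Et : nth t sigma edge0 = e).
  { rewrite Hs, app_nth2 by (unfold t; lia). unfold t. now rewrite Nat.sub_diag. }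
  assert (He : In e sh).
  { eapply Permutation_in; [exact Hperm|]. rewrite <- Et. now apply nth_In. }
  destruct (In_nth _ _ edge0 He) as (k & Hk & Ek). fold m in Hk.
  destruct (position_error t k e Ht Hk Et Ek) as [P1 P2].
  eapply runs_weaken with (m := m); [exact w6 | |].
  { eapply tri_runs with (T := 150); [|cbn; lra].
    eapply (update_ok w n sc K Lim LS q pw sh) with (G := G) (p := p) (M := M) (k := k); auto.
    - constructor; fold m; unfold pass_edge; look; auto.
    - unfold pass_edge. look. now rewrite Ek.
    - unfold pass_edge. look. now rewrite Ek. }
  unfold pass_edge. intros s' Fs' (p' & M' & E9' & E10' & Hld' & Hbig' & EM' & Hp' & Hmk').
  apply IH with (p := p') (M := M'); auto.
  + rewrite Hs, <- app_assoc. auto.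
  + intros i j H. apply Hqr. cbn; auto.
  + constructor; fold m; look; auto.
  + rewrite <- Ek. exact Hld'.
  + rewrite length_app. cbn [length]. fold t in HpG |- *. destruct Hp' as [->|[-> Hn]]; [lia|].
    (* If the lag exceeded eta, the edge at the predicted position p would have a true position of
       at most p + eta < t + 1. It would be inserted, hence marked, although the prefix was blocked
       by it. *)
    destruct (le_lt_dec (t + 1) (p + eta)) as [|Hlt]; auto. exfalso. apply Hn.
    assert (Hpm : p < m).
    { assert (length sigma = m) by (unfold m; now apply Permutation_length). lia. }
    set (f := nth p sh edge0).
    assert (Hf : In f sigma).
    { eapply Permutation_in; [apply Permutation_sym; exact Hperm | now apply nth_In]. }
    destruct (In_nth _ _ edge0 Hf) as (a & Ha & Ea).
    destruct (position_error a p f Ha Hpm Ea eq_refl) as [Q1 Q2].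
    assert (Hfi : In f (G ++ [nth k sh edge0])).
    { rewrite Ek. rewrite <- Ea, Hs. change (e :: insertions evs) with ([e] ++ insertions evs).
      rewrite app_assoc, app_nth1.
      - apply nth_In. rewrite length_app. cbn. fold t. lia.
      - rewrite length_app. cbn. fold t. lia. }
    destruct (ld_sub _ _ _ _ _ Hld' f Hfi) as (k' & Hk' & Ef & Hm').
    replace p with k'; auto. apply sh_inj; auto.
  + rewrite length_app. cbn [length]. fold t in HMG |- *. lia.
- destruct (Hqr i j) as [Hi Hj]; [cbn; auto|].
  cbn [insertions flat_map app] in Hs. fold (insertions evs) in Hs.
  eapply runs_weaken with (m := m); [exact w6 | |].
  { eapply tri_runs; [|exact HTq].
    eapply (tri_weaken w m); [exact w6 | eapply (query_ok w n sc K Lim LS q pw sh) with (G := G)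
      (p := p) (M := M) (i := i) (j := j) (eps := eps) (W := W); auto | |intros s' _ H; exact H].
    - constructor; fold m; unfold pass_query; look; auto.
    - apply Nat.mul_le_mono_l. apply Nat.mul_le_mono_r. apply Nat.mul_le_mono; lia. }
  unfold pass_query. intros s' Fs' (H1 & H2). splits; auto.
  apply IH with (p := p) (M := M); auto.
  + intros i' j' H. apply Hqr. cbn; auto.
  + constructor; fold m; look; auto.
  + look. auto.
  + look. auto.
  + look. exact Hld.
  + look. exact Hbig.
Qed.
End Events.

(** * Asymptotic bounds *)

Close Scope nat_scope.

Lemma bernoulli_le d j : 0 <= d -> 1 + INR j * d <= (1 + d) ^ j.
Proof.
intros Hd. induction j as [|j IH]; [cbn; lra|].
rewrite S_INR. cbn [pow]. pose proof (pos_INR j).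
assert (0 <= INR j * d) by nra. nra.
Qed.

(** A converse of Bernoulli's inequality, for total increments up to 1/2; it turns q^K into 1 + O(K
    (q - 1)). *)
Lemma bernoulli_ge d j : 0 <= d -> INR j * d <= / 2 -> (1 + d) ^ j <= 1 + 2 * (INR j * d).
Proof.
intros Hd. induction j as [|j IH]; [cbn; lra|].
rewrite S_INR. intros H. cbn [pow]. pose proof (pos_INR j).
assert (A : INR j * d <= / 2) by nra. specialize (IH A).
assert (0 <= INR j * d) by nra. nra.
Qed.

Lemma ln_le_sub1 x : 0 < x -> ln x <= x - 1.
Proof.
intros Hx. pose proof (exp_ineq1_le (ln x)). rewrite exp_ln in H by auto. lra.
Qed.

Lemma ln_ge_frac e : 0 < e -> e / (1 + e) <= ln (1 + e).
Proof.
intros He. assert (0 < / (1 + e)) by (apply Rinv_0_lt_compat; lra).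
pose proof (ln_le_sub1 (/ (1 + e)) H) as A. rewrite ln_Rinv in A by lra.
replace (e / (1 + e)) with (1 - / (1 + e)) by (field; lra). lra.
Qed.

Lemma ln_zero : ln 0 = 0.
Proof. unfold ln. case (Rlt_dec 0 0); intros H; [exfalso; lra | reflexivity]. Qed.

Lemma ln_nonneg x : 1 <= x -> 0 <= ln x.
Proof. intros H. rewrite <- ln_1. apply ln_le; lra. Qed.

Lemma ge1_ge x : 1 <= ge1 x /\ x <= ge1 x.
Proof. unfold ge1. split; [apply Rmax_l | apply Rmax_r]. Qed.

Lemma log2_ln x : (1 <= x)%nat -> INR (Nat.log2 x) <= 2 * ln (INR x).
Proof.
intros Hx. destruct (Nat.log2_spec x) as [A _]; [lia|].
apply le_INR in A. rewrite pow_INR in A. replace (INR 2) with 2 in A by (cbn; lra).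
apply ln_le in A; [|apply pow_lt; lra]. rewrite ln_pow in A by lra.
pose proof ln_lt_2. pose proof (pos_INR (Nat.log2 x)). nra.
Qed.

Lemma log_base_nonneg eps n W : 0 < eps -> 1 <= W -> 0 <= log_base (1 + eps) (INR n * W).
Proof.
intros He HW. unfold log_base. assert (0 < ln (1 + eps)).
{ rewrite <- ln_1. apply ln_increasing; lra. }
apply Rle_div_r; [lra|]. rewrite Rmult_0_l. destruct n as [|n].
- cbn [INR]. rewrite Rmult_0_l, ln_zero. lra.
- apply ln_nonneg. rewrite S_INR. pose proof (pos_INR n). nra.
Qed.

Lemma log_base_spec eps n W :
  0 < eps -> (1 <= n)%nat -> 1 <= W ->
  log_base (1 + eps) (INR n * W) * ln (1 + eps) = ln (INR n) + ln W.
Proof.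
intros He Hn HW. apply le_INR in Hn. cbn in Hn. unfold log_base.
assert (0 < ln (1 + eps)) by (rewrite <- ln_1; apply ln_increasing; lra).
rewrite ln_mult by lra. field. lra.
Qed.

(* Bernoulli turns (1 + eps/j)^j into at least 1 + eps, so j (L + 2) steps suffice. *)
Lemma scales_exist eps j n W :
  0 < eps -> (1 <= j)%nat -> 1 <= W ->
  exists N, INR n * W * (1 + eps) <= (1 + eps / INR j) ^ N /\
    INR N <= INR j * (log_base (1 + eps) (INR n * W) + 2).
Proof.
intros He Hj HW. set (L := log_base (1 + eps) (INR n * W)).
assert (HL : 0 <= L) by (now apply log_base_nonneg).
assert (Hj' : 1 <= INR j) by (apply le_INR in Hj; exact Hj).
destruct (nfloor_ex (L + 1)) as [a [Ha1 Ha2]]; [lra|].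
exists (j * (a + 1))%nat. rewrite mult_INR, plus_INR. cbn [INR]. split; [|nra].
rewrite pow_mult.
assert (A : 1 + eps <= (1 + eps / INR j) ^ j).
{ eapply Rle_trans; [|apply bernoulli_le; apply Rlt_le, Rdiv_lt_0_compat; lra].
  right. field. lra. }
apply Rle_trans with ((1 + eps) ^ (a + 1)); [|apply pow_incr; lra].
destruct n as [|n].
- cbn [INR]. rewrite !Rmult_0_l. apply pow_le. lra.
- assert (Hn : 1 <= INR (S n)) by (rewrite S_INR; pose proof (pos_INR n); lra).
  assert (B : L * ln (1 + eps) = ln (INR (S n)) + ln W) by (apply log_base_spec; auto; lia).
  assert (Hp1 : 0 < INR (S n) * W) by (apply Rmult_lt_0_compat; lra).
  assert (Hp2 : 0 < INR (S n) * W * (1 + eps)) by (apply Rmult_lt_0_compat; lra).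
  rewrite <- (exp_ln (INR (S n) * W * (1 + eps))) by auto.
  rewrite <- (exp_ln ((1 + eps) ^ (a + 1))) by (apply pow_lt; lra).
  assert (C : ln (INR (S n) * W * (1 + eps)) <= ln ((1 + eps) ^ (a + 1))).
  { rewrite ln_pow by lra. rewrite !ln_mult by lra. rewrite Nat.add_1_r, (S_INR a).
    assert (0 < ln (1 + eps)) by (rewrite <- ln_1; apply ln_increasing; lra).
    apply Rle_trans with ((L + 1) * ln (1 + eps)); [lra|]. apply Rmult_le_compat_r; lra. }
  destruct C as [C|C]; [left; now apply exp_increasing | right; now rewrite C].
Qed.

Lemma edges_le_square n W s : edge_sequence n W s -> (length s <= n * n)%nat.
Proof.
intros [Hn He]. rewrite <- (length_map ends).
replace (n * n)%nat with (length (list_prod (seq 0 n) (seq 0 n)))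
  by (rewrite length_prod, !length_seq; auto).
apply NoDup_incl_length; auto. intros x Hx. apply in_map_iff in Hx.
destruct Hx as (e & <- & Hin). destruct (He e Hin) as (A & B & _).
apply in_prod; apply in_seq; lia.
Qed.

Lemma Kof_ln m : INR (Kof m) + 1 <= 2 + 2 * ln (ge1 (INR m)).
Proof.
unfold Kof. assert (H := ln_nonneg (ge1 (INR m)) (proj1 (ge1_ge _))).
destruct (Nat.eqb_spec m 0) as [->|Hm]; [assert (INR 0 = 0) by reflexivity; lra|].
rewrite S_INR. pose proof (log2_ln m ltac:(lia)).
assert (ln (INR m) <= ln (ge1 (INR m))).
{ apply ln_le; [apply lt_0_INR; lia | apply ge1_ge]. } lra.
Qed.

Definition query_const (eps_max : R) (c0 : nat) : R :=
  4 + 2 * (ln 2 + ln (2 * INR c0) + ln (2 + 4 * eps_max) + ln 2 + ln 3 + 2).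

(** The product of the constants of the factors in [preprocess_time]: 4 for n + 1 and m + 1, then
    one factor each for K + 1, for N + 2 and for the logarithms of the tournament and of the binary
    search. *)
Definition preprocess_const (eps_max : R) (c0 : nat) : R :=
  let A := 1 + ln (Rmax 1 eps_max) in
  let B := (A + 1) * (1 + eps_max) + 2 * eps_max in
  70 * 100 * 4 * (2 + 2 * A) * (2 * INR c0 * (2 + 2 * A) * B) *
    (4 + 2 * A + 2 * (ln 2 + ln (2 * INR c0) + (2 + 2 * A) + ln (B + 1) + 1 + A + A)).

(** * Number of levels and scales in terms of the sizes in the theorem *)

Section Bounds.
Variables (eps_max : R) (c0 : nat).
Hypothesis Hemax : 0 < eps_max.
Hypothesis Hc0 : (2 <= c0)%nat.
Variables (n m N : nat) (W eps : R).
Hypothesis HW : 1 <= W.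
Hypothesis Heps : 0 < eps <= eps_max.
Let L := log_base (1 + eps) (INR n * W).
Let K := Kof m.
Hypothesis HN : INR N <= INR (c0 * (K + 1)) * (L + 2).

Let L0 : 0 <= L.
Proof. apply log_base_nonneg; lra. Qed.

Let c02 : 2 <= INR c0.
Proof. apply le_INR in Hc0. cbn in Hc0. lra. Qed.

Let K1 : 1 <= INR K + 1.
Proof. pose proof (pos_INR K). lra. Qed.

Lemma N_le : INR N + 2 <= 2 * INR c0 * (INR K + 1) * (L + 2).
Proof.
rewrite mult_INR, plus_INR in HN. cbn [INR] in HN.
assert (2 * 1 * 2 <= INR c0 * (INR K + 1) * (L + 2)).
{ apply Rmult_le_compat; try nra. }
nra.
Qed.

Lemma log2_scales : INR (Nat.log2 (2 * (N + 2))) <=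
  2 * (ln 2 + ln (2 * INR c0) + ln (INR K + 1) + ln (L + 2)).
Proof.
eapply Rle_trans; [apply log2_ln; lia|].
apply Rmult_le_compat_l; [lra|]. rewrite mult_INR, plus_INR. replace (INR 2) with 2 by (cbn; lra).
pose proof N_le as H. pose proof (pos_INR N).
rewrite ln_mult by lra.
assert (ln (INR N + 2) <= ln (2 * INR c0 * (INR K + 1) * (L + 2))) by (apply ln_le; lra).
rewrite (ln_mult (2 * INR c0 * (INR K + 1))) in H1 by nra.
rewrite (ln_mult (2 * INR c0)) in H1 by nra. lra.
Qed.

Section Query.
Hypothesis Hmn : (m <= n * n)%nat.

(** There are no parallel edges, so ln m <= 2 ln n <= 2 L ln (1 + eps) <= 2 eps L. This lets the
    number of levels, which depends on m, disappear from the query time. *)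
Lemma ln_m_le : ln (ge1 (INR m)) <= 2 * eps_max * L.
Proof.
destruct n as [|n'] eqn:En.
- assert (m = 0%nat) as -> by lia. cbn [INR]. unfold ge1. rewrite Rmax_left by lra.
  rewrite ln_1. nra.
- assert (Hn : 1 <= INR (S n')) by (rewrite S_INR; pose proof (pos_INR n'); lra).
  assert (HB : L * ln (1 + eps) = ln (INR (S n')) + ln W).
  { unfold L. rewrite ?En. apply log_base_spec; auto; [lra | lia]. }
  assert (ln (1 + eps) <= eps) by (pose proof (ln_le_sub1 (1 + eps) ltac:(lra)); lra).
  assert (0 <= ln W) by (now apply ln_nonneg).
  assert (A : ln (ge1 (INR m)) <= ln (INR (S n') * INR (S n'))).
  { apply ln_le; [pose proof (proj1 (ge1_ge (INR m))); lra|]. unfold ge1. apply Rmax_lub; [nra|].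
    rewrite <- mult_INR. apply le_INR. auto. }
  rewrite ln_mult in A by lra. nra.
Qed.

(** The number of scales is O((K + 1) (L + 2)) with K + 1 = O(L + 1), so its logarithm is O(ln L) up
    to constants, which [ge1] absorbs. *)
Lemma query_log : 0 <= query_const eps_max c0 /\
  INR (Nat.log2 (2 * (N + 2)) + 1) <= query_const eps_max c0 * ge1 (ln L).
Proof.
unfold query_const. split.
- assert (0 <= ln 2) by (apply ln_nonneg; lra). assert (0 <= ln 3) by (apply ln_nonneg; lra).
  assert (0 <= ln (2 * INR c0)) by (apply ln_nonneg; lra).
  assert (0 <= ln (2 + 4 * eps_max)) by (apply ln_nonneg; lra). lra.
- pose proof log2_scales as H. pose proof ln_m_le as Hm. pose proof (Kof_ln m) as HK. fold K in HK.
  set (g := ge1 (ln L)). assert (Hg : 1 <= g /\ ln L <= g) by apply ge1_ge.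
  assert (HL3 : ln (L + 2) <= ln 3 + g).
  { destruct (Rle_lt_dec L 1) as [C|C].
    - assert (ln (L + 2) <= ln 3) by (apply ln_le; lra). lra.
    - assert (ln (L + 2) <= ln (3 * L)) by (apply ln_le; lra).
      rewrite ln_mult in H0 by lra. lra. }
  assert (HL2 : ln (L + 1) <= ln 2 + g).
  { destruct (Rle_lt_dec L 1) as [C|C].
    - assert (ln (L + 1) <= ln 2) by (apply ln_le; lra). lra.
    - assert (ln (L + 1) <= ln (2 * L)) by (apply ln_le; lra).
      rewrite ln_mult in H0 by lra. lra. }
  assert (HKL : ln (INR K + 1) <= ln (2 + 4 * eps_max) + ln (L + 1)).
  { rewrite <- ln_mult by lra. apply ln_le; [lra|]. nra. }
  rewrite plus_INR. cbn [INR].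
  assert (0 <= ln 2) by (apply ln_nonneg; lra). assert (0 <= ln 3) by (apply ln_nonneg; lra).
  assert (0 <= ln (2 * INR c0)) by (apply ln_nonneg; lra).
  assert (0 <= ln (2 + 4 * eps_max)) by (apply ln_nonneg; lra). nra.
Qed.
End Query.

Let f := preprocessing_size n m W eps.
Let l := ge1 (ln f).
Let E := Rmax 1 eps_max.
Let A := 1 + ln E.

Let E1 : 1 <= E. Proof. apply Rmax_l. Qed.
Let A1 : 1 <= A. Proof. unfold A. pose proof (ln_nonneg E E1). lra. Qed.
Let l1 : 1 <= l. Proof. apply ge1_ge. Qed.

(* Each factor of the preprocessing size is at most E times the size, the others being
   at least 1 / eps_max. *)
Lemma factor_ln x : 1 <= x -> x / eps <= f -> ln x <= A * l.
Proof.
intros Hx Hf. assert (H : x <= E * f).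
{ assert (eps <= E) by (unfold E; pose proof (Rmax_r 1 eps_max); lra).
  apply Rle_trans with (eps * f).
  - apply Rmult_le_compat_l with (r := eps) in Hf; [|lra].
    replace (eps * (x / eps)) with x in Hf by (field; lra). exact Hf.
  - assert (0 <= f).
    { eapply Rle_trans; [|exact Hf]. apply Rlt_le, Rdiv_lt_0_compat; lra. }
    nra. }
assert (Hfp : 0 < f). { assert (0 < E * f) by lra. nra. }
assert (H' : ln x <= ln (E * f)) by (apply ln_le; lra).
rewrite ln_mult in H' by lra.
assert (ln f <= l) by apply ge1_ge. pose proof (ln_nonneg E E1). unfold A. nra.
Qed.

Lemma size_ge : ge1 (INR n) / eps <= f /\ ge1 (INR m) / eps <= f /\ ge1 (ln W) / eps <= f /\
  1 / eps <= f.
Proof.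
unfold f, preprocessing_size.
destruct (ge1_ge (INR n)) as [a1 _], (ge1_ge (INR m)) as [b1 _], (ge1_ge (ln W)) as [g1 _].
set (a := ge1 (INR n)) in *. set (b := ge1 (INR m)) in *. set (g := ge1 (ln W)) in *.
assert (He : 0 <= / eps) by (apply Rlt_le, Rinv_0_lt_compat; lra).
assert (ab : 1 <= a * b) by nra. assert (ag : 1 <= a * g) by nra. assert (bg : 1 <= b * g) by nra.
repeat split; apply Rmult_le_compat_r; auto; nra.
Qed.

(** The four logarithmic factors are one for the levels, two for the number of scales (the level
    count in q and ln n inside ln (nW)), and one for the tournament and the binary search. *)
Lemma preprocess_time :
  INR (70 * 100 * ((n + 1) * (m + 1) * (K + 1) * (N + 2) *
    (Nat.log2 (2 * n) + Nat.log2 (2 * (N + 2)) + 1))) <= preprocess_const eps_max c0 * soft 4 f.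
Proof.
unfold preprocess_const. fold E. fold A. cbv zeta.
destruct size_ge as (S1 & S2 & S3 & S4).
destruct (ge1_ge (INR n)) as [a1 a2], (ge1_ge (INR m)) as [b1 b2], (ge1_ge (ln W)) as [g1 g2].
pose proof (factor_ln _ a1 S1) as Fa. pose proof (factor_ln _ b1 S2) as Fb.
pose proof (factor_ln _ g1 S3) as Fg.
set (a := ge1 (INR n)) in *. set (b := ge1 (INR m)) in *. set (g := ge1 (ln W)) in *.
assert (HK : INR K + 1 <= (2 + 2 * A) * l).
{ pose proof (Kof_ln m) as H. fold K b in H. nra. }
assert (Hie : 0 < / eps) by (apply Rinv_0_lt_compat; lra).
set (B := (A + 1) * (1 + eps_max) + 2 * eps_max) in *.
assert (HB : 2 <= B) by (unfold B; nra).
(* L is (ln n + ln W) / ln (1 + eps), and ln (1 + eps) >= eps / (1 + eps_max) makes the denominator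
   linear in eps. *)
assert (HL : L + 2 <= B * (l * g) / eps).
{ assert (Hl2 : ln (1 + eps) >= eps / (1 + eps_max)).
  { pose proof (ln_ge_frac eps ltac:(lra)).
    assert (eps / (1 + eps_max) <= eps / (1 + eps)).
    { apply Rmult_le_compat_l; [lra|]. apply Rinv_le_contravar; lra. } lra. }
  assert (HLe : L * (eps / (1 + eps_max)) <= A * l + g).
  { destruct n as [|n'] eqn:En.
    - replace L with 0; [nra|]. unfold L, log_base. rewrite ?En. cbn [INR]. rewrite Rmult_0_l, ln_zero.
      unfold Rdiv. lra.
    - assert (Hn : 1 <= INR (S n')) by (rewrite S_INR; pose proof (pos_INR n'); lra).
      assert (HBx : L * ln (1 + eps) = ln (INR (S n')) + ln W).
      { unfold L. rewrite ?En. apply log_base_spec; auto; [lra | lia]. }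
      assert (ln (INR (S n')) <= ln a) by (apply ln_le; lra). nra. }
  assert (Hx : L <= (A * l + g) * (1 + eps_max) / eps).
  { apply Rmult_le_reg_r with (eps / (1 + eps_max)); [apply Rdiv_lt_0_compat; lra|].
    eapply Rle_trans; [exact HLe|]. right. field. lra. }
  assert (H2 : 2 <= 2 * eps_max / eps).
  { apply Rmult_le_reg_r with eps; [lra|]. replace (2 * eps_max / eps * eps) with (2 * eps_max) by (field; lra). lra. }
  assert (lg : 1 <= l * g) by nra.
  apply Rle_trans with (((A * l + g) * (1 + eps_max) + 2 * eps_max) / eps).
  { unfold Rdiv in *. lra. }
  apply Rmult_le_compat_r; [lra|]. unfold B.
  assert (Y1 : l <= l * g) by nra. assert (Y2 : g <= l * g) by nra.
  assert (Y3 : A * l <= A * (l * g)) by (apply Rmult_le_compat_l; lra).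
  assert (Y4 : A * l + g <= (A + 1) * (l * g)) by lra.
  apply Rmult_le_compat_r with (r := 1 + eps_max) in Y4; [|lra].
  assert (Y5 : 2 * eps_max * 1 <= 2 * eps_max * (l * g)) by (apply Rmult_le_compat_l; lra).
  lra. }
assert (HN2 : INR N + 2 <= 2 * INR c0 * (2 + 2 * A) * B * (l * l * g / eps)).
{ eapply Rle_trans; [apply N_le|].
  apply Rle_trans with (2 * INR c0 * ((2 + 2 * A) * l) * (B * (l * g) / eps)).
  - apply Rmult_le_compat; try nra.
  - right. field. lra. }
assert (Hlogn : INR (Nat.log2 (2 * n)) <= 2 + 2 * A * l).
{ destruct n as [|n'].
  - cbn. nra.
  - eapply Rle_trans; [apply log2_ln; lia|]. rewrite mult_INR. replace (INR 2) with 2 by (cbn; lra).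
    assert (Hn : 1 <= INR (S n')) by (rewrite S_INR; pose proof (pos_INR n'); lra).
    rewrite ln_mult by lra.
    assert (ln (INR (S n')) <= ln a) by (apply ln_le; lra).
    assert (ln 2 <= 1) by (pose proof (ln_le_sub1 2 ltac:(lra)); lra). nra. }
assert (HlnL : ln (L + 2) <= ln (B + 1) + l + A * l + A * l).
{ assert (H : ln (L + 2) <= ln ((B + 1) * (l * g) / eps)).
  { apply ln_le; [lra|]. eapply Rle_trans; [exact HL|]. unfold Rdiv.
    apply Rmult_le_compat_r; [lra|]. assert (1 <= l * g) by nra. nra. }
  assert (Z1 : 0 < l * g) by (apply Rmult_lt_0_compat; lra).
  assert (Z2 : 0 < (B + 1) * (l * g)) by (apply Rmult_lt_0_compat; lra).
  unfold Rdiv in H. rewrite ln_mult in H by auto.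
  rewrite (ln_mult (B + 1)) in H by lra. rewrite (ln_mult l g) in H by lra.
  pose proof (ln_le_sub1 l ltac:(lra)).
  assert (ln (/ eps) <= A * l).
  { assert (Hi : ln (1 / eps) <= ln f).
    { apply ln_le; auto. unfold Rdiv. lra. }
    unfold Rdiv in Hi. rewrite Rmult_1_l in Hi. assert (ln f <= l) by apply ge1_ge. nra. }
  lra. }
assert (HLG : INR (Nat.log2 (2 * n) + Nat.log2 (2 * (N + 2)) + 1) <=
  (4 + 2 * A + 2 * (ln 2 + ln (2 * INR c0) + (2 + 2 * A) + ln (B + 1) + 1 + A + A)) * l).
{ rewrite !plus_INR. cbn [INR]. pose proof log2_scales as H.
  pose proof (ln_le_sub1 (INR K + 1) ltac:(lra)).
  assert (0 <= ln 2) by (apply ln_nonneg; lra).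
  assert (0 <= ln (2 * INR c0)) by (apply ln_nonneg; lra).
  assert (0 <= ln (B + 1)) by (apply ln_nonneg; lra). nra. }
set (P := 4 + 2 * A + 2 * (ln 2 + ln (2 * INR c0) + (2 + 2 * A) + ln (B + 1) + 1 + A + A)) in *.
rewrite !mult_INR.
replace (INR 70) with 70 by (rewrite INR_IZR_INZ; reflexivity).
replace (INR 100) with 100 by (rewrite INR_IZR_INZ; reflexivity).
set (LGr := INR (Nat.log2 (2 * n) + Nat.log2 (2 * (N + 2)) + 1)) in *.
rewrite !plus_INR. cbn [INR].
replace (1 + 1) with 2 by lra.
pose proof (pos_INR n). pose proof (pos_INR m). pose proof (pos_INR N). pose proof (pos_INR K).
assert (0 <= LGr) by apply pos_INR.
unfold soft. fold l. unfold f, preprocessing_size. fold a b g.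
apply Rle_trans with (70 * 100 * ((2 * a) * (2 * b) * ((2 + 2 * A) * l) *
  (2 * INR c0 * (2 + 2 * A) * B * (l * l * g / eps)) * (P * l))).
- apply Rmult_le_compat_l; [lra|].
  repeat (apply Rmult_le_compat; [| | |]); try lra; try nra;
    repeat apply Rmult_le_pos; lra.
- right. field. lra.
Qed.
End Bounds.

Lemma preprocess_const_pos eps_max c0 : 0 < eps_max -> (2 <= c0)%nat -> 0 <= preprocess_const eps_max c0.
Proof.
intros He Hc. apply le_INR in Hc. replace (INR 2) with 2 in Hc by (cbn; lra).
unfold preprocess_const. cbv zeta. set (A := 1 + ln (Rmax 1 eps_max)).
assert (A1 : 1 <= A) by (unfold A; pose proof (ln_nonneg _ (Rmax_l 1 eps_max)); lra).
set (B := (A + 1) * (1 + eps_max) + 2 * eps_max).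
assert (HB : 0 <= B) by (unfold B; nra).
assert (0 <= ln 2) by (apply ln_nonneg; lra).
assert (0 <= ln (2 * INR c0)) by (apply ln_nonneg; lra).
assert (0 <= ln (B + 1)) by (apply ln_nonneg; lra).
repeat apply Rmult_le_pos; lra.
Qed.

(** With B = n + m + L + 2 >= 2, all sizes are at most a numerical constant times (c0 + 1) B^4. The
    exponent c0 + 13 is spent on c0 + 1 <= 2^c0 <= B^c0, on B^4, and on B^9 >= 512 for the numerical
    constant. *)
Lemma word_room c0 n m N W eps w :
  (2 <= c0)%nat -> 0 < eps -> 1 <= W ->
  INR N <= INR (c0 * (Kof m + 1)) * (log_base (1 + eps) (INR n * W) + 2) ->
  word_size_ok (c0 + 13) n m W eps w ->
  (32 * (m + ((n + 1) * (n + 1) * (N + 2) + (m + 6) * ((N + 2) * (m + 1)) + 2 * n + 2 * m + 2 * N + 10)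
     + 2) < 2 ^ w)%nat /\ (c0 * (m + 2) < 2 ^ w)%nat /\ (6 <= w)%nat.
Proof.
intros Hc He HW HN Hws. unfold word_size_ok in Hws.
pose proof (log_base_nonneg eps n W He HW) as HL.
set (L := log_base (1 + eps) (INR n * W)) in *.
set (B := INR n + INR m + L + 2) in *.
pose proof (pos_INR n) as Pn. pose proof (pos_INR m) as Pm. pose proof (pos_INR N) as PN.
assert (HB : 2 <= B) by (unfold B; lra).
set (X := INR c0 + 1).
assert (HX : 1 <= X /\ X <= B ^ c0).
{ split; [unfold X; pose proof (pos_INR c0); lra|].
  apply Rle_trans with (2 ^ c0); [|apply pow_incr; lra].
  assert (H : (S c0 <= 2 ^ c0)%nat) by (apply Nat.pow_gt_lin_r; lia).
  apply le_INR in H. rewrite pow_INR, S_INR in H. unfold X.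
  replace (INR 2) with 2 in H by (cbn; lra). exact H. }
destruct (Kof_spec m) as (_ & HK & _). apply le_INR in HK. rewrite plus_INR in HK. cbn [INR] in HK.
assert (HNB : INR N + 2 <= X * (B * B)).
{ rewrite mult_INR, plus_INR in HN. cbn [INR] in HN.
  assert (H : INR c0 * (INR (Kof m) + 1) * (L + 2) <= INR c0 * B * B).
  { pose proof (pos_INR c0). pose proof (pos_INR (Kof m)).
    apply Rmult_le_compat; [apply Rmult_le_pos; lra | lra | | unfold B; lra].
    apply Rmult_le_compat_l; unfold B; lra. }
  unfold X. nra. }
set (Y := X * (B * B * B * B)).
assert (B2 : B <= B * B) by nra.
assert (B3 : B * B <= B * B * B) by nra.
assert (B4 : B * B * B <= B * B * B * B) by nra.
assert (Y0 : B * B * B * B <= Y) by (unfold Y; nra).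
assert (Y1 : (INR n + 1) * (INR n + 1) * (INR N + 2) <= Y).
{ apply Rle_trans with (B * B * (X * (B * B))); [|right; unfold Y; ring].
  apply Rmult_le_compat; [nra | lra | apply Rmult_le_compat; unfold B; lra | auto]. }
assert (Y2 : (INR m + 6) * ((INR N + 2) * (INR m + 1)) <= 3 * Y).
{ apply Rle_trans with (3 * B * (X * (B * B) * B)); [|right; unfold Y; ring].
  apply Rmult_le_compat; [lra | nra | unfold B; lra|].
  apply Rmult_le_compat; [lra | lra | auto | unfold B; lra]. }
assert (Y3 : X * (B * B) <= Y).
{ unfold Y. apply Rmult_le_compat_l; [lra|]. lra. }
assert (HP : 512 * Y <= 2 ^ w).
{ eapply Rle_trans; [|exact Hws]. rewrite pow_add. unfold Y.
  replace (B ^ 13) with (B ^ 9 * (B * B * B * B)) by ring.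
  assert (512 <= B ^ 9).
  { replace 512 with (2 ^ 9) by ring. apply pow_incr. lra. }
  assert (0 <= B * B * B * B) by lra.
  apply Rle_trans with (512 * (B ^ c0 * (B * B * B * B))).
  - apply Rmult_le_compat_l; [lra|]. apply Rmult_le_compat_r; lra.
  - assert (0 <= B ^ c0 * (B * B * B * B)) by (apply Rmult_le_pos; lra). nra. }
assert (Pw : INR (2 ^ w) = 2 ^ w).
{ now rewrite pow_INR. }
assert (A1 : (32 * (m + ((n + 1) * (n + 1) * (N + 2) + (m + 6) * ((N + 2) * (m + 1)) +
   2 * n + 2 * m + 2 * N + 10) + 2) < 2 ^ w)%nat).
{ apply INR_lt. rewrite Pw. eapply Rlt_le_trans; [|exact HP].
  repeat rewrite ?mult_INR, ?plus_INR.
  replace (INR 32) with 32 by (rewrite INR_IZR_INZ; reflexivity).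
  replace (INR 10) with 10 by (rewrite INR_IZR_INZ; reflexivity).
  replace (INR 6) with 6 by (rewrite INR_IZR_INZ; reflexivity).
  replace (INR 2) with 2 by (rewrite INR_IZR_INZ; reflexivity).
  replace (INR 1) with 1 by reflexivity.
  assert (INR n + INR m <= B) by (unfold B; lra). lra. }
splits; auto.
- apply INR_lt. rewrite Pw. eapply Rlt_le_trans; [|exact HP].
  rewrite mult_INR, plus_INR. replace (INR 2) with 2 by (rewrite INR_IZR_INZ; reflexivity).
  assert (INR c0 * (INR m + 2) <= X * B).
  { pose proof (pos_INR c0). apply Rmult_le_compat; unfold X, B; lra. }
  assert (X * B <= X * (B * B)) by (apply Rmult_le_compat_l; lra). nra.
- destruct (le_lt_dec 6 w) as [|Hlt]; auto. exfalso.
  assert (2 ^ w <= 2 ^ 5)%nat by (apply Nat.pow_le_mono_r; lia).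
  change (2 ^ 5)%nat with 32%nat in H. lia.
Qed.

(** The K increments of q add up to at most eps / c0. From 2 eps_max <= c0 this is at most 1/2, as
    [bernoulli_ge] requires, and from 2 <= c0 twice this amount is at most eps. *)
Lemma power_slack eps_max eps c0 K :
  0 < eps <= eps_max -> (2 <= c0)%nat -> 2 * eps_max <= INR c0 ->
  (1 + eps / INR (c0 * (K + 1))) ^ K <= 1 + eps.
Proof.
intros He Hc Hce. apply le_INR in Hc. replace (INR 2) with 2 in Hc by (cbn; lra).
rewrite mult_INR, plus_INR. cbn [INR]. pose proof (pos_INR K).
assert (D : 0 < INR c0 * (INR K + 1)) by nra.
assert (Hd : INR K * (eps / (INR c0 * (INR K + 1))) <= eps / INR c0).
{ apply Rmult_le_reg_r with (INR c0 * (INR K + 1)); auto.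
  replace (INR K * (eps / (INR c0 * (INR K + 1))) * (INR c0 * (INR K + 1))) with (INR K * eps)
    by (field; lra).
  replace (eps / INR c0 * (INR c0 * (INR K + 1))) with ((INR K + 1) * eps) by (field; lra). nra. }
assert (He2 : eps / INR c0 <= / 2 /\ 2 * (eps / INR c0) <= eps).
{ split; apply Rmult_le_reg_r with (INR c0); try lra;
    replace (2 * (eps / INR c0) * INR c0) with (2 * eps) by (field; lra) || idtac;
    replace (eps / INR c0 * INR c0) with eps by (field; lra) || idtac; nra. }
eapply Rle_trans; [apply bernoulli_ge|]; try lra.
apply Rlt_le, Rdiv_lt_0_compat; lra.
Qed.

Theorem theorem3 (eps_max : R) (heps_max : 0 < eps_max) :
  exists (preprocess update query : com) (C : R) (k c : nat),
  forall (n : nat) (W eps : R) (sigma sigma_hat : list edge) (w : nat),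
    1 <= W ->
    0 < eps <= eps_max ->
    edge_sequence n W sigma ->
    Permutation sigma sigma_hat ->
    word_size_ok c n (length sigma) W eps w ->
    forall evs : list event,
      insertions evs = sigma ->
      (forall i j, In (Query i j) evs -> (i < n)%nat /\ (j < n)%nat) ->
      runs_within w preprocess (input n W eps sigma_hat)
        (C * soft k (preprocessing_size n (length sigma) W eps))
        (serves w update query
           (C * update_size n)
           (C * query_size n (prediction_error sigma sigma_hat) W eps)
           eps [] evs).
Proof.
destruct (INR_unbounded eps_max) as [a Ha].
set (c0 := (2 * a + 2)%nat).
assert (Hc0 : (2 <= c0)%nat) by (unfold c0; lia).
assert (Hce : 2 * eps_max <= INR c0).
{ unfold c0. rewrite plus_INR, mult_INR. cbn [INR]. lra. }
(* One constant for the three bounds: 150 is the cost of an update, and 16000 is 1000 * 4^2, since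
   the window of a query gives 2 eta + 2 <= 4 [ge1] eta. *)
set (C := preprocess_const eps_max c0 + 150 + 16000 * query_const eps_max c0).
exists (preprocess c0), update, query, C, 4%nat, (c0 + 13)%nat.
intros n W eps sigma sh w HW He Hsig Hperm Hws evs Hevs Hqs.
assert (Hlen : length sigma = length sh) by (now apply Permutation_length).
rewrite Hlen. rewrite Hlen in Hws. set (m := length sh) in *. set (K := Kof m).
assert (Hj : (1 <= c0 * (K + 1))%nat) by nia.
destruct (scales_exist eps (c0 * (K + 1)) n W) as (N & HqN & HN); auto; [lra|].
destruct (word_room c0 n m N W eps w Hc0 ltac:(lra) HW HN Hws) as (Hw & Hcw & w6).
assert (Hmn : (m <= n * n)%nat) by (rewrite <- Hlen; eapply edges_le_square; eauto).
assert (Hsh : edge_sequence n W sh).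
{ destruct Hsig as [S1 S2]. split.
  - eapply Permutation_NoDup; [|exact S1]. now apply Permutation_map.
  - intros e Hin. apply S2. eapply Permutation_in; [apply Permutation_sym; exact Hperm | auto]. }
pose proof (preprocess_const_pos eps_max c0 heps_max Hc0) as Pc.
destruct (query_log eps_max c0 heps_max Hc0 n m N W eps HW He HN Hmn) as [Qc HQ].
pose proof (preprocess_time eps_max c0 heps_max Hc0 n m N W eps HW He HN) as HP.
assert (Hsoft : 0 <= soft 4 (preprocessing_size n m W eps)).
{ unfold soft, preprocessing_size.
  pose proof (proj1 (ge1_ge (INR n))). pose proof (proj1 (ge1_ge (INR m))).
  pose proof (proj1 (ge1_ge (ln W))).
  apply Rmult_le_pos; [apply Rlt_le, Rdiv_lt_0_compat; [|lra]|].
  - repeat apply Rmult_lt_0_compat; lra.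
  - apply pow_le. match goal with |- 0 <= ge1 ?x => pose proof (proj1 (ge1_ge x)) end. lra. }
eapply runs_weaken with (m := m); [exact w6 | |].
{ eapply tri_runs.
  - apply (preprocess_ok w n c0 N W eps sh); auto; try lia; try lra.
  - eapply Rle_trans; [exact HP|]. apply Rmult_le_compat_r; [auto|]. unfold C. lra. }
intros s' _ (sc & pw & Hsc & Hgeo & HMx & Htb & Hz & E9 & E10).
set (q := 1 + eps / INR (c0 * (K + 1))) in *.
set (Lim := ((n + 1) * (n + 1) * (N + 2) + (m + 6) * ((N + 2) * (m + 1)) + 2 * n + 2 * m + 2 * N + 10)%nat) in *.
destruct (ge1_ge (INR (prediction_error sigma sh))) as [G1 G2].
destruct (ge1_ge (ln (log_base (1 + eps) (INR n * W)))) as [G3 _].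
destruct (ge1_ge (ln (INR n))) as [G4 _].
apply serves_ok with (n := n) (sigma := sigma) (sh := sh) (Lim := Lim) (LS := (Nat.log2 (2 * (N + 2)) + 1)%nat) (sc := sc)
  (K := K) (q := q) (W := W) (pw := pw) (p := 0%nat) (M := 0%nat); auto; try lra; try lia;
  try fold m; try (unfold Lim; lia).
- assert (n * n * sc <= (n + 1) * (n + 1) * (N + 2))%nat by (apply Nat.mul_le_mono; [apply Nat.mul_le_mono|]; lia).
  unfold Lim. lia.
- assert (Nat.log2 (2 * sc) <= Nat.log2 (2 * (N + 2)))%nat by (apply Nat.log2_le_mono; lia). lia.
- assert (0 < eps / INR (c0 * (K + 1))).
  { apply Rdiv_lt_0_compat; [lra | apply lt_0_INR; lia]. }
  unfold q. lra.
- apply Kof_spec.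
- eapply power_slack; eauto.
- unfold update_size, C. nra.
- rewrite !mult_INR, (plus_INR _ 2), mult_INR.
  replace (INR 1000) with 1000 by (rewrite INR_IZR_INZ; reflexivity).
  replace (INR 2) with 2 by (cbn; lra).
  unfold query_size. pose proof (pos_INR (prediction_error sigma sh)) as He0.
  set (e := INR (prediction_error sigma sh)) in *. set (e1 := ge1 e) in *.
  set (g := ge1 (ln (log_base (1 + eps) (INR n * W)))) in *.
  assert (A1 : (2 * e + 2) * (2 * e + 2) <= (4 * e1) * (4 * e1)) by (apply Rmult_le_compat; lra).
  assert (A2 : (2 * e + 2) * (2 * e + 2) * INR (Nat.log2 (2 * (N + 2)) + 1) <=
    (4 * e1) * (4 * e1) * (query_const eps_max c0 * g)).
  { apply Rmult_le_compat; auto; [nra | apply pos_INR]. }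
  apply Rle_trans with (16000 * query_const eps_max c0 * (e1 ^ 2 * g)).
  + apply Rmult_le_compat_l with (r := 1000) in A2; [|lra].
    eapply Rle_trans; [exact A2|]. right. ring.
  + apply Rmult_le_compat_r; [apply Rmult_le_pos; [apply pow_le|]; lra|]. unfold C. lra.
- constructor; auto; try lia; try easy. intros k Hk. rewrite Hz in Hk. lia.
- intros i Hi. rewrite Hz. lia.
- cbn. lia.
Qed.
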